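(* There exists a morphism of $2$-coloured dg operads $\mathrm{JB}_\infty:(\mathcal{HS}_\infty,\delta)\to(\mathcal{LP}_\infty,\delta)$ making the square commutative: $$\nu\circ\mathrm{JB}_\infty=\mathrm{JB}\circ\pi,$$ where $\pi:\mathcal{HS}_\infty\to\mathcal{HS}$ and $\nu:\mathcal{LP}_\infty\to\mathcal{LP}$ are the canonical projections and $\mathrm{JB}:\mathcal{HS}\to\mathcal{LP}$ is the Jacobi–Bernoulli morphism.
   Context: Work over a field $\mathbb K$ of characteristic zero, with the Koszul sign rule. $2$-coloured operads have colours ''straight'' and ''wavy''; a representation in a pair of dg spaces $(\mathfrak g,\mathfrak h)$ is a morphism to the endomorphism operad $\mathcal End_{\mathfrak g,\mathfrak h}$, straight legs corresponding to $\mathfrak g$ and wavy legs to $\mathfrak h$. $(-1)^{\sigma(J_1\sqcup J_2)}$ is the sign of the permutation $[m]\to J_1\sqcup J_2$; $[m]=\{1,\dots,m\}$, $[p,q]=\{p,\dots,q\}$; $a(\dots,b(\dots),\dots)$ denotes $a\circ(1^{\otimes i}\otimes b\otimes1^{\otimes j})$ with the indicated relabelling. $\mathcal{HS}$: generated by a skewsymmetric $[\ ,\ ]$ (two straight inputs, straight output) and $F_n$, $n\ge0$ (one straight input, $n$ symmetric wavy inputs, wavy output), in degree $0$, modulo the Jacobi identity and $$F_n([1,2];3,\dots,n+2)+\sum_{[3,n+2]=I_1\sqcup I_2}\big(F_{|I_2|+1}(1;F_{|I_1|}(2;I_1),I_2)-F_{|I_2|+1}(2;F_{|I_1|}(1;I_1),I_2)\big)=0,\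 n\ge0.$$ $\mathcal{HS}_\infty$: the free $2$-coloured operad generated by $\ell_m$, $m\ge2$ (degree $2-m$, $m$ skewsymmetric straight inputs, straight output) and $f_{m,n}$, $m\ge1,n\ge0$ (degree $1-m$, $m$ skewsymmetric straight inputs, $n$ symmetric wavy inputs, wavy output), with differential $$\delta\ell_m=\sum_{[m]=J_1\sqcup J_2,\ |J_1|\ge2,|J_2|\ge1}(-1)^{|J_2|+1+\sigma(J_1\sqcup J_2)}\ell_{|J_2|+1}(\ell_{|J_1|}(J_1),J_2),$$ $$\delta f_{m,n}=\sum_{[m]=J_1\sqcup J_2,\ |J_1|\ge2}(-1)^{|J_2|+\sigma(J_1\sqcup J_2)}f_{|J_2|+1,n}(\ell_{|J_1|}(J_1),J_2;[m+1,m+n])$$ $$+\sum_{[m]=J_1\sqcup J_2,\ |J_1|,|J_2|\ge1;\ [m+1,m+n]=I_1\sqcup I_2}(-1)^{|J_1|(|J_2|+1)+\sigma(J_1\sqcup J_2)}f_{|J_1|,|I_1|+1}(J_1;f_{|J_2|,|I_2|}(J_2;I_2),I_1).$$ The projection $\pi$ sends $\ell_2\mapsto[\ ,\ ]$, $f_{1,n}\mapsto F_n$, and all other generators to $0$. $\mathcal{LP}$: generated in degree $0$ by skewsymmetric $[\ ,\ ]_{\mathfrak g}$ (straight), skewsymmetric $[\ ,\ ]_{\mathfrak h}$ (wavy), and $\phi$ (one straight input, wavy output), modulo the two Jacobi identities and $\phi([1,2]_{\mathfrak g})=[\phi(1),\phi(2)]_{\mathfrak h}$. $\mathcal{LP}_\infty$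 (the minimal resolution of $\mathcal{LP}$): the free $2$-coloured operad generated by corollas with skewsymmetric inputs: $\ell_m$, $m\ge2$ (straight inputs and output, degree $2-m$), $\lambda_n$, $n\ge2$ (wavy inputs and output, degree $2-n$), $\phi_p$, $p\ge1$ (straight inputs, wavy output, degree $1-p$), with the differential for which dg representations in $(\mathfrak g,\mathfrak h)$ are precisely the $L_\infty$-structures $\{\ell_m\}$ on $\mathfrak g$ and $\{\lambda_n\}$ on $\mathfrak h$ (extending the given differentials) together with an $L_\infty$-morphism $\{\phi_p\}:\mathfrak g\to\mathfrak h$ (a morphism of dg coalgebras $\odot^{\ge1}(\mathfrak g[1])\to\odot^{\ge1}(\mathfrak h[1])$). The projection $\nu$ sends $\ell_2\mapsto[\ ,\ ]_{\mathfrak g}$, $\lambda_2\mapsto[\ ,\ ]_{\mathfrak h}$, $\phi_1\mapsto\phi$, and all other generators to $0$. $\mathrm{JB}:\mathcal{HS}\to\mathcal{LP}$ is the morphism with $[\ ,\ ]\mapsto[\ ,\ ]_{\mathfrak g}$ and $$F_n\mapsto\frac{B_n}{n!}\sum_{\sigma\in\mathbb S_n}[\dots[[\phi(1),\sigma(1)+1]_{\mathfrak h},\sigma(2)+1]_{\mathfrak h}\dots,\sigma(n)+1]_{\mathfrak h},\qquad \sum_{n\ge0}\tfrac{B_n}{n!}z^n=\tfrac{z}{e^z-1},$$ the wavy inputs of $F_n$ being labelled $2,\dots,n+1$. *)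

(* Defs.v *)
From HB Require Import structures.
From mathcomp Require Import all_boot all_order all_algebra perm.
From mathcomp Require Import finmap boolp.
Set Implicit Arguments.
Unset Strict Implicit.
Unset Printing Implicit Defensive.
Import GRing.Theory.
Local Open Scope quotient_scope.
Local Open Scope fset_scope.
Local Open Scope ring_scope.

Inductive colour := Straight | Wavy.

Definition colour_to_bool c := if c is Straight then true else false.
Definition colour_of_bool (b : bool) := if b then Straight else Wavy.
Lemma colour_to_boolK : cancel colour_to_bool colour_of_bool.
Proof. by case. Qed.
HB.instance Definition _ := Countable.copy colour (can_type colour_to_boolK).

(* Operads are presented by their components on finite sets of labels
   (coordinate-free partial compositions); a label carries its colour. *)
Definition label := (colour * nat)%type.

Definition renaming := colour -> nat -> nat.

Definition rename (f : renaming) (x : label) : label := (x.1, f x.1 x.2).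

Definition relabels (f : renaming) (A D : {fset label}) : Prop :=
  {in A &, injective (rename f)} /\ D = rename f @` A.

Definition graft (A : {fset label}) (x : label) (B D : {fset label}) : Prop :=
  [/\ x \in A, [disjoint A `\ x & B] & D = (A `\ x) `|` B].

Definition koszul (K : fieldType) (d e : int) : K := (-1) ^+ absz (d * e).

(* A 2-coloured Z-graded symmetric operad over K.  [ocar A c d] is the
   degree d part of the space of operations with output colour c whose inputs
   are labelled by A.  [ocomp c' z a b] is the partial composition of b into
   the input (c', z) of a, and [orel f] is the action of relabellings; both
   are made total by the value 0 when the labels or the degrees of the source
   and of the target do not match. *)
Record operad (K : fieldType) := Operad {
  ocar :> {fset label} -> colour -> int -> lmodType K;
  ounit : forall (c : colour) (z : nat), ocar [fset (c, z)] c 0;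
  ocomp : forall A B D c c' (z : nat) d1 d2 d,
    ocar A c d1 -> ocar B c' d2 -> ocar D c d;
  orel : forall (f : renaming) A D c d, ocar A c d -> ocar D c d;
  ocomp_out : forall A B D c c' z d1 d2 d (a : ocar A c d1) (b : ocar B c' d2),
    ~ (graft A (c', z) B D /\ d1 + d2 = d) -> ocomp D z d a b = 0;
  ocomp_linearl : forall A B D c c' z d1 d2 d k (a a' : ocar A c d1)
      (b : ocar B c' d2),
    ocomp D z d (k *: a + a') b = k *: ocomp D z d a b + ocomp D z d a' b;
  ocomp_linearr : forall A B D c c' z d1 d2 d k (a : ocar A c d1)
      (b b' : ocar B c' d2),
    ocomp D z d a (k *: b + b') = k *: ocomp D z d a b + ocomp D z d a b';
  orel_out : forall f A D c d (a : ocar A c d),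
    ~ relabels f A D -> orel f D a = 0;
  orel_linear : forall f A D c d k (a a' : ocar A c d),
    orel f D (k *: a + a') = k *: orel f D a + orel f D a';
  orel_ext : forall f g A D c d (a : ocar A c d),
    {in A, rename f =1 rename g} -> orel f D a = orel g D a;
  orel_id : forall A c d (a : ocar A c d), orel (fun=> id) A a = a;
  orel_trans : forall f g A B D c d (a : ocar A c d),
    relabels f A B -> relabels g B D ->
    orel g D (orel f B a) = orel (fun c i => g c (f c i)) D a;
  orel_unit : forall f c z,
    orel f [fset (c, f c z)] (ounit c z) = ounit c (f c z);
  (* the three renamings f, g, h agree wherever they have to, but g may give
     a new name to the slot z that disappears in the composition *)
  orel_comp : forall f g h A A' B B' D D' c c' z d1 d2 d
      (a : ocar A c d1) (b : ocar B c' d2),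
    graft A (c', z) B D -> graft A' (c', g c' z) B' D' ->
    relabels f D D' -> relabels g A A' -> relabels h B B' ->
    {in A `\ (c', z), rename f =1 rename g} -> {in B, rename f =1 rename h} ->
    orel f D' (ocomp D z d a b) =
    ocomp D' (g c' z) d (orel g A' a) (orel h B' b);
  ocomp_unitl : forall B c z d (b : ocar B c d),
    ocomp B z d (ounit c z) b = b;
  ocomp_unitr : forall A c c' z d (a : ocar A c d),
    (c', z) \in A -> ocomp A z d a (ounit c' z) = a;
  ocomp_seqA : forall A B C D E G c c1 c2 z1 z2 d1 d2 d3 d12 d23 d
      (a : ocar A c d1) (b : ocar B c1 d2) (e : ocar C c2 d3),
    graft A (c1, z1) B D -> graft D (c2, z2) C E ->
    graft B (c2, z2) C G -> graft A (c1, z1) G E ->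
    d1 + d2 = d12 -> d12 + d3 = d -> d2 + d3 = d23 ->
    ocomp E z2 d (ocomp D z1 d12 a b) e = ocomp E z1 d a (ocomp G z2 d23 b e);
  ocomp_parA : forall A B C D E G c c1 c2 z1 z2 d1 d2 d3 d12 d13 d
      (a : ocar A c d1) (b : ocar B c1 d2) (e : ocar C c2 d3),
    (c1, z1) != (c2, z2) ->
    (c1, z1) \in A -> (c2, z2) \in A ->
    graft A (c1, z1) B D -> graft D (c2, z2) C E ->
    graft A (c2, z2) C G -> graft G (c1, z1) B E ->
    d1 + d2 = d12 -> d12 + d3 = d -> d1 + d3 = d13 ->
    ocomp E z2 d (ocomp D z1 d12 a b) e =
    koszul K d2 d3 *: ocomp E z1 d (ocomp G z2 d13 a e) b
}.
Arguments ounit {K} o c z.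
Arguments ocomp {K o A B D c} c' z {d1 d2 d} a b.
Arguments orel {K o} f {A D c d} a.

Record morphism (K : fieldType) (O P : operad K) := Morphism {
  mmap : forall A c d, O A c d -> P A c d;
  mmap_linear : forall A c d k (a b : O A c d),
    mmap (k *: a + b) = k *: mmap a + mmap b;
  mmap_unit : forall c z, mmap (ounit O c z) = ounit P c z;
  mmap_comp : forall A B D c c' z d1 d2 d (a : O A c d1) (b : O B c' d2),
    mmap (ocomp c' z a b : O D c d) = ocomp c' z (mmap a) (mmap b);
  mmap_rel : forall f A D c d (a : O A c d),
    mmap (orel f a : O D c d) = orel f (mmap a)
}.

Arguments mmap {K O P} h {A c d} a : rename.

Record differential (K : fieldType) (O : operad K) := Differential {
  dmap : forall A c d, O A c d -> O A c (d + 1);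
  dmap_linear : forall A c d k (a b : O A c d),
    dmap (k *: a + b) = k *: dmap a + dmap b;
  dmap_sq0 : forall A c d (a : O A c d), dmap (dmap a) = 0;
  dmap_rel : forall f A D c d (a : O A c d),
    dmap (orel f a : O D c d) = orel f (dmap a);
  dmap_comp : forall A B D c c' z d1 d2 d (a : O A c d1) (b : O B c' d2),
    dmap (ocomp c' z a b : O D c d) =
    ocomp c' z (dmap a) b + koszul K 1 d1 *: ocomp c' z a (dmap b)
}.

Arguments dmap {K O} d {A c d} a : rename.

Definition dg_morphism (K : fieldType) (O P : operad K) (dO : differential O)
    (dP : differential P) (h : morphism O P) : Prop :=
  forall A c d (a : O A c d), mmap h (dmap dO a) = dmap dP (mmap h a).

Definition nin (A : {fset label}) (c : colour) : nat :=
  #|` [fset x in A | x.1 == c] |.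

(* A family [g] of generating corollas: one corolla, of degree [gdeg g m n],
   for each allowed number m of straight and n of wavy inputs; its inputs of
   colour c are skewsymmetric if [gskew g c] and symmetric otherwise. *)
Record signature := Signature {
  gen : Type;
  gout : gen -> colour;
  gok : gen -> nat -> nat -> bool;
  gdeg : gen -> nat -> nat -> int;
  gskew : gen -> colour -> bool
}.

Definition valid (S : signature) (g : gen S) (A : {fset label}) (d : int) :=
  gok g (nin A Straight) (nin A Wavy) &&
  (d == gdeg g (nin A Straight) (nin A Wavy)).

Definition inversions (S : signature) (g : gen S) (f : renaming)
    (A : {fset label}) : nat :=
  \sum_(x <- A) \sum_(y <- A)
    [&& x.1 == y.1, gskew g x.1, (x.2 < y.2)%N &
        ((rename f y).2 < (rename f x).2)%N].

(* [I g A d] is the corolla g whose inputs are labelled by A, in increasing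
   order within each colour, if such a corolla exists and has degree d, and 0
   otherwise. *)
Record interp (K : fieldType) (S : signature) (P : operad K) := Interp {
  ival :> forall (g : gen S) A d, P A (gout g) d;
  ival_out : forall g A d, ~~ valid g A d -> ival g A d = 0;
  ival_rel : forall f g A D d, relabels f A D ->
    orel f (ival g A d) = (-1) ^+ inversions g f A *: ival g D d
}.

Section Presentation.
Variables (K : fieldType) (S : signature).

Inductive expr : {fset label} -> colour -> int -> Type :=
| Ezero A c d : expr A c d
| Eadd A c d : expr A c d -> expr A c d -> expr A c d
| Escale A c d : K -> expr A c d -> expr A c d
| Eunit (c : colour) (z : nat) : expr [fset (c, z)] c 0
| Ecomp A B D c c' (z : nat) d1 d2 d :
    expr A c d1 -> expr B c' d2 -> expr D c d
| Erel (f : renaming) A D c d : expr A c d -> expr D c d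
| Egen (g : gen S) A d : expr A (gout g) d.

Fixpoint eval (P : operad K) (I : interp S P) A c d (e : expr A c d) :
    P A c d :=
  match e with
  | Ezero _ _ _ => 0
  | Eadd _ _ _ e1 e2 => eval I e1 + eval I e2
  | Escale _ _ _ k e1 => k *: eval I e1
  | Eunit c z => ounit P c z
  | Ecomp _ _ _ _ c' z _ _ _ e1 e2 => ocomp c' z (eval I e1) (eval I e2)
  | Erel f _ _ _ _ e1 => orel f (eval I e1)
  | Egen g A d => I g A d
  end.

Definition relators := forall A c d, expr A c d -> Prop.

Variable R : relators.

Definition model (P : operad K) (I : interp S P) : Prop :=
  forall A c d (e : expr A c d), R e -> eval I e = 0.

Section Carrier.
Variables (A : {fset label}) (c : colour) (d : int).

HB.instance Definition _ := gen_eqMixin (expr A c d).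
HB.instance Definition _ := gen_choiceMixin (expr A c d).

(* By completeness of equational reasoning, two expressions have the same
   value in every operad satisfying the relators iff they are identified by
   the operad axioms and the relators. *)
Definition eqmod (e e' : expr A c d) : bool :=
  `[< forall (P : operad K) (I : interp S P), model I ->
        eval I e = eval I e' >].

Lemma eqmod_equiv : equiv_class_of eqmod.
Proof.
split.
- by move=> e; apply/asboolP.
- move=> e e'; apply/asboolP/asboolP => h P I m; exact/esym/h.
- move=> e2 e1 e3 /asboolP h1 /asboolP h2.
  by apply/asboolP => P I m; rewrite h1// h2.
Qed.

Canonical eqmod_rel := EquivRelPack eqmod_equiv.

Definition qcar := {eq_quot eqmod_rel}.

HB.instance Definition _ := Choice.on qcar.

Definition qeval (P : operad K) (I : interp S P) (x : qcar) : P A c d :=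
  eval I (repr x).

Definition qclass (e : expr A c d) : qcar := \pi e.

Lemma qevalE (P : operad K) (I : interp S P) e :
  model I -> qeval I (qclass e) = eval I e.
Proof.
move=> m; have /eqmodP/asboolP h : repr (qclass e) = e %[mod qcar].
  by rewrite reprK.
exact: h.
Qed.

Lemma qcarP (x y : qcar) :
  (forall (P : operad K) (I : interp S P), model I -> qeval I x = qeval I y) ->
  x = y.
Proof.
move=> h; rewrite -[x]reprK -[y]reprK; apply/eqmodP/asboolP; exact: h.
Qed.

Definition qzero : qcar := qclass (Ezero A c d).
Definition qadd (x y : qcar) := qclass (Eadd (repr x) (repr y)).
Definition qscale k (x : qcar) := qclass (Escale k (repr x)).
Definition qopp (x : qcar) := qscale (-1) x.

Lemma qaddE (P : operad K) (I : interp S P) x y :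
  model I -> qeval I (qadd x y) = qeval I x + qeval I y.
Proof. by move=> m; rewrite qevalE. Qed.

Lemma qscaleE (P : operad K) (I : interp S P) k x :
  model I -> qeval I (qscale k x) = k *: qeval I x.
Proof. by move=> m; rewrite qevalE. Qed.

Lemma qaddA : associative qadd.
Proof. by move=> x y z; apply: qcarP => P I m; rewrite !qaddE// addrA. Qed.
Lemma qaddC : commutative qadd.
Proof. by move=> x y; apply: qcarP => P I m; rewrite !qaddE// addrC. Qed.
Lemma qadd0 : left_id qzero qadd.
Proof. by move=> x; apply: qcarP => P I m; rewrite !qaddE// qevalE//= add0r. Qed.
Lemma qaddN : left_inverse qzero qopp qadd.
Proof.
move=> x; apply: qcarP => P I m.
by rewrite qaddE// qscaleE// qevalE//= scaleN1r addNr.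
Qed.

HB.instance Definition _ := GRing.isZmodule.Build qcar qaddA qaddC qadd0 qaddN.

Lemma qscaleA k l x : qscale k (qscale l x) = qscale (k * l) x.
Proof. by apply: qcarP => P I m; rewrite !qscaleE// scalerA. Qed.
Lemma qscale1 : left_id 1 qscale.
Proof. by move=> x; apply: qcarP => P I m; rewrite qscaleE// scale1r. Qed.
Lemma qscaleDr : right_distributive qscale +%R.
Proof.
move=> k x y; apply: qcarP => P I m.
by rewrite qscaleE// !qaddE// !qscaleE// scalerDr.
Qed.
Lemma qscaleDl x : {morph qscale^~ x : k l / k + l}.
Proof.
move=> k l; apply: qcarP => P I m.
by rewrite qscaleE// qaddE// !qscaleE// scalerDl.
Qed.

HB.instance Definition _ := GRing.Zmodule_isLmodule.Build K qcar
  qscaleA qscale1 qscaleDr qscaleDl.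

Lemma qeval_linear (P : operad K) (I : interp S P) k (x y : qcar) :
  model I -> qeval I (k *: x + y) = k *: qeval I x + qeval I y.
Proof. by move=> m; rewrite qaddE// qscaleE. Qed.

Lemma qeval0 (P : operad K) (I : interp S P) :
  model I -> qeval I (0 : qcar) = 0.
Proof. by move=> m; rewrite qevalE. Qed.

End Carrier.

Definition qunit c z : qcar [fset (c, z)] c 0 := qclass (Eunit c z).
Definition qcomp A B D c c' z d1 d2 d (x : qcar A c d1) (y : qcar B c' d2) :
  qcar D c d := qclass (Ecomp D z d (repr x) (repr y)).
Definition qrel f A D c d (x : qcar A c d) : qcar D c d :=
  qclass (Erel f D (repr x)).

Section Eval.
Variables (P : operad K) (I : interp S P).
Hypothesis m : model I.
Lemma qunitE c z : qeval I (qunit c z) = ounit P c z.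
Proof. by rewrite qevalE. Qed.
Lemma qcompE A B D c c' z d1 d2 d (x : qcar A c d1) (y : qcar B c' d2) :
  qeval I (qcomp D z d x y) = ocomp c' z (qeval I x) (qeval I y).
Proof. by rewrite qevalE. Qed.
Lemma qrelE f A D c d (x : qcar A c d) :
  qeval I (qrel f D x) = orel f (qeval I x).
Proof. by rewrite qevalE. Qed.
Definition qevalsE := (qcompE, qrelE, qunitE).
End Eval.

(* The operad generated by the signature S, subject to the relators R. *)
Definition presented : operad K.
Proof.
refine (@Operad K (fun A c d => qcar A c d) qunit qcomp qrel
  _ _ _ _ _ _ _ _ _ _ _ _ _ _); intros; apply: qcarP => P I m;
  rewrite ?(qeval_linear, qscaleE, qevalsE, qeval0)//.
- exact: ocomp_out.
- exact: ocomp_linearl.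
- exact: ocomp_linearr.
- exact: orel_out.
- exact: orel_linear.
- exact: orel_ext.
- exact: orel_id.
- exact: orel_trans.
- exact: orel_unit.
- exact: orel_comp.
- exact: ocomp_unitl.
- exact: ocomp_unitr.
- exact: (ocomp_seqA (D := D) (G := G)).
- exact: (ocomp_parA (D := D) (G := G)).
Defined.

Definition gen_interp : interp S presented.
Proof.
refine (@Interp K S presented (fun g A d => qclass (Egen g A d)) _ _).
- move=> g A d v; apply: qcarP => P I m.
  by rewrite qeval0// qevalE//= ival_out.
- move=> f g A D d v; apply: qcarP => P I m.
  by rewrite qrelE// qscaleE// !qevalE//=; exact: ival_rel.
Defined.

Lemma eval_gen A c d (e : expr A c d) : eval gen_interp e = qclass e.
Proof.
elim: e => [{}A {}c {}d|{}A {}c {}d e1 IH1 e2 IH2|{}A {}c {}d k e1 IH1|c0 z||f|]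
  => [|||//|B B' D c0 c' z d1 d2 d0 e1 IH1 e2 IH2|B D c0 d0 e1 IH1|//] /=.
all: rewrite ?IH1 ?IH2; apply: qcarP => P I m.
- by rewrite qeval0// qevalE.
- by rewrite qaddE// !qevalE.
- by rewrite qscaleE// !qevalE.
- by rewrite qcompE// !qevalE.
- by rewrite qrelE// !qevalE.
Qed.

Lemma gen_model : model gen_interp.
Proof.
move=> A c d e Re; rewrite eval_gen; apply: qcarP => P I m.
by rewrite qevalE// qeval0// m.
Qed.

(* The morphism determined by the values of the generators. *)
Definition lift (P : operad K) (I : interp S P) (m : model I) :
  morphism presented P.
Proof.
refine (@Morphism K presented P (fun A c d => @qeval A c d P I) _ _ _ _).
- by move=> *; exact: qeval_linear.
- by move=> *; exact: qunitE.
- by move=> *; exact: qcompE.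
- by move=> *; exact: qrelE.
Defined.

Lemma lift_gen (P : operad K) (I : interp S P) (m : model I) g A d :
  mmap (lift m) (gen_interp g A d) = I g A d.
Proof. exact: qevalE. Qed.

Lemma lift_unique (P : operad K) (h h' : morphism presented P) :
  (forall g A d, mmap h (gen_interp g A d) = mmap h' (gen_interp g A d)) ->
  forall A c d (x : presented A c d), mmap h x = mmap h' x.
Proof.
move=> hh A c d x; rewrite -[x]reprK -/(qclass _) -eval_gen.
have m0 (k : morphism presented P) B c0 d0 :
    mmap k (0 : presented B c0 d0) = 0.
  by have := mmap_linear k (-1) 0 (0 : presented B c0 d0);
     rewrite !scaleN1r oppr0 !addr0 addNr.
have mD (k : morphism presented P) B c0 d0 (a b : presented B c0 d0) :
    mmap k (a + b) = mmap k a + mmap k b.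
  by have := mmap_linear k 1 a b; rewrite !scale1r.
have mZ (k : morphism presented P) B c0 d0 l (a : presented B c0 d0) :
    mmap k (l *: a) = l *: mmap k a.
  by have := mmap_linear k l a 0; rewrite m0 !addr0.
elim: (repr x) => //= *; rewrite ?m0 ?mD ?mZ ?mmap_unit ?mmap_comp ?mmap_rel//;
  congruence.
Qed.

End Presentation.
Arguments Ezero {K S A c d}.
Arguments Ecomp {K S A B D c} c' z {d1 d2 d}.
Arguments Egen K {S} g A d.
Arguments gen_interp {K S} R.

Definition free (K : fieldType) (S : signature) : operad K :=
  presented (fun A c d (_ : expr K S A c d) => False).

Definition free_interp (K : fieldType) (S : signature) : interp S (free K S) :=
  gen_interp _.
Arguments free_interp K {S}.

Definition Esub (K : fieldType) (S : signature) A c d (e e' : expr K S A c d) :=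
  Eadd e (Escale (-1) e').

Definition Esum (K : fieldType) (S : signature) A c d
    (s : seq (expr K S A c d)) : expr K S A c d :=
  foldr (@Eadd K S A c d) Ezero s.

(* (c, i), ..., (c, i + n - 1) *)
Definition labels (c : colour) (i n : nat) : {fset label} :=
  [fset (c, k) | k in iota i n].

(* The sign of the permutation listing J1 increasingly, then J2, is
   (-1) ^+ shuffle J1 J2.  *)
Definition shuffle (J1 J2 : {fset label}) : nat :=
  \sum_(a <- J1) \sum_(b <- J2) (b.2 < a.2)%N.

(* All inputs are numbered from 1 on, so that the name 0 is free for the slot
   (of either colour) at which a composition is made; being the smallest name
   it labels the first input of a corolla. *)

(* [[1,2],3] - [[1,3],2] + [[2,3],1] *)
Definition jacobi (K : fieldType) (S : signature) (c : colour)
    (b : forall A d, expr K S A c d) : expr K S (labels c 1 3) c 0 :=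
  let bb (i j k : nat) := Ecomp c 0 (b [fset (c, 0%N); (c, k)] 0)
                            (b [fset (c, i); (c, j)] 0) in
  Eadd (Esub (bb 1 2 3)%N (bb 1 3 2)%N) (bb 2 3 1)%N.

Inductive HS_gen := HS_br | HS_F.

Definition HS_sig : signature := {|
  gen := HS_gen;
  gout g := match g with HS_br => Straight | HS_F => Wavy end;
  gok g m n := match g with
               | HS_br => (m == 2) && (n == 0)
               | HS_F => m == 1
               end%N;
  gdeg g m n := 0;
  gskew g c := c == Straight
|}.

Section HS.
Variable K : fieldType.

Let br A d : expr K HS_sig A Straight d := Egen K (HS_br : gen HS_sig) A d.
Let F A d : expr K HS_sig A Wavy d := Egen K (HS_F : gen HS_sig) A d.

Definition HS_action n :
    expr K HS_sig (labels Straight 1 2 `|` labels Wavy 3 n) Wavy 0 :=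
  let W := labels Wavy 3 n in
  let FF (i j : nat) V : expr K HS_sig (labels Straight 1 2 `|` W) Wavy 0 :=
    Ecomp Wavy 0
    (F ((Straight, i) |` ((Wavy, 0%N) |` (W `\` V))) 0)
    (F ((Straight, j) |` V) 0) in
  Eadd (Ecomp Straight 0 (F ((Straight, 0%N) |` W) 0)
                         (br (labels Straight 1 2) 0))
       (Esum [seq Esub (FF 1 2 V) (FF 2 1 V) | V <- fpowerset W])%N.

Inductive HS_rel : relators K HS_sig :=
| HS_rel_jacobi : HS_rel (jacobi br)
| HS_rel_action n : HS_rel (HS_action n).

Definition HS : operad K := presented HS_rel.

End HS.

Definition HS_bracket K A d : HS K A Straight d :=
  gen_interp (@HS_rel K) (HS_br : gen HS_sig) A d.
Definition HS_op K A d : HS K A Wavy d := gen_interp (@HS_rel K) (HS_F : gen HS_sig) A d.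

Inductive LP_gen := LP_brg | LP_brh | LP_phi.

Definition LP_sig : signature := {|
  gen := LP_gen;
  gout g := match g with LP_brg => Straight | LP_brh | LP_phi => Wavy end;
  gok g m n := match g with
               | LP_brg => (m == 2) && (n == 0)
               | LP_brh => (m == 0) && (n == 2)
               | LP_phi => (m == 1) && (n == 0)
               end%N;
  gdeg g m n := 0;
  gskew g c := true
|}.

Section LP.
Variable K : fieldType.

Let brg A d : expr K LP_sig A Straight d := Egen K (LP_brg : gen LP_sig) A d.
Let brh A d : expr K LP_sig A Wavy d := Egen K (LP_brh : gen LP_sig) A d.
Let phi A d : expr K LP_sig A Wavy d := Egen K (LP_phi : gen LP_sig) A d.

Definition LP_hom : expr K LP_sig (labels Straight 1 2) Wavy 0 :=
  Esub (Ecomp Straight 0 (phi [fset (Straight, 0%N)] 0)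
                         (brg (labels Straight 1 2) 0))
       (Ecomp Wavy 2
         (Ecomp Wavy 1 (brh (labels Wavy 1 2) 0) (phi [fset (Straight, 1%N)] 0)
           : expr K LP_sig [fset (Straight, 1%N); (Wavy, 2%N)] Wavy 0)
         (phi [fset (Straight, 2%N)] 0)).

Inductive LP_rel : relators K LP_sig :=
| LP_rel_jacobig : LP_rel (jacobi brg)
| LP_rel_jacobih : LP_rel (jacobi brh)
| LP_rel_hom : LP_rel LP_hom.

Definition LP : operad K := presented LP_rel.

End LP.

Definition LP_bracketg K A d : LP K A Straight d :=
  gen_interp (@LP_rel K) (LP_brg : gen LP_sig) A d.
Definition LP_bracketh K A d : LP K A Wavy d :=
  gen_interp (@LP_rel K) (LP_brh : gen LP_sig) A d.
Definition LP_map K A d : LP K A Wavy d := gen_interp (@LP_rel K) (LP_phi : gen LP_sig) A d.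

Inductive HSinf_gen := HSinf_l | HSinf_f.

Definition HSinf_sig : signature := {|
  gen := HSinf_gen;
  gout g := match g with HSinf_l => Straight | HSinf_f => Wavy end;
  gok g m n := match g with
               | HSinf_l => (2 <= m) && (n == 0)
               | HSinf_f => 1 <= m
               end%N;
  gdeg g m n := match g with
                | HSinf_l => 2 - m%:Z
                | HSinf_f => 1 - m%:Z
                end;
  gskew g c := c == Straight
|}.

Inductive LPinf_gen := LPinf_l | LPinf_lam | LPinf_phi.

Definition LPinf_sig : signature := {|
  gen := LPinf_gen;
  gout g := match g with LPinf_l => Straight | LPinf_lam | LPinf_phi => Wavy end;
  gok g m n := match g with
               | LPinf_l => (2 <= m) && (n == 0)
               | LPinf_lam => (m == 0) && (2 <= n)
               | LPinf_phi => (1 <= m) && (n == 0)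
               end%N;
  gdeg g m n := match g with
                | LPinf_l => 2 - m%:Z
                | LPinf_lam => 2 - n%:Z
                | LPinf_phi => 1 - m%:Z
                end;
  gskew g c := true
|}.

Definition HSinf (K : fieldType) : operad K := free K HSinf_sig.
Definition LPinf (K : fieldType) : operad K := free K LPinf_sig.

Definition HSinf_ell K A d : HSinf K A Straight d := free_interp K (HSinf_l : gen HSinf_sig) A d.
Definition HSinf_op K A d : HSinf K A Wavy d := free_interp K (HSinf_f : gen HSinf_sig) A d.
Definition LPinf_ell K A d : LPinf K A Straight d := free_interp K (LPinf_l : gen LPinf_sig) A d.
Definition LPinf_lambda K A d : LPinf K A Wavy d := free_interp K (LPinf_lam : gen LPinf_sig) A d.
Definition LPinf_map K A d : LPinf K A Wavy d := free_interp K (LPinf_phi : gen LPinf_sig) A d.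

Section Differentials.
Variable K : fieldType.

Section Linfinity.
Variable O : operad K.

(* sum of  +- l(l(J), A \ J) *)
Definition Linf_sum (c : colour) (l : forall A d, O A c d)
    (A : {fset label}) d : O A c d :=
  \sum_(J <- fpowerset A | (2 <= #|` J|)%N && (1 <= #|` A `\` J|)%N)
    (-1) ^+ (#|` A `\` J| + 1 + shuffle J (A `\` J)) *:
    ocomp c 0 (l ((c, 0%N) |` (A `\` J)) (2 - (#|` A `\` J| + 1)%N%:Z))
              (l J (2 - #|` J|%:Z)).

(* sum of  +- h(l(J), A \ J; W) *)
Definition Linf_src_sum (l : forall A d, O A Straight d)
    (h : forall A d, O A Wavy d) (A W D : {fset label}) d : O D Wavy d :=
  \sum_(J <- fpowerset A | (2 <= #|` J|)%N)
    (-1) ^+ (#|` A `\` J| + shuffle J (A `\` J)) *: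
    ocomp Straight 0
      (h (((Straight, 0%N) |` (A `\` J)) `|` W) (1 - (#|` A `\` J| + 1)%N%:Z))
      (l J (2 - #|` J|%:Z)).

End Linfinity.

(* sum of  +- f(J; f(A \ J; W \ V), V) *)
Definition HSinf_action_sum (A W : {fset label}) d : HSinf K (A `|` W) Wavy d :=
  \sum_(J <- fpowerset A | (1 <= #|` J|)%N && (1 <= #|` A `\` J|)%N)
  \sum_(V <- fpowerset W)
    (-1) ^+ (#|` J| * (#|` A `\` J| + 1) + shuffle J (A `\` J)) *:
    ocomp Wavy 0
      (HSinf_op K (J `|` ((Wavy, 0%N) |` V)) (1 - #|` J|%:Z))
      (HSinf_op K ((A `\` J) `|` (W `\` V)) (1 - #|` A `\` J|%:Z)).

Definition HSinf_differential (D : differential (HSinf K)) : Prop :=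
  (forall m, (2 <= m)%N ->
     dmap D (HSinf_ell K (labels Straight 1 m) (2 - m%:Z)) =
     Linf_sum (HSinf_ell K) _ _)
  /\
  (forall m n, (1 <= m)%N ->
     let A := labels Straight 1 m in
     let W := labels Wavy m.+1 n in
     dmap D (HSinf_op K (A `|` W) (1 - m%:Z)) =
     Linf_src_sum (HSinf_ell K) (HSinf_op K) A W _ _ + HSinf_action_sum A W _).

(* [lambda_phi [:: J_k; ...; J_1]] is lambda_k(phi(J_1), ..., phi(J_k)), that
   is lambda_k \o (phi (x) ... (x) phi): the slots (Wavy, 1), ..., (Wavy, k)
   of lambda_k are filled successively, starting from the first one. *)
Fixpoint lambda_phi (Js : seq {fset label}) (D : {fset label}) (d : int) :
    LPinf K D Wavy d :=
  if Js is J :: Js' then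
    ocomp Wavy (size Js)
      (lambda_phi Js' ((Wavy, size Js) |` (D `\` J)) (d - (1 - #|` J|%:Z)))
      (LPinf_map K J (1 - #|` J|%:Z))
  else LPinf_lambda K D d.

Definition block m k (b : {ffun 'I_m -> 'I_k}) (a : 'I_k) : {fset label} :=
  [fset (Straight, (nat_of_ord i).+1) | i in 'I_m & b i == a].

(* Shuffle sign and Koszul sign of an ordered partition J_1, ..., J_k. *)
Definition block_sign m k (b : {ffun 'I_m -> 'I_k}) : nat :=
  \sum_(a < k) \sum_(a' < k | (a < a')%N)
    (#|` block b a| * (#|` block b a'| + 1) + shuffle (block b a) (block b a')).

(* sum over unordered partitions  +- lambda_k(phi(J_1), ..., phi(J_k)), k >= 2,
   written as a sum over ordered partitions (the fibres of a surjection b onto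
   'I_k) divided by k!.  The signs come from the equation
     sum Phi(b(J), A \ J) = sum b'_k(Phi(J_1), ..., Phi(J_k))
   of a morphism of dg coalgebras, where b, b' and Phi are the components of
   the codifferentials and of the morphism on the symmetric coalgebras of the
   suspensions, through (s being the suspension, of degree -1)
     l_m = - (-1)^(m(m-1)/2) s^-1 b_m (s (x) ... (x) s),
     phi_p = (-1)^(p(p-1)/2) s^-1 Phi_p (s (x) ... (x) s),
   and lambda_n as l_m; the same substitution turns the codifferential
   equation into the one of [Linf_sum]. *)
Definition LPinf_target_sum m d : LPinf K (labels Straight 1 m) Wavy d :=
  \sum_(2 <= k < m.+1) (k`!%:R)^-1 *:
    \sum_(b : {ffun 'I_m -> 'I_k} | [forall a, a \in codom b])
      (-1) ^+ block_sign b *: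
      lambda_phi (rev [seq block b a | a <- enum 'I_k]) _ _.

Definition LPinf_differential (D : differential (LPinf K)) : Prop :=
  [/\ forall m, (2 <= m)%N ->
        dmap D (LPinf_ell K (labels Straight 1 m) (2 - m%:Z)) =
        Linf_sum (LPinf_ell K) _ _,
      forall n, (2 <= n)%N ->
        dmap D (LPinf_lambda K (labels Wavy 1 n) (2 - n%:Z)) =
        Linf_sum (LPinf_lambda K) _ _
    & forall p, (1 <= p)%N ->
        dmap D (LPinf_map K (labels Straight 1 p) (1 - p%:Z)) =
        Linf_src_sum (LPinf_ell K) (LPinf_map K)
          (labels Straight 1 p) fset0 _ _
        - LPinf_target_sum p _].

End Differentials.

Section Projections.
Variable K : fieldType.

(* [HS_bracket A d] vanishes unless A consists of two straight labels and
   d = 0, and similarly for the other generators, so that ell_m with m > 2,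
   f_{m,n} with m > 1, etc. are sent to 0. *)
Definition HS_projection_interp : interp HSinf_sig (HS K).
Proof.
refine (@Interp K HSinf_sig (HS K)
  (fun g => match g return forall A d, HS K A (gout (g : gen HSinf_sig)) d with
            | HSinf_l => @HS_bracket K
            | HSinf_f => @HS_op K
            end) _ _).
- case=> A d nv.
  + apply: (@ival_out _ _ _ (gen_interp (@HS_rel K)) HS_br).
    by apply: contra nv; case/andP=> /andP[/eqP h1 /eqP h2] /eqP->;
       rewrite /valid/= h1 h2.
  + apply: (@ival_out _ _ _ (gen_interp (@HS_rel K)) HS_F).
    by apply: contra nv; case/andP=> /eqP h1 /eqP->; rewrite /valid/= h1.
- move=> f [] A D d rf.
  + exact: (ival_rel (gen_interp (@HS_rel K)) HS_br).
  + exact: (ival_rel (gen_interp (@HS_rel K)) HS_F).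
Defined.

Definition LP_projection_interp : interp LPinf_sig (LP K).
Proof.
refine (@Interp K LPinf_sig (LP K)
  (fun g => match g return forall A d, LP K A (gout (g : gen LPinf_sig)) d with
            | LPinf_l => @LP_bracketg K
            | LPinf_lam => @LP_bracketh K
            | LPinf_phi => @LP_map K
            end) _ _).
- case=> A d nv.
  + apply: (@ival_out _ _ _ (gen_interp (@LP_rel K)) LP_brg).
    by apply: contra nv; case/andP=> /andP[/eqP h1 /eqP h2] /eqP->;
       rewrite /valid/= h1 h2.
  + apply: (@ival_out _ _ _ (gen_interp (@LP_rel K)) LP_brh).
    by apply: contra nv; case/andP=> /andP[/eqP h1 /eqP h2] /eqP->;
       rewrite /valid/= h1 h2.
  + apply: (@ival_out _ _ _ (gen_interp (@LP_rel K)) LP_phi).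
    by apply: contra nv; case/andP=> /andP[/eqP h1 /eqP h2] /eqP->;
       rewrite /valid/= h1 h2.
- move=> f [] A D d rf.
  + exact: (ival_rel (gen_interp (@LP_rel K)) LP_brg).
  + exact: (ival_rel (gen_interp (@LP_rel K)) LP_brh).
  + exact: (ival_rel (gen_interp (@LP_rel K)) LP_phi).
Defined.

Lemma no_relators (S : signature) (P : operad K) (I : interp S P) :
  model (fun A c d (_ : expr K S A c d) => False) I.
Proof. by []. Qed.

Definition HS_projection : morphism (HSinf K) (HS K) :=
  lift (no_relators HS_projection_interp).

Definition LP_projection : morphism (LPinf K) (LP K) :=
  lift (no_relators LP_projection_interp).

(* The coefficient of z ^+ n in (\sum_k B_k / k! z ^+ k) (e^z - 1) = z. *)
Definition bernoulli (B : nat -> K) : Prop :=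
  forall n, \sum_(k < n) B k / k`!%:R / (n - k)`!%:R = (n == 1%N)%:R.

(* [nested_bracket [:: x_n; ...; x_1] D] is [...[[phi(1), x_1], x_2] ..., x_n],
   with set of inputs D. *)
Fixpoint nested_bracket (xs : seq nat) (D : {fset label}) : LP K D Wavy 0 :=
  if xs is x :: xs' then
    ocomp Wavy 0 (LP_bracketh K [fset (Wavy, 0%N); (Wavy, x)] 0)
                 (nested_bracket xs' (D `\ (Wavy, x)))
  else LP_map K D 0.

Definition jacobi_bernoulli (B : nat -> K) (JB : morphism (HS K) (LP K)) :
    Prop :=
  mmap JB (HS_bracket K (labels Straight 1 2) 0) =
    LP_bracketg K (labels Straight 1 2) 0
  /\
  forall n,
    mmap JB (HS_op K (labels Straight 1 1 `|` labels Wavy 2 n) 0) =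
    (B n / n`!%:R) *:
      \sum_(s : 'S_n)
        nested_bracket (rev [seq (s i : nat).+2 | i <- enum 'I_n]) _.

End Projections.

(* Main.v *)
From HB Require Import structures.
Require Import Defs.
From mathcomp Require Import all_boot all_order all_algebra perm.
From mathcomp Require Import finmap boolp zify ssrAC.
From Stdlib Require Import Btauto.
Set Implicit Arguments.
Unset Strict Implicit.
Unset Printing Implicit Defensive.
Import GRing.Theory.
Local Open Scope fset_scope.
Local Open Scope ring_scope.

(** Operations of a coloured operad are read here as Taylor coefficients of
functions and vector fields. A family of operations with straight inputs x and
wavy inputs y is a function of an odd variable x and of an even variable y, and
the sum of all insertions of a family v into a slot of kind k of a family a,
written a <| v and defined as [star], is the derivative of a along the vector
field v d/dk. Insertions satisfy the graded pre-Lie identity [star_comm]. In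
these terms the differential of HS_infinity says that ell and f are the
components of a homological vector field in (x, y), so that a dg morphism from
HS_infinity to LP_infinity that is the identity on ell amounts to a function f
in LP_infinity such that

  d f = f <| ell + f <| f     (insertions into x and y respectively).     (1)

The function f comes from phi and lambda as follows. Let z be an odd wavy
variable, to be thought of as a Maurer-Cartan element, and let adj (y, z) be
lambda with one of its inputs z replaced by y: the infinitesimal gauge
transformation of z by y. Put V = adj + f, a vector field in the direction z
that depends on the parameters x and y, and ask that its flow at time one carry
z = 0 to phi (x):

  (exp (V d/dz) z) at z = 0  is  phi.                                      (2)

The linear term of the exponential contributes f, and the other terms contain f
only in smaller weight, the weight being the number of inputs x and y; hence (2)
is a contracting fixpoint equation, with a unique solution [solution].

Equation (1) follows from (2). Let Q be the derivation with components
d, ell, f and lambda, and let the defect be the difference of the two sides of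
(1). The L-infinity relation for lambda gives
[Q, V d/dz] = defect d/dz up to sign [field_ident]. Applying Q to (2) thus gives
- exp (V d/dz) lambda plus terms that are linear in the defect [hvf_flow]. The
exponential of a derivation is multiplicative [expf_star], whence, at z = 0,
exp (V d/dz) lambda is the sum of all lambda (phi, ..., phi) [exp_lam], and the
equation of an L-infinity morphism satisfied by phi cancels everything but the
defect terms [defect_sum]. Among these, the defect itself appears once, and all
others contain the defect with fewer inputs; by induction on the number of
inputs it vanishes [defect0].

In LP only the binary bracket survives, V is affine in z, and (2) becomes
sum over n of ad^n f / (n + 1)! = phi [phi_binary]. The generating function of
the Bernoulli numbers inverts this: f is the sum of the B_n / n! ad^n phi
[solution_bernoulli], and ad^n phi is the sum over all permutations of the
nested brackets in the definition of the Jacobi-Bernoulli morphism [adn_phi].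
Since (2) is preserved by operad morphisms [fmap_solution], the square
commutes. *)

(** * Sums over subsets of a finite set *)

Lemma fsetD_subU (T : choiceType) (J M : {fset T}) : J `<=` M -> (M `\` J) `|` J = M.
Proof.
move=> JM; apply/fsetP => x; rewrite !inE.
by case: (boolP (x \in J)) => //= [/(fsubsetP JM) ->|]; rewrite ?orbF.
Qed.

Section SubsetSums.
Variables (T : choiceType) (V : nmodType).
Implicit Types (A B J L M : {fset T}).

(** Reindexing along a map that is injective on the summation range only,
with no inverse map to be constructed. *)
Lemma sum_bij_seq (T1 T2 : eqType) (S1 : seq T1) (S2 : seq T2)
    (h : T1 -> T2) (P : pred T1) (Q : pred T2) (F : T2 -> V) :
  uniq S1 -> uniq S2 ->
  {in S1 &, forall x y, P x -> P y -> h x = h y -> x = y} ->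
  (forall y, reflect (exists x, [/\ x \in S1, P x & y = h x]) ((y \in S2) && Q y)) ->
  \sum_(y <- S2 | Q y) F y = \sum_(x <- S1 | P x) F (h x).
Proof.
move=> u1 u2 hinj himg.
rewrite -big_filter -[RHS]big_filter -(big_map h predT F); apply: perm_big.
apply: uniq_perm.
- by rewrite filter_uniq.
- rewrite map_inj_in_uniq ?filter_uniq// => x y.
  by rewrite !mem_filter => /andP[Px x1] /andP[Py y1]; apply: hinj.
- move=> y; rewrite mem_filter andbC; apply/himg/mapP => [[x [x1 Px ->]]|[x]].
    by exists x => //; rewrite mem_filter Px.
  by rewrite mem_filter => /andP[Px x1] ->; exists x.
Qed.

Lemma big_fset_bij (T1 T2 : choiceType) (S1 : {fset T1}) (S2 : {fset T2})
    (h : T1 -> T2) (P : pred T1) (Q : pred T2) (F : T2 -> V) :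
  {in S1 &, forall x y, P x -> P y -> h x = h y -> x = y} ->
  (forall y, reflect (exists x, [/\ x \in S1, P x & y = h x]) ((y \in S2) && Q y)) ->
  \sum_(y <- S2 | Q y) F y = \sum_(x <- S1 | P x) F (h x).
Proof. by apply: sum_bij_seq; apply: fset_uniq. Qed.

Lemma sum_fpowerset_U1 x B (F : {fset T} -> V) : x \notin B ->
  \sum_(L <- fpowerset (x |` B)) F L =
  \sum_(L <- fpowerset B) F L + \sum_(L <- fpowerset B) F (x |` L).
Proof.
move=> xB; rewrite (bigID (fun L => x \notin L))/=; congr (_ + _).
  apply: (@big_fset_bij _ _ (fpowerset B) _ id (fun=> true)) => // y.
  apply: (iffP andP) => [[]|[z [zB _ ->]]].
    rewrite fpowersetE => sy nx; exists y; split=> //; rewrite fpowersetE.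
    by apply/fsubsetP => z zy; move/fsubsetP: sy => /(_ _ zy); rewrite !inE;
       case/orP => // /eqP zx; move: nx; rewrite -zx zy.
  move: zB; rewrite !fpowersetE => zB; split.
    by apply: (fsubset_trans zB); apply/fsubsetP => u uB; rewrite !inE uB orbT.
  by apply: contra xB; apply/fsubsetP.
apply: (@big_fset_bij _ _ (fpowerset B) _ (fun L => x |` L) (fun=> true)).
  move=> y z; rewrite !fpowersetE => yB zB _ _ e.
  have nx (u : {fset T}) : u `<=` B -> x \notin u.
    by move=> uB; apply: contra xB; apply/fsubsetP.
  by rewrite -(fsetU1K (nx _ yB)) -(fsetU1K (nx _ zB)) e.
move=> y; apply: (iffP andP) => [[]|[z [zB _ ->]]].
  rewrite negbK fpowersetE => sy nx; exists (y `\ x); split=> //.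
    by rewrite fpowersetE fsubDset.
  by rewrite fsetD1K.
by move: zB; rewrite negbK !fpowersetE !inE eqxx => zB; split=> //; apply: fsetUS.
Qed.

Lemma sum_fpowerset_disj A J (F : {fset T} -> V) :
  \sum_(L <- fpowerset (A `\` J)) F L =
  \sum_(L <- fpowerset A | [disjoint L & J]%fset) F L.
Proof.
apply/esym/(@big_fset_bij _ _ (fpowerset (A `\` J)) _ id (fun=> true)) => // y.
rewrite fpowersetE; apply: (iffP andP) => [[h1 h2]|[z [+ _ ->]]].
  by exists y; split=> //; rewrite fpowersetE fsubsetD h1.
by rewrite fpowersetE fsubsetD => /andP[].
Qed.

Lemma sum_fpowersetC2 A (F : {fset T} -> {fset T} -> V) :
  \sum_(J <- fpowerset A) \sum_(L <- fpowerset (A `\` J)) F J L =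
  \sum_(L <- fpowerset A) \sum_(J <- fpowerset (A `\` L)) F J L.
Proof.
under eq_bigr do rewrite sum_fpowerset_disj.
under [RHS]eq_bigr do rewrite sum_fpowerset_disj.
rewrite (exchange_big_dep predT)//=; apply: eq_bigr => L _.
by apply: eq_bigl => J; rewrite fdisjoint_sym.
Qed.

(** Choosing J and then L outside J amounts to choosing their union and then J
inside it. This is what makes inserting into an inserted operation associative. *)
Lemma sum_fpowerset_nest A (F : {fset T} -> {fset T} -> V) :
  \sum_(J <- fpowerset A) \sum_(L <- fpowerset (A `\` J)) F J L =
  \sum_(M <- fpowerset A) \sum_(J <- fpowerset M) F J (M `\` J).
Proof.
transitivity (\sum_(J <- fpowerset A) \sum_(M <- fpowerset A | J `<=` M) F J (M `\` J)).
  apply: eq_big_seq => J; rewrite fpowersetE => JA.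
  rewrite (@big_fset_bij _ _ (fpowerset A) (fpowerset (A `\` J)) (fun M => M `\` J)
    (fun M => J `<=` M) predT)//.
    by move=> x y _ _ Jx Jy e; rewrite -(fsetD_subU Jx) -(fsetD_subU Jy) e.
  move=> y; rewrite andbT fpowersetE; apply: (iffP idP) => [|[x [xA Jx ->]]].
    rewrite fsubsetD => /andP[yA dy]; exists (y `|` J); split.
    - by rewrite fpowersetE fsubUset yA.
    - exact: fsubsetUr.
    - by rewrite fsetDUl fsetDv fsetU0; apply/esym/fsetDidPl.
  by apply: fsetSD; rewrite -fpowersetE.
rewrite (exchange_big_dep predT)//=; apply: eq_big_seq => M; rewrite fpowersetE => MA.
apply: (@big_fset_bij _ _ (fpowerset M) _ id (fun=> true)) => // J.
apply: (iffP andP) => [[_ JM]|[z [+ _ ->]]].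
  by exists J; rewrite fpowersetE.
by rewrite !fpowersetE => zM; split=> //; apply: (fsubset_trans zM).
Qed.

Lemma sum_fpowersetD A (F : {fset T} -> V) :
  \sum_(J <- fpowerset A) F J = \sum_(J <- fpowerset A) F (A `\` J).
Proof.
apply: (@big_fset_bij _ _ (fpowerset A) _ _ (fun=> true)).
  move=> x y; rewrite !fpowersetE => xA yA _ _ e.
  by rewrite -(fsetDK xA) -(fsetDK yA) e.
move=> y; rewrite andbT; apply: (iffP idP) => [|[x [+ _ ->]]].
  rewrite fpowersetE => yA; exists (A `\` y); rewrite fpowersetE fsetDK//.
  by rewrite fsubsetDl.
by rewrite !fpowersetE fsubsetDl.
Qed.

Lemma sum_fpowersetU A B (F : {fset T} -> V) : [disjoint A & B]%fset ->
  \sum_(M <- fpowerset (A `|` B)) F M =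
  \sum_(J <- fpowerset A) \sum_(L <- fpowerset B) F (J `|` L).
Proof.
elim/finSet_rect: B F => B IH F dAB.
have [->|[x xB]] := fset_0Vmem B.
  rewrite fsetU0 fpowerset0; apply: eq_bigr => J _.
  by rewrite big_seq_fset1 fsetU0.
have xnA : x \notin A.
  by apply/negP => xA; move/fdisjointP: dAB => /(_ _ xA); rewrite xB.
have xn : x \notin A `|` B `\ x by rewrite !inE (negPf xnA) eqxx.
rewrite -(fsetD1K xB) fsetUCA sum_fpowerset_U1//.
have dAB' : [disjoint A & B `\ x]%fset.
  by apply: fdisjointWr dAB; apply: fsubD1set.
rewrite !IH ?fproperD1// -big_split; apply: eq_bigr => J _ /=.
rewrite sum_fpowerset_U1 ?fsetD11//; congr (_ + _).
by apply: eq_bigr => L _; rewrite fsetUCA.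
Qed.

Lemma sum_fpowerset_imfset (T' : choiceType) (h : T' -> T) (A : {fset T'})
    (F : {fset T} -> V) : {in A &, injective h} ->
  \sum_(M <- fpowerset (h @` A)) F M = \sum_(J <- fpowerset A) F (h @` J).
Proof.
move=> hi; apply: (@big_fset_bij _ _ (fpowerset A) _ _ (fun=> true)).
  move=> x y; rewrite !fpowersetE => xA yA _ _ e.
  apply/fsetP => u; apply/idP/idP => ux.
    have : h u \in h @` y by rewrite -e in_imfset.
    case/imfsetP => /= v vy /hi ->//; first exact: (fsubsetP xA).
    exact: (fsubsetP yA).
  have : h u \in h @` x by rewrite e in_imfset.
  case/imfsetP => /= v vy /hi ->//; first exact: (fsubsetP yA).
  exact: (fsubsetP xA).
move=> y; rewrite andbT; apply: (iffP idP) => [|[x [+ _ ->]]].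
  rewrite fpowersetE => yA; exists [fset u in A | h u \in y]; split=> //.
    by rewrite fpowersetE; apply/fsubsetP => u; rewrite !inE => /andP[].
  apply/fsetP => u; apply/idP/imfsetP => /= [uy|[v]].
    have /imfsetP[/= v vA uv] := fsubsetP yA _ uy.
    by exists v => //; rewrite !inE vA -uv.
  by rewrite !inE => /andP[_ +] ->.
rewrite !fpowersetE => xA; apply/fsubsetP => u /imfsetP[/= v vx ->].
by apply: in_imfset; apply: (fsubsetP xA).
Qed.

Lemma big_fsetU_disj (A B : {fset T}) (F : T -> V) : [disjoint A & B]%fset ->
  \sum_(x <- A `|` B) F x = \sum_(x <- A) F x + \sum_(x <- B) F x.
Proof.
move=> dAB; rewrite (bigID (fun x => x \in A))/=; congr (_ + _).
  apply: (@big_fset_bij _ _ A _ id (fun=> true)) => // y; rewrite inE.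
  apply: (iffP andP) => [[_ yA]|[z [zA _ ->]]]; first by exists y.
  by rewrite zA.
apply: (@big_fset_bij _ _ B _ id (fun=> true)) => // y; rewrite inE.
apply: (iffP andP) => [[+ yA]|[z [zA _ ->]]].
  by rewrite (negPf yA) /= => yB; exists y.
rewrite zA orbT; split=> //; apply/negP => /(fdisjointP dAB).
by rewrite zA.
Qed.

Lemma sum_fset_imfset (T' : choiceType) (h : T' -> T) (A : {fset T'}) (F : T -> V) :
  {in A &, injective h} -> \sum_(x <- h @` A) F x = \sum_(x <- A) F (h x).
Proof. by move=> hi; rewrite big_imfset. Qed.

End SubsetSums.

(** * Signs, and families of operations with decorated inputs *)

(** The kinds of formal variables. The straight inputs are of kind KX and the
wavy inputs of the operations f of kind KY. KZ is the odd wavy variable along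
which the flow is taken, and KU is a copy of KZ that marks the slots of lambda
into which a function of z is to be substituted. *)
Inductive kind := KX | KY | KZ | KU.

Definition kind_to_nat k := match k with KX => 0%N | KY => 1%N | KZ => 2%N | KU => 3%N end.
Definition kind_of_nat n := match n with 0%N => KX | 1%N => KY | 2%N => KZ | _ => KU end.
Lemma kind_to_natK : cancel kind_to_nat kind_of_nat.
Proof. by case. Qed.
HB.instance Definition _ := Countable.copy kind (can_type kind_to_natK).

Definition kcol k := if k is KX then Straight else Wavy.
(** Skewsymmetric inputs are odd after suspension, symmetric ones are even. *)
Definition parity_of k : nat := k != KY.

(** The inputs of an operation may be shared out between several kinds of
variables of the same colour, as in a Taylor expansion in several variables, so
that the kinds are prescribed label by label. *)
Definition deco := label -> kind.
Definition upd (k0 : deco) (s : label) (k : kind) : deco :=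
  fun x => if x == s then k else k0 x.

(** The order in which the inputs of a corolla are listed; all Koszul signs refer
to it. *)
Definition lab_lt (x y : label) : bool :=
  match x.1, y.1 with
  | Straight, Wavy => true
  | Wavy, Straight => false
  | _, _ => (x.2 < y.2)%N
  end.

Lemma lab_lt_total x y : x != y -> lab_lt x y = ~~ lab_lt y x.
Proof.
by case: x y => [[] i] [[] j] //; rewrite /lab_lt/= xpair_eqE eqxx/= -leqNgt;
  case: ltngtP.
Qed.

Lemma lab_ltxx x : lab_lt x x = false.
Proof. by case: x => [[] i]; rewrite /lab_lt/= ltnn. Qed.

Lemma sumnU_disj (T : choiceType) (A B : {fset T}) (F : T -> nat) : [disjoint A & B]%fset ->
  (\sum_(x <- A `|` B) F x = \sum_(x <- A) F x + \sum_(x <- B) F x)%N.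
Proof. exact: big_fsetU_disj. Qed.

Lemma sumn_imfset (T T' : choiceType) (h : T' -> T) (A : {fset T'}) (F : T -> nat) :
  {in A &, injective h} -> (\sum_(x <- h @` A) F x = \sum_(x <- A) F (h x))%N.
Proof. exact: sum_fset_imfset. Qed.

Section Signs.
Implicit Types (q : deco) (A J I : {fset label}).

Definition od q A : nat := \sum_(x <- A) parity_of (q x).

(** Number of odd inversions in the list formed by J followed by I. *)
Definition iv q J I : nat :=
  \sum_(x <- J) \sum_(y <- I) parity_of (q x) * parity_of (q y) * lab_lt y x.

(** Number of pairs of odd inputs whose order is reversed by f. *)
Definition rinv q (f : renaming) A : nat :=
  \sum_(x <- A) \sum_(y <- A)
    parity_of (q x) * parity_of (q y) * (lab_lt x y && lab_lt (rename f y) (rename f x)).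

Lemma odU q A B : [disjoint A & B]%fset -> od q (A `|` B) = (od q A + od q B)%N.
Proof. exact: sumnU_disj. Qed.

Lemma od1 q x : od q [fset x] = parity_of (q x).
Proof. by rewrite /od big_seq_fset1. Qed.

Lemma od0 q : od q fset0 = 0%N.
Proof. by rewrite /od big_seq_fset0. Qed.

Lemma odU1 q A x : x \notin A -> od q (x |` A) = (parity_of (q x) + od q A)%N.
Proof. by move=> xA; rewrite odU ?od1// fdisjoint1X. Qed.

Lemma ivUl q A B I : [disjoint A & B]%fset -> iv q (A `|` B) I = (iv q A I + iv q B I)%N.
Proof. exact: sumnU_disj. Qed.

Lemma ivUr q A B J : [disjoint A & B]%fset -> iv q J (A `|` B) = (iv q J A + iv q J B)%N.
Proof.
move=> dAB; rewrite /iv -big_split; apply: eq_bigr => x _; exact: sumnU_disj.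
Qed.

Lemma od_ext q q' A : {in A, q =1 q'} -> od q A = od q' A.
Proof. by move=> h; apply: eq_big_seq => x /h ->. Qed.

Lemma iv_ext q q' J I : {in J, q =1 q'} -> {in I, q =1 q'} -> iv q J I = iv q' J I.
Proof.
move=> hJ hI; apply: eq_big_seq => x /hJ ->.
by apply: eq_big_seq => y /hI ->.
Qed.

Lemma ivC q J I : [disjoint J & I]%fset -> (iv q I J + iv q J I = od q J * od q I)%N.
Proof.
move=> dJI; rewrite {1}/iv exchange_big/= /iv -big_split/= /od big_distrl/=.
apply: eq_big_seq => x xJ; rewrite -big_split/= big_distrr/=.
apply: eq_big_seq => y yI; have xy : x != y.
  by apply/eqP => xy; move/fdisjointP: dJI => /(_ _ xJ); rewrite xy yI.
rewrite (lab_lt_total xy); case: (lab_lt y x) => /=; nia.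
Qed.

Lemma od_rel q q' f A : {in A &, injective (rename f)} ->
  {in A, forall x, q' (rename f x) = q x} -> od q' (rename f @` A) = od q A.
Proof.
move=> fi h; rewrite /od sumn_imfset//.
by apply: eq_big_seq => x /h ->.
Qed.

Lemma rinv_id q A : rinv q (fun=> id) A = 0%N.
Proof.
rewrite /rinv big1// => x _; rewrite big1// => y _.
have E z : rename (fun=> id) z = z by case: z.
rewrite !E; case: (eqVneq x y) => [->|xy]; first by rewrite lab_ltxx muln0.
by rewrite (lab_lt_total xy) andNb muln0.
Qed.

Lemma rinv_ext q q' f g A : {in A, rename f =1 rename g} -> {in A, q =1 q'} ->
  rinv q f A = rinv q' g A.
Proof.
move=> fg h; apply: eq_big_seq => x xA; apply: eq_big_seq => y yA.
by rewrite !h// !fg.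
Qed.

Lemma rinv1 q f x : rinv q f [fset x] = 0%N.
Proof. by rewrite /rinv !big_seq_fset1 lab_ltxx muln0. Qed.

(** Shuffling J and I together, renaming, and shuffling back is the same as
renaming each of them: both counts have the same parity, and the witness D is
the number of pairs that are inverted before and after. *)
Lemma rinvU q q' f J I : [disjoint J & I]%fset ->
  {in J `|` I &, injective (rename f)} ->
  {in J `|` I, forall x, q' (rename f x) = q x} ->
  exists D, (rinv q f (J `|` I) + 2 * D = rinv q f J + rinv q f I +
     iv q J I + iv q' (rename f @` J) (rename f @` I))%N.
Proof.
move=> dJI fi h.
have hJ : {subset J <= J `|` I} by move=> x xJ; rewrite inE xJ.
have hI : {subset I <= J `|` I} by move=> x xJ; rewrite inE xJ orbT.
pose c x y : nat := parity_of (q x) * parity_of (q y) * (lab_lt y x && lab_lt (rename f y) (rename f x)).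
exists (\sum_(x <- J) \sum_(y <- I) c x y)%N.
have -> : iv q' (rename f @` J) (rename f @` I) =
   (\sum_(x <- J) \sum_(y <- I) parity_of (q x) * parity_of (q y) * lab_lt (rename f y) (rename f x))%N.
  rewrite /iv sumn_imfset; last by move=> u v /hJ uJ /hJ; apply: fi.
  apply: eq_big_seq => x xJ; rewrite sumn_imfset; last by move=> u v /hI uJ /hI; apply: fi.
  by apply: eq_big_seq => y yI; rewrite (h _ (hJ _ xJ)) (h _ (hI _ yI)).
have -> : rinv q f (J `|` I) = (rinv q f J + rinv q f I +
    (\sum_(x <- J) \sum_(y <- I) parity_of (q x) * parity_of (q y) *
        (lab_lt x y && lab_lt (rename f y) (rename f x)) +
     \sum_(x <- J) \sum_(y <- I) parity_of (q y) * parity_of (q x) *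
        (lab_lt y x && lab_lt (rename f x) (rename f y))))%N.
  rewrite {1}/rinv sumnU_disj//.
  have E x : (\sum_(y <- J `|` I) parity_of (q x) * parity_of (q y) *
        (lab_lt x y && lab_lt (rename f y) (rename f x)) =
     \sum_(y <- J) parity_of (q x) * parity_of (q y) *
        (lab_lt x y && lab_lt (rename f y) (rename f x)) +
      \sum_(y <- I) parity_of (q x) * parity_of (q y) *
        (lab_lt x y && lab_lt (rename f y) (rename f x)))%N.
    exact: sumnU_disj.
  under eq_bigr do rewrite E.
  under [X in (_ + X)%N = _]eq_bigr do rewrite E.
  rewrite !big_split/= [X in (_ + (X + _))%N = _]exchange_big/= -/(rinv q f J) -/(rinv q f I).
  by rewrite [X in (_ + X)%N = _]addnC addnACA.
rewrite -!addnA; congr addn; congr addn.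
rewrite big_distrr/= /iv -!big_split/=; apply: eq_big_seq => x xJ.
rewrite big_distrr/= -!big_split/=; apply: eq_big_seq => y yI.
have xy : x != y.
  by apply/eqP => xy; move/fdisjointP: dJI => /(_ _ xJ); rewrite xy yI.
have fxy : rename f x != rename f y.
  by apply: contra xy => /eqP /fi ->//; [apply: hJ|apply: hI].
rewrite /c (lab_lt_total xy) (lab_lt_total fxy).
case: (lab_lt y x); case: (lab_lt (rename f y) (rename f x)) => /=; nia.
Qed.

End Signs.

Lemma signP (K : fieldType) m n : odd m = odd n -> (-1) ^+ m = (-1) ^+ n :> K.
Proof. by move=> h; rewrite -signr_odd h signr_odd. Qed.

Section Families.
Variables (K : fieldType) (P : operad K).

(** The Taylor coefficients of a function with values in operations of output
colour c: the coefficient of the inputs A, of kinds q, in operadic degree d. *)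
Definition fam (c : colour) := deco -> forall A d, P A c d.

Section FamMod.
Variable c : colour.
HB.instance Definition _ := gen_eqMixin (fam c).
HB.instance Definition _ := gen_choiceMixin (fam c).
Lemma fam_ext (a b : fam c) : (forall q A d, a q A d = b q A d) -> a = b.
Proof.
by move=> h; apply: functional_extensionality_dep => q;
  apply: functional_extensionality_dep => A;
  apply: functional_extensionality_dep => d.
Qed.
Definition fam0 : fam c := fun q A d => 0.
Definition fam_opp (a : fam c) : fam c := fun q A d => - a q A d.
Definition fam_add (a b : fam c) : fam c := fun q A d => a q A d + b q A d.
Definition fam_scale (k : K) (a : fam c) : fam c := fun q A d => k *: a q A d.
Lemma fam_addA : associative fam_add.
Proof. by move=> *; apply: fam_ext => *; apply: addrA. Qed.
Lemma fam_addC : commutative fam_add.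
Proof. by move=> *; apply: fam_ext => *; apply: addrC. Qed.
Lemma fam_add0 : left_id fam0 fam_add.
Proof. by move=> *; apply: fam_ext => *; apply: add0r. Qed.
Lemma fam_addN : left_inverse fam0 fam_opp fam_add.
Proof. by move=> *; apply: fam_ext => *; apply: addNr. Qed.
HB.instance Definition _ := GRing.isZmodule.Build (fam c) fam_addA fam_addC fam_add0 fam_addN.
Lemma fam_scaleA k l a : fam_scale k (fam_scale l a) = fam_scale (k * l) a.
Proof. by apply: fam_ext => *; apply: scalerA. Qed.
Lemma fam_scale1 : left_id 1 fam_scale.
Proof. by move=> *; apply: fam_ext => *; apply: scale1r. Qed.
Lemma fam_scaleDr : right_distributive fam_scale +%R.
Proof. by move=> *; apply: fam_ext => *; apply: scalerDr. Qed.
Lemma fam_scaleDl a : {morph fam_scale^~ a : k l / k + l}.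
Proof. by move=> *; apply: fam_ext => *; apply: scalerDl. Qed.
HB.instance Definition _ := GRing.Zmodule_isLmodule.Build K (fam c)
  fam_scaleA fam_scale1 fam_scaleDr fam_scaleDl.
Lemma famD (a b : fam c) q A d : (a + b) q A d = a q A d + b q A d. Proof. by []. Qed.
Lemma famN (a : fam c) q A d : (- a) q A d = - a q A d. Proof. by []. Qed.
Lemma famB (a b : fam c) q A d : (a - b) q A d = a q A d - b q A d. Proof. by []. Qed.
Lemma famZ k (a : fam c) q A d : (k *: a) q A d = k *: a q A d. Proof. by []. Qed.
Lemma fam0E q A d : (0 : fam c) q A d = 0. Proof. by []. Qed.
Lemma fam_sum I (r : seq I) (Q : pred I) (F : I -> fam c) q A d :
  (\sum_(i <- r | Q i) F i) q A d = \sum_(i <- r | Q i) F i q A d.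
Proof. by elim/big_rec2: _ => // i x y _ <-. Qed.
End FamMod.
Definition famE := (famD, famN, famB, famZ, fam0E, fam_sum).

Lemma orel0 f A D c d : orel f (0 : P A c d) = 0 :> P D c d.
Proof.
have := orel_linear f D (-1) 0 (0 : P A c d).
by rewrite !scaleN1r oppr0 !addr0 addNr.
Qed.
Lemma orelZ f A D c d k (a : P A c d) : orel f (k *: a) = k *: orel f a :> P D c d.
Proof. by have := orel_linear f D k a 0; rewrite orel0 !addr0. Qed.
Lemma orelD f A D c d (a b : P A c d) : orel f (a + b) = orel f a + orel f b :> P D c d.
Proof. by have := orel_linear f D 1 a b; rewrite !scale1r. Qed.
Lemma orel_sum f A D c d I (r : seq I) (Q : pred I) (F : I -> P A c d) :
  orel f (\sum_(i <- r | Q i) F i) = \sum_(i <- r | Q i) orel f (F i) :> P D c d.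
Proof. by elim/big_rec2: _ => [|i x y _ <-]; rewrite ?orel0 ?orelD. Qed.

Section OComp.
Context {A B D : {fset label}} {c c' : colour} {z : nat} {d1 d2 d : int}.
Lemma ocomp0l (b : P B c' d2) : ocomp c' z (0 : P A c d1) b = 0 :> P D c d.
Proof.
have := ocomp_linearl D z d (-1) 0 (0 : P A c d1) b.
by rewrite !scaleN1r oppr0 !addr0 addNr.
Qed.
Lemma ocomp0r (a : P A c d1) : ocomp c' z a (0 : P B c' d2) = 0 :> P D c d.
Proof.
have := ocomp_linearr D z d (-1) a 0 (0 : P B c' d2).
by rewrite !scaleN1r oppr0 !addr0 addNr.
Qed.
Lemma ocompDl (a a' : P A c d1) (b : P B c' d2) :
  ocomp c' z (a + a') b = ocomp c' z a b + ocomp c' z a' b :> P D c d.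
Proof. by have := ocomp_linearl D z d 1 a a' b; rewrite !scale1r. Qed.
Lemma ocompDr (a : P A c d1) (b b' : P B c' d2) :
  ocomp c' z a (b + b') = ocomp c' z a b + ocomp c' z a b' :> P D c d.
Proof. by have := ocomp_linearr D z d 1 a b b'; rewrite !scale1r. Qed.
Lemma ocompZl k (a : P A c d1) (b : P B c' d2) :
  ocomp c' z (k *: a) b = k *: ocomp c' z a b :> P D c d.
Proof. by have := ocomp_linearl D z d k a 0 b; rewrite ocomp0l !addr0. Qed.
Lemma ocompZr k (a : P A c d1) (b : P B c' d2) :
  ocomp c' z a (k *: b) = k *: ocomp c' z a b :> P D c d.
Proof. by have := ocomp_linearr D z d k a b 0; rewrite ocomp0r !addr0. Qed.
Lemma ocomp_suml I (r : seq I) (Q : pred I) (F : I -> P A c d1) (b : P B c' d2) :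
  ocomp c' z (\sum_(i <- r | Q i) F i) b =
  \sum_(i <- r | Q i) ocomp c' z (F i) b :> P D c d.
Proof. by elim/big_rec2: _ => [|i x y _ <-]; rewrite ?ocomp0l ?ocompDl. Qed.
Lemma ocomp_sumr I (r : seq I) (Q : pred I) (a : P A c d1) (F : I -> P B c' d2) :
  ocomp c' z a (\sum_(i <- r | Q i) F i) =
  \sum_(i <- r | Q i) ocomp c' z a (F i) :> P D c d.
Proof. by elim/big_rec2: _ => [|i x y _ <-]; rewrite ?ocomp0r ?ocompDr. Qed.
End OComp.

End Families.

(** * Insertion of one family into the slots of another *)

Lemma addb_xorb a b : a (+) b = xorb a b. Proof. by case: a; case: b. Qed.
Lemma oddabsD (x y : int) : odd (absz (x + y)) = odd (absz x) (+) odd (absz y).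
Proof. lia. Qed.

Ltac parity := rewrite ?(oddD, oddM, abszM, oddabsD) /= ?addb_xorb; btauto.

Lemma sign_mod2 (K : fieldType) (m n x y : nat) : (m + 2 * x = n + 2 * y)%N ->
  (-1) ^+ m = (-1) ^+ n :> K.
Proof.
move=> h; apply: signP; move: (congr1 odd h).
by rewrite !(oddD, oddM) /= !addbF.
Qed.

(** Comparison of the signs of an insertion before and after renaming. *)
Lemma star_relabel_sign (K : fieldType) (rg rI a a' rA rJ b b' v w1 w2 : nat) :
  (rg + 2 * w1 = 0 + rI + a + a' -> rA + 2 * w2 = rJ + rI + b + b' ->
  (-1) ^+ (a + b + v + rg + rJ) = (-1) ^+ (rA + (a' + b' + v)) :> K)%N.
Proof.
move=> h1 h2; apply: (@sign_mod2 _ _ _ (w1 + b') (w2 + a)); lia.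
Qed.

(** Insertions need a name for the slot that disappears. *)
Definition fresh (A : {fset label}) : nat := (\max_(x <- A) x.2).+1.

Lemma fresh_lt (A : {fset label}) x : x \in A -> (x.2 < fresh A)%N.
Proof. by move=> xA; rewrite ltnS (big_rem x) //= leq_maxl. Qed.

Lemma freshP (A : {fset label}) c n : (fresh A <= n)%N -> (c, n) \notin A.
Proof. by move=> h; apply/negP => /fresh_lt /=; rewrite ltnNge h. Qed.

Lemma updE q s k : upd q s k s = k. Proof. by rewrite /upd eqxx. Qed.
Lemma upd_out q s k (A : {fset label}) : s \notin A -> {in A, upd q s k =1 q}.
Proof. by move=> sA x xA; rewrite /upd; case: eqP => // e; rewrite -e xA in sA. Qed.

Lemma graftU (A J : {fset label}) s : s \notin A -> J `<=` A ->
  graft (s |` (A `\` J)) s J A.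
Proof.
move=> sA JA; split; first by rewrite !inE eqxx.
  rewrite fsetU1K; last by rewrite !inE (negPf sA) andbF.
  by apply/fdisjointP => x; rewrite !inE => /andP[].
rewrite fsetU1K; last by rewrite !inE (negPf sA) andbF.
by rewrite fsetD_subU.
Qed.

Lemma fdisjointDl (A J : {fset label}) : [disjoint A `\` J & J]%fset.
Proof. by apply/fdisjointP => x; rewrite !inE => /andP[]. Qed.
Lemma fdisjointDr (A J : {fset label}) : [disjoint J & A `\` J]%fset.
Proof. by rewrite fdisjoint_sym fdisjointDl. Qed.

Lemma fsubset_notin (A J : {fset label}) x : J `<=` A -> x \notin A -> x \notin J.
Proof. by move=> /fsubsetP JA; apply: contra => /JA. Qed.

Lemma imfset_setD (T T' : choiceType) (h : T -> T') (A J : {fset T}) :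
  {in A &, injective h} -> J `<=` A -> h @` (A `\` J) = (h @` A) `\` (h @` J).
Proof.
move=> hi /fsubsetP JA; apply/fsetP => y; rewrite inE.
apply/imfsetP/andP => /= [[x + ->]|[ny /imfsetP[/= x xA e]]].
  rewrite inE => /andP[xJ xA]; split; last by apply: in_imfset.
  by apply/imfsetP => /= -[z zJ /hi e]; rewrite (e xA (JA _ zJ)) zJ in xJ.
exists x => //; rewrite inE xA andbT; apply: contra ny => xJ.
by rewrite e; apply: in_imfset.
Qed.

Lemma relabels_sub f A D J : relabels f A D -> J `<=` A -> relabels f J (rename f @` J).
Proof. by move=> [fi _] /fsubsetP JA; split=> // x y /JA xA /JA; apply: fi. Qed.

Section Star.
Variables (K : fieldType) (P : operad K).
Local Notation fam := (fam P).
Implicit Types (q : deco) (A D J I : {fset label}) (d e : int) (n : nat).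

(** The coefficients of one function of total degree e, where each odd variable
counts for one, with the Koszul symmetry under renaming of the inputs. *)
Record regular e c (a : fam c) : Prop := Regular {
  reg_hom : forall q A d, d != e - (od q A)%:Z -> a q A d = 0;
  reg_rel : forall f q q' A D d, relabels f A D ->
    {in A, forall x, q' (rename f x) = q x} ->
    orel f (a q A d) = (-1) ^+ rinv q f A *: a q' D d }.

Lemma rename_id x : rename (fun=> id) x = x. Proof. by case: x. Qed.

Lemma relabels_id A : relabels (fun=> id) A A.
Proof.
split; first by move=> x y _ _; rewrite !rename_id.
by apply/fsetP => x; apply/idP/imfsetP => /= [xA|[y yA ->]];
  [exists x|]; rewrite ?rename_id.
Qed.

(** Only the kinds of the actual inputs matter: apply equivariance to the
identity renaming. *)
Lemma reg_ext e c (a : fam c) q q' A d : regular e a -> {in A, q =1 q'} ->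
  a q A d = a q' A d.
Proof.
move=> ra h; have /(_ q q') := reg_rel ra d (relabels_id A).
rewrite orel_id rinv_id scale1r; apply=> x xA.
by rewrite rename_id h.
Qed.

(** The sign for inserting v, of total degree e', into the slot s: the slot is
moved in front of the remaining inputs I, the inputs J of v are listed before
I, and v d/dk, whose parity is e' minus that of k, moves past I. *)
Definition ssign k e' q s J I : nat :=
  (iv q [fset s] I + iv q J I + `|e' - (parity_of k)%:Z|%N * od q I)%N.

(** The insertion at a slot named n. The degrees of the two coefficients are those
prescribed by the total degrees e and e'. *)
Definition star_sum n k e e' c (a : fam c) (v : fam (kcol k)) : fam c := fun q A d =>
  \sum_(J <- fpowerset A)
    (-1) ^+ ssign k e' q (kcol k, n) J (A `\` J) *:
    ocomp (kcol k) n (a q ((kcol k, n) |` (A `\` J)) (e - (od q ((kcol k, n) |` (A `\` J)))%:Z))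
                    (v q J (e' - (od q J)%:Z)).

(** The derivative of a along v d/dk: insertion of v into every slot of kind k.
The slot receives a name that does not occur in A; the choice is immaterial by
[starE]. *)
Definition star k e e' c (a : fam c) (v : fam (kcol k)) : fam c := fun q A d =>
  star_sum (fresh A) e e' a v (upd q (kcol k, fresh A) k) A d.

(** Equivariance, in a form where the name of the slot changes as well. It
yields both the regularity of an insertion and its independence of that name. *)
Lemma star_sum_rel k e e' c (a : fam c) (v : fam (kcol k)) f q q' A D n n' d :
  regular e a -> regular e' v -> relabels f A D ->
  {in A, forall x, q' (rename f x) = q x} ->
  q (kcol k, n) = k -> q' (kcol k, n') = k ->
  (kcol k, n) \notin A -> (kcol k, n') \notin D ->
  orel f (star_sum n e e' a v q A d) =
  (-1) ^+ rinv q f A *: star_sum n' e e' a v q' D d.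
Proof.
move=> ra rv rf h qs qs' sA sD; have [fi eD] := rf.
have eP : fpowerset D = fpowerset (rename f @` A) by rewrite eD.
rewrite /star_sum orel_sum eP sum_fpowerset_imfset// scaler_sumr.
apply: eq_big_seq => J; rewrite fpowersetE => JA.
pose s : label := (kcol k, n); pose s' : label := (kcol k, n').
pose g : renaming := fun c0 m => if (c0, m) == s then n' else f c0 m.
have gs : rename g s = s' by rewrite /rename /g /= eqxx.
have gE x : x != s -> rename g x = rename f x.
  by case: x => c0 m; rewrite /rename/g/= => /negPf ->.
have IA : A `\` J `<=` A by apply: fsubsetDl.
have gI : {in A, rename g =1 rename f}.
  by move=> x xA; apply: gE; apply: contraNneq sA => e0; rewrite -/s -e0.
have sI : s \notin A `\` J by apply: fsubset_notin sA.
have fJD : rename f @` J `<=` D.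
  rewrite eD; apply/fsubsetP => x /imfsetP[/= y yJ ->].
  by apply: in_imfset; apply: (fsubsetP JA).
have eI : D `\` (rename f @` J) = rename f @` (A `\` J).
  by rewrite eD imfset_setD.
have s'I : s' \notin D `\` (rename f @` J) by apply: fsubset_notin sD; apply: fsubsetDl.
have rg : relabels g (s |` (A `\` J)) (s' |` (D `\` (rename f @` J))).
  split.
    move=> x y; rewrite !inE -!/s.
    have P0 z : z \in A -> rename g z != s'.
      move=> zA; rewrite gI//; apply: contraNneq sD => e0.
      by rewrite -/s' -e0 eD in_imfset.
    move=> /orP[/eqP->|/andP[_ xA]] /orP[/eqP->|/andP[_ yA]] //.
    - by rewrite gs => e1; have := P0 _ yA; rewrite -e1 eqxx.
    - by rewrite gs => e1; have := P0 _ xA; rewrite e1 eqxx.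
    - by rewrite !gI// => /fi; apply.
  rewrite imfsetU1 gs eI; congr (_ |` _); apply/esym/eq_in_imfset => //= x.
  by rewrite inE => /andP[_ xA]; rewrite gI.
have hI : {in s |` (A `\` J), forall x, q' (rename g x) = q x}.
  move=> x; rewrite !inE -/s => /orP[/eqP->|/andP[_ xA]]; first by rewrite gs qs qs'.
  by rewrite gI// h.
have hJ : {in J, forall x, q' (rename f x) = q x}.
  by move=> x xJ; apply: h; apply: (fsubsetP JA).
have rJ := relabels_sub rf JA.
rewrite orelZ.
rewrite (@orel_comp _ P f g f _ (s' |` (D `\` (rename f @` J))) _ (rename f @` J) _ D);
  [|exact: graftU|by rewrite /g eqxx; apply: graftU|exact: rf|exact: rg|exact: rJ| |by []].
  2: by move=> x; rewrite fsetU1K// inE => /andP[_ /gI].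
rewrite [g _ _]/(rename g s).2 gs /=.
rewrite (reg_rel ra _ rg hI) (reg_rel rv _ rJ hJ) ocompZl ocompZr !scalerA.
have -> : od q (s |` (A `\` J)) = od q' (s' |` (D `\` (rename f @` J))).
  by have [gi ->] := rg; rewrite (od_rel gi hI).
have -> : od q J = od q' (rename f @` J).
  by have [fiJ _] := rJ; rewrite (od_rel fiJ hJ).
congr (_ *: _); rewrite -!exprD.
have odI : od q (A `\` J) = od q' (D `\` (rename f @` J)).
  rewrite eI (od_rel _ (_ : {in A `\` J, forall x, q' (rename f x) = q x}))//.
    by move=> x y; rewrite !inE => /andP[_ xA] /andP[_ yA]; apply: fi.
  by move=> x; rewrite !inE => /andP[_ xA]; apply: h.
have dsI : [disjoint [fset s] & A `\` J]%fset by rewrite fdisjoint1X.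
have [w1 E1] : exists w1, (rinv q g (s |` (A `\` J)) + 2 * w1 = rinv q g [fset s] +
   rinv q g (A `\` J) + iv q [fset s] (A `\` J) +
   iv q' (rename g @` [fset s]) (rename g @` (A `\` J)))%N.
  by apply: rinvU => //; have [] := rg.
have gAJ : rename g @` (A `\` J) = rename f @` (A `\` J).
  by apply: eq_in_imfset => //= x; rewrite inE => /andP[_ /gI].
rewrite rinv1 imfset_fset1 gs gAJ in E1.
have E3 : rinv q g (A `\` J) = rinv q f (A `\` J).
  by apply: rinv_ext => // x; rewrite inE => /andP[_ /gI].
have [w2 E2] : exists w2, (rinv q f (J `|` (A `\` J)) + 2 * w2 = rinv q f J +
   rinv q f (A `\` J) + iv q J (A `\` J) +
   iv q' (rename f @` J) (rename f @` (A `\` J)))%N.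
  apply: rinvU; rewrite ?fdisjointDr//; rewrite fsetUC fsetD_subU//.
rewrite fsetUC fsetD_subU// in E2.
rewrite /ssign -odI eI -/s -/s'.
rewrite E3 in E1; exact: (star_relabel_sign _ _ E1 E2).
Qed.

Lemma starE k e e' c (a : fam c) (v : fam (kcol k)) q A n d :
  regular e a -> regular e' v -> q (kcol k, n) = k -> (kcol k, n) \notin A ->
  star e e' a v q A d = star_sum n e e' a v q A d.
Proof.
move=> ra rv qs sA; have sA' := freshP (kcol k) (leqnn (fresh A)).
have := star_sum_rel d ra rv (relabels_id A) _ (updE q (kcol k, fresh A) k) qs sA' sA.
rewrite orel_id rinv_id scale1r; apply=> x xA.
by rewrite rename_id (upd_out _ _ sA').
Qed.

Lemma star_hom k e e' c (a : fam c) (v : fam (kcol k)) q A d :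
  d != (e + e' - (parity_of k)%:Z) - (od q A)%:Z -> star e e' a v q A d = 0.
Proof.
move=> nd; rewrite /star /star_sum big_seq big1// => J; rewrite fpowersetE => JA.
have sA' := freshP (kcol k) (leqnn (fresh A)).
set q' := upd _ _ _; rewrite ocomp_out ?scaler0// => -[_].
rewrite odU1; last by apply: fsubset_notin sA'; apply: fsubsetDl.
have e1 : od q' A = od q A by apply: od_ext; apply: upd_out.
have e2 : od q' A = (od q' (A `\` J) + od q' J)%N.
  by rewrite -{1}(fsetD_subU JA) (odU _ (fdisjointDl A J)).
have qs : q' (kcol k, fresh A) = k by apply: updE.
rewrite qs => e0; move/eqP: nd; apply; rewrite -e0 -e1 e2 !PoszD; lia.
Qed.

Lemma star_regular k e e' c (a : fam c) (v : fam (kcol k)) :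
  regular e a -> regular e' v -> regular (e + e' - (parity_of k)%:Z) (star e e' a v).
Proof.
move=> ra rv; split=> [q A d|f q q' A D d rf h]; first exact: star_hom.
pose n := maxn (fresh A) (fresh D).
have sA := freshP (kcol k) (leq_maxl (fresh A) (fresh D) : (_ <= n)%N).
have sD := freshP (kcol k) (leq_maxr (fresh A) (fresh D) : (_ <= n)%N).
pose s := (kcol k, n).
have rs : regular (e + e' - (parity_of k)%:Z) (star e e' a v) -> True by [].
have E1 q0 B d0 : s \notin B -> star e e' a v q0 B d0 = star_sum n e e' a v (upd q0 s k) B d0.
  move=> sB; rewrite -(starE d0 ra rv (updE q0 s k) sB).
  rewrite /star; set sf := (kcol k, fresh B).
  have sfB : sf \notin B by apply: freshP.
  have := star_sum_rel d0 ra rv (relabels_id B) _ (updE q0 sf k) (updE (upd q0 s k) sf k) sfB sfB.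
  rewrite orel_id rinv_id scale1r; apply=> x xB.
  by rewrite rename_id (upd_out _ _ sfB)// (upd_out _ _ sfB)// (upd_out _ _ sB).
rewrite !E1// (star_sum_rel d ra rv rf _ (updE q s k) (updE q' s k))//.
  congr (_ *: _); congr (_ ^+ _); apply: rinv_ext => //; exact: upd_out.
move=> x xA; rewrite (upd_out q k sA xA) (upd_out q' k sD) ?h//.
by have [_ ->] := rf; apply: in_imfset.
Qed.

Section StarLinear.
Variables (k : kind) (e e' : int) (c : colour).
Implicit Types (a b : fam c) (v w : fam (kcol k)).
Lemma starDl a b v : star e e' (a + b) v = star e e' a v + star e e' b v.
Proof.
apply: fam_ext => q A d; rewrite famE /star /star_sum -big_split/=.
by apply: eq_bigr => J _; rewrite famE ocompDl scalerDr.
Qed.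
Lemma starDr a v w : star e e' a (v + w) = star e e' a v + star e e' a w.
Proof.
apply: fam_ext => q A d; rewrite famE /star /star_sum -big_split/=.
by apply: eq_bigr => J _; rewrite famE ocompDr scalerDr.
Qed.
Lemma starZl x a v : star e e' (x *: a) v = x *: star e e' a v.
Proof.
apply: fam_ext => q A d; rewrite famE /star /star_sum scaler_sumr.
by apply: eq_bigr => J _; rewrite famE ocompZl !scalerA mulrC.
Qed.
Lemma starZr x a v : star e e' a (x *: v) = x *: star e e' a v.
Proof.
apply: fam_ext => q A d; rewrite famE /star /star_sum scaler_sumr.
by apply: eq_bigr => J _; rewrite famE ocompZr !scalerA mulrC.
Qed.
Lemma star0l v : star e e' (0 : fam c) v = 0.
Proof. by rewrite -[X in star _ _ X _](scale0r (0 : fam c)) starZl scale0r. Qed.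
Lemma star0r a : star e e' a (0 : fam (kcol k)) = 0.
Proof. by rewrite -[X in star _ _ _ X](scale0r (0 : fam (kcol k))) starZr scale0r. Qed.
Lemma starNl a v : star e e' (- a) v = - star e e' a v.
Proof. by rewrite -scaleN1r starZl scaleN1r. Qed.
Lemma starNr a v : star e e' a (- v) = - star e e' a v.
Proof. by rewrite -scaleN1r starZr scaleN1r. Qed.
Lemma star_suml T (r : seq T) (Q : pred T) (F : T -> fam c) v :
  star e e' (\sum_(i <- r | Q i) F i) v = \sum_(i <- r | Q i) star e e' (F i) v.
Proof. by elim/big_rec2: _ => [|i x y _ <-]; rewrite ?star0l ?starDl. Qed.
Lemma star_sumr T (r : seq T) (Q : pred T) a (F : T -> fam (kcol k)) :
  star e e' a (\sum_(i <- r | Q i) F i) = \sum_(i <- r | Q i) star e e' a (F i).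
Proof. by elim/big_rec2: _ => [|i x y _ <-]; rewrite ?star0r ?starDr. Qed.
End StarLinear.

Section RegularLinear.
Variables (e : int) (c : colour).
Implicit Types (a b : fam c).
Lemma regular0 : regular e (0 : fam c).
Proof. by split=> [//|*]; rewrite !famE orel0 scaler0. Qed.
Lemma regularD a b : regular e a -> regular e b -> regular e (a + b).
Proof.
move=> ra rb; split=> [q A d nd|f q q' A D d rf h]; rewrite !famE.
  by rewrite (reg_hom ra)// (reg_hom rb)// addr0.
by rewrite orelD (reg_rel ra d rf h) (reg_rel rb d rf h) scalerDr.
Qed.
Lemma regularZ x a : regular e a -> regular e (x *: a).
Proof.
move=> ra; split=> [q A d nd|f q q' A D d rf h]; rewrite !famE.
  by rewrite (reg_hom ra)// scaler0.
by rewrite orelZ (reg_rel ra d rf h) !scalerA mulrC.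
Qed.
Lemma regularN a : regular e a -> regular e (- a).
Proof. by rewrite -scaleN1r; apply: regularZ. Qed.
Lemma regularB a b : regular e a -> regular e b -> regular e (a - b).
Proof. by move=> ra /regularN; apply: regularD. Qed.
End RegularLinear.

End Star.
Arguments star {K P} k e e' {c} a v.
Arguments star_sum {K P} n k e e' {c} a v.

(** * The graded pre-Lie identity *)

Ltac fset_cases := rewrite ?inE /= ?negb_or ?negb_and;
  repeat match goal with
   | |- context [?x \in ?Y] => case: (x \in Y)
   | |- context [?x == ?y] => case: (x == y)
  end; rewrite //= /is_true; try solve [intuition congruence].

Lemma oddabsBB (x : int) (o o' : nat) :
  odd (absz (x - o'%:Z)) = odd (absz (x - o%:Z)) (+) odd o (+) odd o'.
Proof. lia. Qed.

Section SignAux.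
Variables (K : fieldType) (X Y X' : nat).
(** The signs for inserting w into an input of u, which sits in a. *)
Lemma nested_insertion_sign t1 t2 j1 j2 s2 l2 oL oM : odd X' = odd X (+) odd Y ->
  ((-1) ^+ (t1 + t2 + (j1 + j2) + Y * (oL + oM) + (s2 + (t2 + l2) + X * oM)) =
  (-1) ^+ (s2 + (j2 + l2) + X' * oM + (t1 + j1 + Y * oL)) :> K)%N.
Proof. move=> h; apply: signP; rewrite !(oddD, oddM) h !addb_xorb; btauto. Qed.

(** The signs for inserting u and w into two different slots of a, in either
order; p1 * p2 is the Koszul sign of parallel composition. *)
Lemma parallel_insertion_sign p1 p2 ok ol st ts sM tM sJ Js tL Lt JL LJ JM LM oJ oL oM :
  odd p1 = odd X (+) odd ok (+) odd oL -> odd p2 = odd Y (+) odd ol (+) odd oJ ->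
  (Lt + tL = ol * oL -> sJ + Js = ok * oJ -> LJ + JL = oJ * oL -> st + ts = ok * ol ->
  (-1) ^+ (tL + tM + (JL + JM) + Y * (oL + oM) +
     (st + sM + (Lt + LM) + X * (ol + oM)) + p1 * p2) =
  (-1) ^+ (X * Y + (sJ + sM + (LJ + LM) + X * (oJ + oM) +
     (ts + tM + (Js + JM) + Y * (ok + oM)))) :> K)%N.
Proof.
move=> hp1 hp2 h1 h2 h3 h4.
have E x y z : (x + y = z)%N -> odd x = odd z (+) odd y.
  by move=> <-; rewrite oddD -addbA addbb addbF.
apply: signP; rewrite !(oddD, oddM) hp1 hp2 (E _ _ _ h1) (E _ _ _ h2) (E _ _ _ h3) (E _ _ _ h4).
by rewrite !oddM !addb_xorb; btauto.
Qed.
End SignAux.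

Section PreLie.
Variables (K : fieldType) (P : operad K).
Local Notation fam := (fam P).
Implicit Types (q : deco) (A D J I L M : {fset label}) (d e : int) (n : nat).

(** The simultaneous insertion of u and w into two slots of a. *)
Definition par_sum n m k l e e1 e2 c (a : fam c) (u : fam (kcol k)) (w : fam (kcol l)) : fam c :=
  fun q A d =>
  let s := (kcol k, n) in let t := (kcol l, m) in
  \sum_(J <- fpowerset A) \sum_(L <- fpowerset (A `\` J))
    (-1) ^+ (ssign l e2 q t J (A `\` J) + ssign k e1 q s L (t |` ((A `\` J) `\` L))) *:
    ocomp (kcol l) m
      (ocomp (kcol k) n
         (a q (s |` (t |` ((A `\` J) `\` L))) (e - (od q (s |` (t |` ((A `\` J) `\` L))))%:Z))
         (u q L (e1 - (od q L)%:Z))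
       : P (t |` (A `\` J)) c (e + e1 - (parity_of k)%:Z - (od q (t |` (A `\` J)))%:Z))
      (w q J (e2 - (od q J)%:Z)).

(** After u, the family w is inserted either into u or next to it. *)
Lemma star_assoc n m k l e e1 e2 c (a : fam c) (u : fam (kcol k)) (w : fam (kcol l)) q A d :
  regular e a -> regular e1 u -> regular e2 w ->
  q (kcol k, n) = k -> q (kcol l, m) = l -> (kcol k, n) != (kcol l, m) ->
  (kcol k, n) \notin A -> (kcol l, m) \notin A ->
  d = e + e1 + e2 - (parity_of k)%:Z - (parity_of l)%:Z - (od q A)%:Z ->
  star l (e + e1 - (parity_of k)%:Z) e2 (star k e e1 a u) w q A d =
  star k e (e1 + e2 - (parity_of l)%:Z) a (star l e1 e2 u w) q A d
  + par_sum n m e e1 e2 a u w q A d.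
Proof.
move=> ra ru rw qs qt st sA tA ed.
pose s := (kcol k, n); pose t := (kcol l, m).
have rau := star_regular ra ru; have ruw := star_regular ru rw.
rewrite (starE d rau rw qt tA) (starE d ra ruw qs sA) /star_sum -/s -/t.
have E1 J : J `<=` A -> star k e e1 a u q (t |` (A `\` J))
     (e + e1 - (parity_of k)%:Z - (od q (t |` (A `\` J)))%:Z) =
   star_sum n k e e1 a u q (t |` (A `\` J))
     (e + e1 - (parity_of k)%:Z - (od q (t |` (A `\` J)))%:Z).
  move=> JA; apply: (starE _ ra ru qs); rewrite !inE negb_or st negb_and.
  by rewrite sA orbT.
under eq_big_seq => J do [rewrite fpowersetE => JA; rewrite E1// /star_sum -/s sum_fpowerset_U1;
  [|by rewrite !inE negb_and tA orbT]; rewrite ocompDl scalerDr].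
rewrite big_split/= addrC; congr (_ + _).
  under eq_bigr do rewrite ocomp_suml scaler_sumr.
  rewrite sum_fpowerset_nest; apply: eq_big_seq => M; rewrite fpowersetE => MA.
  rewrite (starE _ ru rw qt); last exact: fsubset_notin tA.
  rewrite /star_sum ocomp_sumr scaler_sumr; apply: eq_big_seq => J; rewrite fpowersetE => JM.
  have JA := fsubset_trans JM MA.
  have tM : t \notin M by apply: fsubset_notin tA.
  have sM : s \notin M by apply: fsubset_notin sA.
  have -> : (t |` (A `\` J)) `\` (t |` (M `\` J)) = A `\` M.
    apply/fsetP => x; rewrite !inE; case: (eqVneq x t) => [->|_] //=.
      by rewrite (negPf tA) andbF.
    by move: (fsubsetP JM x); fset_cases.
  rewrite ocompZl ocompZr !scalerA -!exprD.
  have sI : s \notin A `\` M by apply: fsubset_notin sA; apply: fsubsetDl.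
  have tI : t \notin A `\` M by apply: fsubset_notin tA; apply: fsubsetDl.
  have tJ : t \notin A `\` J by apply: fsubset_notin tA; apply: fsubsetDl.
  have tMJ : t \notin M `\` J by apply: fsubset_notin tM; apply: fsubsetDl.
  have eAJ : A `\` J = (M `\` J) `|` (A `\` M).
    by apply/fsetP => x; move: (fsubsetP JM x) (fsubsetP MA x); fset_cases.
  have dMJ : [disjoint M `\` J & A `\` M]%fset.
    by apply/fdisjointP => x; rewrite !inE => /andP[_ ->].
  have dJM : [disjoint J & M `\` J]%fset := fdisjointDr _ _.
  have eM : M = J `|` (M `\` J) by rewrite fsetUC fsetD_subU.
  have odAJ : od q (A `\` J) = (od q (M `\` J) + od q (A `\` M))%N by rewrite eAJ odU.
  have odM : od q M = (od q J + od q (M `\` J))%N by rewrite {1}eM odU.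
  have odA : od q A = (od q (A `\` M) + od q M)%N by rewrite -{1}(fsetD_subU MA) odU// fdisjointDl.
  congr (_ *: _).
    rewrite /ssign -/t odAJ {1 2}eAJ.
    rewrite !(ivUr _ _ dMJ).
    have -> I : iv q (t |` (M `\` J)) I = (iv q [fset t] I + iv q (M `\` J) I)%N.
      by apply: ivUl; rewrite fdisjoint1X.
    have -> I : iv q M I = (iv q J I + iv q (M `\` J) I)%N by rewrite {1}eM ivUl.
    by apply: (@nested_insertion_sign K); rewrite -oddabsD; congr (odd (absz _)); clear; lia.
  apply: (@ocomp_seqA _ P _ (t |` (M `\` J)) J (t |` (A `\` J)) A M).
  - have eAM : (t |` (A `\` J)) `\` (t |` (M `\` J)) = A `\` M.
      by apply/fsetP => x; move: (fsubsetP JM x) (fsubsetP MA x) (negPf tA);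
        rewrite !inE; case: (eqVneq x t) => [->|_]; fset_cases.
    rewrite -eAM; apply: graftU.
      by rewrite !inE negb_or st negb_and sA orbT.
    by apply/fsubsetP => x; move: (fsubsetP MA x); fset_cases.
  - exact: graftU.
  - exact: graftU.
  - exact: graftU.
  - rewrite !odU1// qs qt odAJ !PoszD; clear; lia.
  - rewrite ed odA odM !odU1// qt odAJ !PoszD; clear; lia.
  - rewrite odM !odU1// qt !PoszD; clear; lia.
apply: eq_big_seq => J; rewrite fpowersetE => JA.
rewrite ocomp_suml scaler_sumr; apply: eq_big_seq => L; rewrite fpowersetE => LA.
have -> : (t |` (A `\` J)) `\` L = t |` ((A `\` J) `\` L).
  apply/fsetP => x; rewrite !inE; case: (eqVneq x t) => [->|//] /=.
  by rewrite andbT; apply: contra tA => /(fsubsetP LA); rewrite inE => /andP[].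
by rewrite ocompZl scalerA -exprD.
Qed.

Lemma par_sumC n m k l e e1 e2 c (a : fam c) (u : fam (kcol k)) (w : fam (kcol l)) q A d :
  q (kcol k, n) = k -> q (kcol l, m) = l -> (kcol k, n) != (kcol l, m) ->
  (kcol k, n) \notin A -> (kcol l, m) \notin A ->
  d = e + e1 + e2 - (parity_of k)%:Z - (parity_of l)%:Z - (od q A)%:Z ->
  par_sum n m e e1 e2 a u w q A d =
  (-1) ^+ (absz (e1 - (parity_of k)%:Z) * absz (e2 - (parity_of l)%:Z)) *: par_sum m n e e2 e1 a w u q A d.
Proof.
move=> qs qt st sA tA ed; rewrite /par_sum; pose s := (kcol k, n); pose t := (kcol l, m).
rewrite -/s -/t [in RHS]sum_fpowersetC2 scaler_sumr.
apply: eq_big_seq => J; rewrite fpowersetE => JA.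
rewrite scaler_sumr; apply: eq_big_seq => L; rewrite fpowersetE => LA.
rewrite scalerA.
have sJ : s \notin A `\` J by apply: fsubset_notin sA; apply: fsubsetDl.
have tJ : t \notin A `\` J by apply: fsubset_notin tA; apply: fsubsetDl.
have sL : s \notin A `\` L by apply: fsubset_notin sA; apply: fsubsetDl.
have tL : t \notin A `\` L by apply: fsubset_notin tA; apply: fsubsetDl.
have LA' : L `<=` A by apply: (fsubset_trans LA); apply: fsubsetDl.
have JA' : J `<=` A `\` L.
  by apply/fsubsetP => x; move: (fsubsetP JA x) (fsubsetP LA x); fset_cases.
have -> : (A `\` L) `\` J = (A `\` J) `\` L by rewrite !fsetDDl fsetUC.
set M := (A `\` J) `\` L.
have sM : s \notin M by apply: fsubset_notin sJ; apply: fsubsetDl.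
have tM : t \notin M by apply: fsubset_notin tJ; apply: fsubsetDl.
have eAJ : A `\` J = L `|` M by rewrite fsetUC fsetD_subU.
have eAL : A `\` L = J `|` M.
  by apply/fsetP => x; rewrite /M; move: (fsubsetP JA x) (fsubsetP LA x); fset_cases.
have dLM : [disjoint L & M]%fset by apply: fdisjointDr.
have dJM : [disjoint J & M]%fset.
  by apply/fdisjointP => x xJ; rewrite !inE xJ andbF.
have dJL : [disjoint J & L]%fset.
  by apply/fdisjointP => x xJ; apply/negP => /(fsubsetP LA); rewrite inE xJ.
have odAJ : od q (A `\` J) = (od q L + od q M)%N by rewrite eAJ odU.
have odAL : od q (A `\` L) = (od q J + od q M)%N by rewrite eAL odU.
have odA : od q A = (od q L + od q M + od q J)%N.
  by rewrite -{1}(fsetD_subU JA) odU ?fdisjointDl// odAJ.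
have tsM : t \notin s |` M by rewrite in_fset1U negb_or eq_sym st.
have stM : s \notin t |` M by rewrite in_fset1U negb_or st.
rewrite (@ocomp_parA _ P _ L J (t |` (A `\` J)) A (s |` (A `\` L)) c (kcol k) (kcol l) n m
   _ _ _ _ (e + e2 - (parity_of l)%:Z - (od q (s |` (A `\` L)))%:Z)).
- rewrite scalerA fsetUCA /koszul.
  congr (_ *: _); rewrite -!exprD /ssign -/s -/t odAJ odAL {1 2}eAJ {1 2}eAL.
  rewrite !(ivUr _ _ dLM) !(ivUr _ _ dJM) !odU1// qs qt.
  have dt : [disjoint [fset t] & M]%fset by rewrite fdisjoint1X.
  have ds : [disjoint [fset s] & M]%fset by rewrite fdisjoint1X.
  rewrite !(ivUr _ _ dt) !(ivUr _ _ ds) abszM.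
  apply: (@parallel_insertion_sign K).
  - exact: oddabsBB.
  - exact: oddabsBB.
  - by rewrite ivC ?od1 ?qt// fdisjoint1X; apply: fsubset_notin tA.
  - by rewrite addnC ivC ?od1 ?qs// fdisjoint1X; apply: fsubset_notin sA.
  - by rewrite ivC.
  - by rewrite addnC ivC ?od1 ?qs ?qt// fdisjoint1X inE.
- exact: st.
- by rewrite !inE eqxx.
- by rewrite !inE eqxx !orbT.
- have -> : t |` M = (t |` (A `\` J)) `\` L.
    apply/fsetP => x; rewrite /M !inE; case: (eqVneq x t) => [->|_] /=.
      by rewrite (fsubset_notin LA tJ).
    by move: (fsubsetP LA x); fset_cases.
  by apply: graftU; [rewrite in_fset1U negb_or st|apply/fsubsetP => x; move: (fsubsetP LA x); fset_cases].
- exact: graftU.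
- have -> : s |` (t |` M) = t |` ((s |` (A `\` L)) `\` J).
    rewrite fsetUCA; congr (_ |` _).
    apply/fsetP => x; rewrite eAL !inE; case: (eqVneq x s) => [->|_] /=.
      by rewrite (fsubset_notin JA sA).
    by move: (fdisjointP dJM x); rewrite /M; fset_cases.
  apply: graftU; first by rewrite in_fset1U negb_or eq_sym st.
  by apply/fsubsetP => x; move: (fsubsetP JA' x); fset_cases.
- exact: graftU.
- rewrite !odU1// qs qt odAJ !PoszD; clear; lia.
- rewrite ed odA !odU1// qt odAJ !PoszD; clear; lia.
- rewrite !odU1// qs qt odAL !PoszD; clear; lia.
Qed.

(** The graded pre-Lie identity: by [star_assoc] the associator only consists of
simultaneous insertions, which commute up to a Koszul sign. It computes the
commutator of two vector fields. *)
Lemma star_comm k l e e1 e2 c (a : fam c) (u : fam (kcol k)) (w : fam (kcol l)) :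
  regular e a -> regular e1 u -> regular e2 w ->
  star l (e + e1 - (parity_of k)%:Z) e2 (star k e e1 a u) w =
  star k e (e1 + e2 - (parity_of l)%:Z) a (star l e1 e2 u w) +
  (-1) ^+ (absz (e1 - (parity_of k)%:Z) * absz (e2 - (parity_of l)%:Z)) *:
   (star k (e + e2 - (parity_of l)%:Z) e1 (star l e e2 a w) u
    - star l e (e2 + e1 - (parity_of k)%:Z) a (star k e2 e1 w u)).
Proof.
move=> ra ru rw; apply: fam_ext => q A d; rewrite !famE.
pose n := fresh A; pose m := (fresh A).+1.
pose q' := upd (upd q (kcol k, n) k) (kcol l, m) l.
have sA : (kcol k, n) \notin A by apply: freshP.
have tA : (kcol l, m) \notin A by apply/freshP/leqnSn.
have st : (kcol k, n) != (kcol l, m).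
  by rewrite xpair_eqE negb_and orbC -[_ == m]/(n == n.+1) neq_ltn ltnSn.
have qt : q' (kcol l, m) = l by apply: updE.
have qs : q' (kcol k, n) = k by rewrite /q' /upd (negPf st) eqxx.
have qq : {in A, q =1 q'}.
  by move=> x xA; rewrite /q' (upd_out _ _ tA xA) (upd_out _ _ sA xA).
have X c0 e0 (b : fam c0) : regular e0 b -> b q A d = b q' A d.
  by move=> rb; apply: (reg_ext _ rb).
have rau := star_regular ra ru; have raw := star_regular ra rw.
have ruw := star_regular ru rw; have rwu := star_regular rw ru.
rewrite (X _ _ _ (star_regular rau rw)) (X _ _ _ (star_regular ra ruw)).
rewrite (X _ _ _ (star_regular raw ru)) (X _ _ _ (star_regular ra rwu)).
have [ed|nd] := eqVneq d (e + e1 + e2 - (parity_of k)%:Z - (parity_of l)%:Z - (od q' A)%:Z); last first.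
  rewrite !star_hom ?subr0 ?scaler0 ?addr0//; apply: contra nd => /eqP ->;
  apply/eqP; clear; lia.
rewrite (star_assoc ra ru rw qs qt st sA tA ed) (star_assoc ra rw ru qt qs _ tA sA) ?(eq_sym _ (kcol k, n))//;
  last by rewrite ed; clear; lia.
congr (_ + _); rewrite (par_sumC a u w qs qt st sA tA ed).
by congr (_ *: _); rewrite [RHS]addrC addKr.
Qed.

End PreLie.

(** * Morphisms, differentials, supports and coordinate functions *)

Section Morphisms.
Variables (K : fieldType) (O P : operad K) (h : morphism O P).
Lemma mmap0 A c d : mmap h (0 : O A c d) = 0.
Proof.
by have := mmap_linear h (-1) 0 (0 : O A c d); rewrite !scaleN1r oppr0 !addr0 addNr.
Qed.
Lemma mmapD A c d (a b : O A c d) : mmap h (a + b) = mmap h a + mmap h b.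
Proof. by have := mmap_linear h 1 a b; rewrite !scale1r. Qed.
Lemma mmapZ A c d k (a : O A c d) : mmap h (k *: a) = k *: mmap h a.
Proof. by have := mmap_linear h k a 0; rewrite mmap0 !addr0. Qed.
Lemma mmap_sum A c d T (r : seq T) (Q : pred T) (F : T -> O A c d) :
  mmap h (\sum_(i <- r | Q i) F i) = \sum_(i <- r | Q i) mmap h (F i).
Proof. by elim/big_rec2: _ => [|i x y _ <-]; rewrite ?mmap0 ?mmapD. Qed.

Definition fmap c (a : fam O c) : fam P c := fun q A d => mmap h (a q A d).

Lemma fmap_star k e e' c (a : fam O c) (v : fam O (kcol k)) :
  fmap (star k e e' a v) = star k e e' (fmap a) (fmap v).
Proof.
apply: fam_ext => q A d; rewrite /fmap /star /star_sum mmap_sum.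
by apply: eq_bigr => J _; rewrite mmapZ mmap_comp.
Qed.
Lemma fmapD c (a b : fam O c) : fmap (a + b) = fmap a + fmap b.
Proof. by apply: fam_ext => q A d; rewrite /fmap mmapD. Qed.
Lemma fmapZ c k (a : fam O c) : fmap (k *: a) = k *: fmap a.
Proof. by apply: fam_ext => q A d; rewrite /fmap mmapZ. Qed.
Lemma fmap_reg c e (a : fam O c) : regular e a -> regular e (fmap a).
Proof.
move=> ra; split=> [q A d nd|f q q' A D d rf hq]; rewrite /fmap.
  by rewrite (reg_hom ra)// mmap0.
by rewrite -mmap_rel (reg_rel ra d rf hq) mmapZ.
Qed.
End Morphisms.

Section Diff.
Variables (K : fieldType) (P : operad K) (D : differential P).
Implicit Types (q : deco) (A J I : {fset label}) (d e : int).

Lemma dmap0 A c d : dmap D (0 : P A c d) = 0.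
Proof.
by have := dmap_linear D (-1) 0 (0 : P A c d); rewrite !scaleN1r oppr0 !addr0 addNr.
Qed.
Lemma dmapD A c d (a b : P A c d) : dmap D (a + b) = dmap D a + dmap D b.
Proof. by have := dmap_linear D 1 a b; rewrite !scale1r. Qed.
Lemma dmapZ A c d k (a : P A c d) : dmap D (k *: a) = k *: dmap D a.
Proof. by have := dmap_linear D k a 0; rewrite dmap0 !addr0. Qed.
Lemma dmap_sum A c d T (r : seq T) (Q : pred T) (F : T -> P A c d) :
  dmap D (\sum_(i <- r | Q i) F i) = \sum_(i <- r | Q i) dmap D (F i).
Proof. by elim/big_rec2: _ => [|i x y _ <-]; rewrite ?dmap0 ?dmapD. Qed.

(** Grafting on a unit moves an operation to a propositionally equal degree,
and sends it to 0 in all other degrees. *)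
Definition dcast A c d d' (x : P A c d) : P A c d' := ocomp c 0 (ounit P c 0) x.

Lemma dcast_id A c d (x : P A c d) : dcast d x = x.
Proof. exact: ocomp_unitl. Qed.

(** Since the differential raises the degree by one, the coefficient of degree d
comes from the one of degree d - 1, and must be moved from degree (d - 1) + 1. *)
Definition fdiff c (a : fam P c) : fam P c := fun q A d =>
  dcast d (dmap D (a q A (d - 1))).

Lemma fdiffE c (a : fam P c) q A d : fdiff a q A (d + 1) = dmap D (a q A d).
Proof.
have E d2 : d2 = d -> dcast (d + 1) (dmap D (a q A d2)) = dmap D (a q A d).
  by move=> ->; rewrite dcast_id.
by rewrite /fdiff E// addrK.
Qed.

Lemma deg_pred d : exists d1, d = d1 + 1.
Proof. by exists (d - 1); rewrite subrK. Qed.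

Lemma fdiff_reg c e (a : fam P c) : regular e a -> regular (e + 1) (fdiff a).
Proof.
move=> ra; split=> [q A d|f q q' A B d rf h]; have [d1 ->] := deg_pred d; rewrite !fdiffE.
  move=> nd; rewrite (reg_hom ra) ?dmap0//; apply: contra nd => /eqP ->.
  by apply/eqP; clear; lia.
by rewrite -dmap_rel (reg_rel ra d1 rf h) dmapZ.
Qed.

Lemma fdiffD c (a b : fam P c) : fdiff (a + b) = fdiff a + fdiff b.
Proof. by apply: fam_ext => q A d; have [d1 ->] := deg_pred d; rewrite famE !fdiffE dmapD. Qed.
Lemma fdiffZ c k (a : fam P c) : fdiff (k *: a) = k *: fdiff a.
Proof. by apply: fam_ext => q A d; have [d1 ->] := deg_pred d; rewrite famE !fdiffE dmapZ. Qed.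

Lemma fdiff_star k e e' c (a : fam P c) (v : fam P (kcol k)) :
  fdiff (star k e e' a v) = star k (e + 1) e' (fdiff a) v +
     (-1) ^+ (absz e + parity_of k) *: star k e (e' + 1) a (fdiff v).
Proof.
apply: fam_ext => q A d; have [d1 ->] := deg_pred d; rewrite !famE fdiffE.
rewrite /star /star_sum; set q' := upd _ _ _.
rewrite dmap_sum scaler_sumr -big_split; apply: eq_big_seq => J; rewrite fpowersetE => JA /=.
rewrite dmapZ dmap_comp scalerDr -!fdiffE.
have -> S : e + 1 - (od q' S)%:Z = e - (od q' S)%:Z + 1 by clear; lia.
have -> S : e' + 1 - (od q' S)%:Z = e' - (od q' S)%:Z + 1 by clear; lia.
congr (_ + _); rewrite !scalerA; congr (_ *: _).
rewrite /koszul /ssign -!exprD mul1r odU1; last first.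
  by apply: fsubset_notin (freshP _ (leqnn _)); apply: fsubsetDl.
have -> : q' (kcol k, fresh A) = k by apply: updE.
have -> : e' + 1 - (parity_of k)%:Z = e' - (parity_of k)%:Z + 1 by clear; lia.
set i := iv _ _ _; set j := iv _ _ _; set o := od _ _; set x := e' - _.
have : odd (absz (e - (parity_of k + o)%N%:Z)) = odd (absz e) (+) odd (parity_of k) (+) odd o.
  by clear; lia.
have : odd (absz (x + 1)) = ~~ odd (absz x) by clear; lia.
move=> h1 h2; apply: signP; rewrite !(oddD, oddM) h1 h2 !addb_xorb; btauto.
Qed.
End Diff.

Section Supports.
Variables (K : fieldType) (P : operad K).
Local Notation fam := (fam P).
Implicit Types (q : deco) (A J I : {fset label}) (d e : int) (k l : kind).

(** One notion for the independence of a variable and for the restriction of a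
kind to the labels of one colour. *)
Definition avoid (B : label -> kind -> Prop) c (a : fam c) :=
  forall q A d x, x \in A -> B x (q x) -> a q A d = 0.

Lemma avoidD B c (a b : fam c) : avoid B a -> avoid B b -> avoid B (a + b).
Proof. by move=> ha hb q A d x xA qx; rewrite famE (ha _ _ _ x) ?(hb _ _ _ x) ?addr0. Qed.
Lemma avoidZ B c z (a : fam c) : avoid B a -> avoid B (z *: a).
Proof. by move=> ha q A d x xA qx; rewrite famE (ha _ _ _ x) ?scaler0. Qed.
Lemma avoidN B c (a : fam c) : avoid B a -> avoid B (- a).
Proof. by rewrite -scaleN1r; apply: avoidZ. Qed.

Lemma avoid_star B k e e' c (a : fam c) (v : fam (kcol k)) :
  avoid B a -> avoid B v -> avoid B (star k e e' a v).
Proof.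
move=> fa fv q A d x xA qx; rewrite /star /star_sum big_seq big1// => J; rewrite fpowersetE => JA.
have sA := freshP (kcol k) (leqnn (fresh A)).
have q'x := upd_out q k sA xA.
have [xJ|xJ] := boolP (x \in J); first by rewrite (fv _ _ _ x) ?q'x// ocomp0r scaler0.
by rewrite (fa _ _ _ x) ?q'x// ?inE ?xJ ?xA ?orbT// ocomp0l scaler0.
Qed.

Lemma fdiff_avoid (D : differential P) B c (a : fam c) : avoid B a -> avoid B (fdiff D a).
Proof.
by move=> fa q A d x xA qx; have [d1 ->] := deg_pred d; rewrite fdiffE (fa _ _ _ x)// dmap0.
Qed.

Lemma star_lacks0 k e e' c (a : fam c) (v : fam (kcol k)) :
  avoid (fun _ l => l = k) a -> star k e e' a v = 0.
Proof.
move=> fa; apply: fam_ext => q A d; rewrite /star /star_sum big1// => J _.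
by rewrite (fa _ _ _ (kcol k, fresh A)) ?updE ?inE ?eqxx// ocomp0l scaler0.
Qed.
End Supports.

Notation lacks k := (avoid (fun _ l => l = k)).

Section Units.
Variables (K : fieldType) (P : operad K).
Local Notation fam := (fam P).
Implicit Types (q : deco) (A J I : {fset label}) (d e : int) (k l : kind).

(** The coordinate function of kind k, whose only coefficient is the operadic
unit. Composing the unit with itself moves it to the required set of inputs and
degree, and gives 0 when these are not those of a unit. *)
Definition unitf cc k : fam cc := fun q A d =>
  \sum_(x <- A | (x.1 == cc) && (q x == k))
    ocomp cc x.2 (ounit P cc x.2) (ounit P cc x.2).

Lemma unitf_out cc k q A d : (forall z, A <> [fset (cc, z)]) -> unitf cc k q A d = 0.
Proof.
move=> nA; rewrite /unitf big_seq_cond big1// => -[c z] /and3P[xA /= /eqP ec _].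
rewrite ocomp_out// => -[[_ _ eA] _]; apply: (nA z); rewrite eA.
by apply/fsetP => y; rewrite !inE andNb.
Qed.

Lemma unitf1 cc k q z d : unitf cc k q [fset (cc, z)] d =
  if q (cc, z) == k then dcast d (ounit P cc z) else 0.
Proof.
rewrite /unitf big_mkcond big_seq_fset1 /= eqxx /=; case: eqP => // _.
have [->|nd] := eqVneq d 0; first by rewrite dcast_id ocomp_unitl.
by rewrite /dcast !ocomp_out// => -[_ ed]; rewrite -ed addr0 eqxx in nd.
Qed.

Lemma fset1_exP cc A : (exists z, A = [fset (cc, z)]) \/ (forall z, A <> [fset (cc, z)]).
Proof.
have [h|h] := pselect (exists z, A = [fset (cc, z)]); first by left.
by right=> z eA; apply: h; exists z.
Qed.

Lemma dcast_neq A c d d' (x : P A c d) : d' != d -> dcast d' x = 0.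
Proof. by move=> nd; rewrite /dcast ocomp_out// => -[_]; rewrite add0r => e; rewrite e eqxx in nd. Qed.

Lemma orel_cast f A B c d d' (x : P A c d) :
  orel f (dcast d' x) = dcast d' (orel f x : P B c d).
Proof.
have [->|nd] := eqVneq d' d; first by rewrite !dcast_id.
by rewrite !dcast_neq// orel0.
Qed.

Lemma unitf_reg cc k : regular (parity_of k)%:Z (unitf cc k).
Proof.
split=> [q A d nd|f q q' A D d [fi rf] h].
  have [[z eA]|nA] := fset1_exP cc A; last exact: unitf_out.
  rewrite eA in nd *; rewrite unitf1; case: eqP => // qz; rewrite dcast_neq//; apply: contra nd => /eqP->.
  by rewrite od1 qz subrr.
have [[z eA]|nA] := fset1_exP cc A; last first.
  rewrite !unitf_out// ?orel0 ?scaler0// => z eD; rewrite eD in rf.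
  have /imfsetP[/= x xA ex] : (cc, z) \in rename f @` A by rewrite -rf inE.
  apply: (nA x.2); apply/fsetP => y; rewrite inE.
  have ex1 : x = (cc, x.2) by rewrite (surjective_pairing x) -[x.1]/(rename f x).1 -ex.
  rewrite -ex1; apply/idP/eqP => [yA|->//]; apply: fi => //.
  have : rename f y \in rename f @` A by rewrite in_imfset.
  by rewrite -rf inE -ex => /eqP.
rewrite eA in fi rf h *; rewrite imfset_fset1 in rf; rewrite rf rinv1 scale1r unitf1.
have hz : q' (rename f (cc, z)) = q (cc, z) by apply: h; rewrite inE.
rewrite unitf1 hz; case: eqP => _; last by rewrite orel0.
by rewrite orel_cast orel_unit.
Qed.

(** The coordinate of kind k is mapped to v by the derivation v d/dk. *)
Lemma star_unitl k e (v : fam (kcol k)) : regular e v ->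
  star k (parity_of k)%:Z e (unitf (kcol k) k) v = v.
Proof.
move=> rv; apply: fam_ext => q A d; rewrite /star /star_sum.
have sA := freshP (kcol k) (leqnn (fresh A)).
set q' := upd _ _ _; have qs : q' (kcol k, fresh A) = k by apply: updE.
have vq : v q A d = v q' A d.
  by apply: (reg_ext _ rv) => x xA; rewrite /q' (upd_out q k sA xA).
have AA : A \in fpowerset A by rewrite fpowersetE.
rewrite (big_fsetD1 A)//= big_seq big1 => [|J].
  rewrite addr0 fsetDv /ssign od0 muln0 addn0.
  have iv0 I : iv q' I fset0 = 0%N by rewrite /iv big1// => x _; rewrite big_seq_fset0.
  rewrite !iv0 expr0 scale1r fsetU0 unitf1 qs eqxx od1 qs subrr dcast_id vq.
  have [->|nd] := eqVneq d (e - (od q' A)%:Z); first by rewrite ocomp_unitl.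
  by rewrite (reg_hom rv nd) ocomp_out// => -[_ ed]; rewrite -ed add0r eqxx in nd.
rewrite !inE fpowersetE => /andP[nJ JA]; rewrite unitf_out ?ocomp0l ?scaler0// => z eA.
move/negP: nJ; apply; rewrite eqEfsubset JA /=.
have : (kcol k, fresh A) \in [fset (kcol k, z)] by rewrite -eA !inE eqxx.
rewrite inE => /eqP es; rewrite -es in eA.
apply/fsubsetP => x xA; apply/negPn/negP => xJ.
have : x \in [fset (kcol k, fresh A)] by rewrite -eA !inE xJ xA orbT.
by rewrite inE => /eqP ex; rewrite -ex xA in sA.
Qed.

(** The derivation y d/dz replaces one variable z by y. Here the slot of kind k
is filled by the unit of kind l, so that every input of kind l is in turn
regarded as one of kind k. *)
Lemma star_unitr k l e c (a : fam c) q A d : regular e a ->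
  star k e (parity_of l)%:Z a (unitf (kcol k) l) q A d =
  \sum_(x <- A | (x.1 == kcol k) && (q x == l))
    (-1) ^+ (absz ((parity_of l)%:Z - (parity_of k)%:Z) * od q (A `\ x) +
             (iv q [fset x] (A `\ x) + iv (upd q x k) [fset x] (A `\ x))) *:
    a (upd q x k) A d.
Proof.
move=> ra; have ru := unitf_reg (kcol k) l.
pose s := (kcol k, fresh A); have sA : s \notin A by apply: freshP.
have [ed|nd] := eqVneq d (e + (parity_of l)%:Z - (parity_of k)%:Z - (od q A)%:Z); last first.
  rewrite star_hom// big_seq_cond big1// => x /and3P[xA _ /eqP qx].
  rewrite (reg_hom ra) ?scaler0//; apply: contra nd => /eqP ->; apply/eqP.
  rewrite -(fsetD1K xA) !odU1 ?fsetD11// updE qx (@od_ext (upd q x k) q) ?PoszD; first lia.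
  by apply: upd_out; rewrite fsetD11.
rewrite /star /star_sum -/s; set q' := upd q s k.
have qs : q' s = k by apply: updE.
have q'E : {in A, q' =1 q} by move=> x xA; apply: (upd_out q k sA xA).
rewrite (bigID (fun J => [exists x : A, J == [fset val x]]))/= [X in _ + X]big_seq_cond.
rewrite [X in _ + X]big1 ?addr0; last first.
  move=> J; rewrite fpowersetE => /andP[JA /existsPn nJ].
  rewrite unitf_out ?ocomp0r ?scaler0// => z eJ.
  have zA : (kcol k, z) \in A by apply: (fsubsetP JA); rewrite eJ inE.
  by have := nJ [` zA]; rewrite eJ /= eqxx.
rewrite (@big_fset_bij _ _ _ A _ (fun x => [fset x]) predT); last 2 first.
- by move=> x y _ _ _ _ /fset1_inj.
- move=> J; rewrite fpowersetE; apply: (iffP andP) => [[_ /existsP[x /eqP->]]|[x [xA _ ->]]].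
    by exists (val x); split=> //; apply: valP.
  by rewrite fsub1set; split=> //; apply/existsP; exists [` xA].
rewrite [RHS]big_mkcond; apply: eq_big_seq => -[cx z] xA; set x := (cx, z).
case: ifPn => [/andP[/eqP /= ec qx]|]; last first.
  rewrite negb_and => nx; case: (eqVneq cx (kcol k)) nx => [ec|nc] /= nx.
    rewrite /x ec unitf1 -ec q'E// -/x (negPf nx) ocomp0r scaler0 //.
  rewrite unitf_out ?ocomp0r ?scaler0// => z0 e0; have : x \in [fset x] by rewrite inE.
  by rewrite e0 inE xpair_eqE (negPf nc).
subst cx; rewrite unitf1 q'E// qx od1 q'E// -/x (eqP qx) subrr dcast_id.
have sI : s \notin A `\ x by apply: fsubset_notin sA; apply: fsubsetDl.
have odI : od q' (A `\ x) = od q (A `\ x).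
  by apply: od_ext => w; rewrite inE => /andP[_]; apply: q'E.
set S := s |` (A `\ x).
have eS : e - (od q' S)%:Z = d.
  have odA : od q A = (parity_of l + od q (A `\ x))%N.
    by rewrite -{1}(fsetD1K xA) odU1 ?fsetD11// (eqP qx).
  rewrite ed odU1// qs odI odA !PoszD; clear; lia.
rewrite eS.
(* composing with the unit renames the slot to x *)
pose g : renaming := fun c0 m => if (c0, m) == s then z else m.
have gs : rename g s = x by rewrite /rename /g /= eqxx.
have gI : {in A, rename g =1 id}.
  move=> [c0 m] yA; rewrite /rename/g /=; case: eqP => // e0; by rewrite -e0 yA in sA.
have gI' : {in A `\ x, rename g =1 id}.
  by move=> w; rewrite inE => /andP[_ wA]; apply: gI.
have eI : rename g @` (A `\ x) = A `\ x.
  by rewrite -[RHS]imfset_id; apply: eq_in_imfset.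
have rg : relabels g S A.
  split; last by rewrite /S imfsetU1 gs eI fsetD1K.
  move=> u v; rewrite !in_fset1U => /orP[/eqP->|uA] /orP[/eqP->|vA] //.
  - by rewrite gs gI'// => e0; rewrite -e0 fsetD11 in vA.
  - by rewrite gs gI'// => e0; rewrite e0 fsetD11 in uA.
  - by rewrite !gI'.
have hq : {in S, forall w, upd q x k (rename g w) = q' w}.
  move=> w; rewrite in_fset1U => /orP[/eqP->|wA]; first by rewrite gs updE qs.
  rewrite gI'// q'E; last by move: wA; rewrite inE => /andP[].
  by apply: upd_out wA; rewrite fsetD11.
have gr : graft S s [fset x] A by apply: graftU => //; rewrite fsub1set.
have -> : ocomp (kcol k) (fresh A) (a q' S d) (ounit P (kcol k) z) = orel g (a q' S d) :> P A c d.
  rewrite -[LHS]orel_id (@orel_comp _ P (fun=> id) g (fun=> id) _ A _ [fset x] _ A).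
  - rewrite [g _ _]/(rename g s).2 gs orel_id.
    exact: ocomp_unitr.
  - by [].
  - rewrite [g _ _]/(rename g s).2 gs; split=> //.
      by apply/fdisjointP => w; rewrite !inE => /andP[].
    by rewrite fsetUC fsetD1K.
  - exact: relabels_id.
  - exact: rg.
  - exact: relabels_id.
  - by move=> w; rewrite fsetU1K// => wA; rewrite gI'// rename_id.
  - by [].
rewrite (reg_rel ra _ rg hq) scalerA -exprD; congr (_ *: _).
have dsI : [disjoint [fset s] & A `\ x]%fset by rewrite fdisjoint1X.
have [w hw] : exists w, (rinv q' g (s |` (A `\ x)) + 2 * w = rinv q' g [fset s] +
   rinv q' g (A `\ x) + iv q' [fset s] (A `\ x) +
   iv (upd q x k) (rename g @` [fset s]) (rename g @` (A `\ x)))%N.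
  by apply: rinvU => //; have [] := rg.
have rg0 : rinv q' g (A `\ x) = 0%N.
  rewrite -[RHS](rinv_id q' (A `\ x)); apply: rinv_ext => // v /gI' ->.
  by rewrite rename_id.
rewrite rinv1 rg0 imfset_fset1 gs eI in hw.
have ivx : iv q' [fset x] (A `\ x) = iv q [fset x] (A `\ x).
  apply: iv_ext => v; first by rewrite inE => /eqP ->; apply: q'E.
  by rewrite inE => /andP[_]; apply: q'E.
rewrite /ssign -/s odI ivx.
apply: (@sign_mod2 _ _ _ w (iv q' [fset s] (A `\ x))).
set o := od _ _; set b := absz _.
suff : (iv q' [fset s] (A `\ x) + iv q [fset x] (A `\ x) + b * o + rinv q' g S + 2 * w =
 b * o + (iv q [fset x] (A `\ x) + iv (upd q x k) [fset x] (A `\ x)) + 2 * iv q' [fset s] (A `\ x))%N by [].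
rewrite -addnA [X in (_ + X)%N]hw add0n; clear; lia.
Qed.

Lemma unitf_lacks cc k l : k <> l -> lacks l (unitf cc k).
Proof.
move=> kl q A d x xA qx; have [[z eA]|nA] := fset1_exP cc A; last exact: unitf_out.
rewrite eA unitf1; case: eqP => // qz.
by move: xA; rewrite eA inE => /eqP ex; case: kl; rewrite -qz -qx ex.
Qed.
End Units.

(** * Restrictions, weights and exponentials of derivations *)

(** A sequence of operations with inputs of a single type, as a function of one
variable of kind k. *)
Definition pure (K : fieldType) (P : operad K) c (G : forall A d, P A c d) k : fam P c :=
  fun q A d => if all (fun x => q x == k) A then G A d else 0.

Lemma pure_lacks (K : fieldType) (P : operad K) c (G : forall A d, P A c d) k l :
  l <> k -> lacks l (pure G k).
Proof.
move=> lk q A d x xA qx; rewrite /pure; case: allP => // h.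
by case: lk; rewrite -qx; apply/eqP/h.
Qed.

Section Corolla.
Variables (K : fieldType) (S : signature) (P : operad K) (I : interp S P).
Variables (g : gen S) (k : kind).

Lemma nin_card (A : {fset label}) : (nin A Straight + nin A Wavy = #|` A|)%N.
Proof.
rewrite /nin -cardfsUI.
have -> : [fset x in A | x.1 == Straight] `|` [fset x in A | x.1 == Wavy] = A.
  by apply/fsetP => -[[] z]; rewrite !inE /= ?andbT ?andbF ?orbF.
have -> : [fset x in A | x.1 == Straight] `&` [fset x in A | x.1 == Wavy] = fset0.
  by apply/fsetP => -[[] z]; rewrite !inE /= ?andbT ?andbF ?orbF.
by rewrite cardfs0 addn0.
Qed.

Lemma od_all q (A : {fset label}) : parity_of k = 1%N -> all (fun x => q x == k) A -> od q A = #|` A|.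
Proof.
move=> ok1 /allP h; rewrite /od (eq_big_seq (fun=> 1%N)) ?sum1_size//.
by move=> x /h /eqP ->.
Qed.

Lemma pure_reg e : parity_of k = 1%N -> (forall c, gskew g c) ->
  (forall m n, gok g m n -> gdeg g m n = e - (m + n)%N%:Z) -> regular e (pure (ival I g) k).
Proof.
move=> ok1 sk dg; split=> [q A d|f q q' A D d rf h]; rewrite /pure.
  case: ifP => // hA nd; rewrite ival_out//; apply: contra nd => /andP[ok /eqP ->].
  by rewrite dg// nin_card (od_all ok1 hA).
have [fi eD] := rf.
have -> : all (fun x => q' x == k) D = all (fun x => q x == k) A.
  rewrite eD; apply/allP/allP => hA x.
    by move=> xA; rewrite -h//; apply: hA; apply: in_imfset.
  by move=> /imfsetP[/= y yA ->]; rewrite h//; apply: hA.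
case: ifP => hA; last by rewrite orel0 scaler0.
rewrite (ival_rel I g d rf); congr (_ ^+ _ *: _).
rewrite /inversions /rinv; apply: eq_big_seq => x xA; apply: eq_big_seq => y yA.
rewrite (eqP (allP hA _ xA)) (eqP (allP hA _ yA)) ok1 sk /= /lab_lt /rename /=.
by rewrite !mul1n; case: x y {xA yA} => [[] i] [[] j] /=.
Qed.

End Corolla.

Section Kill.
Variables (K : fieldType) (P : operad K).
Local Notation fam := (fam P).
Implicit Types (q : deco) (A J I : {fset label}) (d e : int) (k l : kind).

(** Restriction to the locus where the variable of kind l vanishes. *)
Definition kill l c (a : fam c) : fam c := fun q A d =>
  if has (fun x => q x == l) A then 0 else a q A d.

Lemma kill_linear l c : linear (@kill l c).
Proof.
move=> z a b; apply: fam_ext => q A d; rewrite /kill !famE.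
by case: ifP; rewrite ?scaler0 ?addr0.
Qed.
Lemma killD l c (a b : fam c) : kill l (a + b) = kill l a + kill l b.
Proof. by have := kill_linear l 1 a b; rewrite !scale1r. Qed.
Lemma kill0 l c : kill l (0 : fam c) = 0.
Proof. by apply: fam_ext => q A d; rewrite /kill if_same. Qed.
Lemma killZ l c z (a : fam c) : kill l (z *: a) = z *: kill l a.
Proof. by have := kill_linear l z a 0; rewrite kill0 !addr0. Qed.
Lemma kill_sum l c T (r : seq T) (Q : pred T) (F : T -> fam c) :
  kill l (\sum_(i <- r | Q i) F i) = \sum_(i <- r | Q i) kill l (F i).
Proof. by elim/big_rec2: _ => [|i x y _ <-]; rewrite ?kill0 ?killD. Qed.

Lemma kill_lacks l c (a : fam c) : lacks l a -> kill l a = a.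
Proof.
move=> fa; apply: fam_ext => q A d; rewrite /kill; case: hasP => // -[x xA /eqP qx].
by rewrite (fa q A d x).
Qed.

Lemma lacks_kill l c (a : fam c) : lacks l (kill l a).
Proof.
by move=> q A d x xA qx; rewrite /kill; case: hasP => // -[]; exists x => //; rewrite qx.
Qed.

Lemma lacks_kill_other l k c (a : fam c) : lacks k a -> lacks k (kill l a).
Proof. by move=> fa q A d x xA qx; rewrite /kill (fa _ _ _ x)// if_same. Qed.

Lemma kill_reg l c e (a : fam c) : regular e a -> regular e (kill l a).
Proof.
move=> ra; split=> [q A d nd|f q q' A D d rf h]; rewrite /kill.
  by rewrite (reg_hom ra)// if_same.
have -> : has (fun x => q' x == l) D = has (fun x => q x == l) A.
  have [_ ->] := rf; apply/hasP/hasP => -[x].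
    by move=> /imfsetP[/= y yA ->]; rewrite h// => qy; exists y.
  by move=> xA qx; exists (rename f x); [apply: in_imfset|rewrite h].
by case: ifP; rewrite ?orel0 ?scaler0// (reg_rel ra d rf h).
Qed.

(** Derivations in other directions are tangent to that locus. *)
Lemma kill_star l k e e' c (a : fam c) (v : fam (kcol k)) : l <> k ->
  kill l (star k e e' a v) = star k e e' (kill l a) (kill l v).
Proof.
move=> lk; apply: fam_ext => q A d; rewrite {1}/kill.
case: hasP => [[x xA /eqP qx]|nA].
  by rewrite (@avoid_star _ _ (fun _ k' => k' = l) k e e' c (kill l a) (kill l v) _ _ q A d x)//; apply: lacks_kill.
have sA := freshP (kcol k) (leqnn (fresh A)).
rewrite /star /star_sum; apply: eq_big_seq => J; rewrite fpowersetE => JA.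
congr (_ *: ocomp _ _ _ _); rewrite /kill; case: hasP => // -[x].
  rewrite !inE => /orP[/eqP->|/andP[xJ xA]]; first by rewrite updE => /eqP/esym.
  by rewrite (upd_out q k sA xA) => qx; case: nA; exists x.
by move=> /(fsubsetP JA) xA; rewrite (upd_out q k sA xA) => qx; case: nA; exists x.
Qed.
End Kill.

(** Only x and y have weight. The slots z and u have none, so that weights add up
under insertion into them. *)
Definition wk k : nat := match k with KX | KY => 1 | _ => 0 end.
Definition wt (q : deco) (A : {fset label}) : nat := \sum_(x <- A) wk (q x).

Lemma wtU q (A B : {fset label}) : [disjoint A & B]%fset -> wt q (A `|` B) = (wt q A + wt q B)%N.
Proof. exact: sumnU_disj. Qed.
Lemma wt_ext q q' (A : {fset label}) : {in A, q =1 q'} -> wt q A = wt q' A.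
Proof. by move=> h; apply: eq_big_seq => x /h ->. Qed.
Lemma wt1 q x : wt q [fset x] = wk (q x).
Proof. by rewrite /wt big_seq_fset1. Qed.
Lemma wt_rel f q q' (A D : {fset label}) : relabels f A D ->
  {in A, forall x, q' (rename f x) = q x} -> wt q' D = wt q A.
Proof.
move=> [fi ->] h; rewrite /wt sumn_imfset//.
by apply: eq_big_seq => x /h ->.
Qed.

Lemma wt_split q k (A J : {fset label}) : J `<=` A ->
  let s := (kcol k, fresh A) in let q' := upd q s k in
  (wt q' (s |` (A `\` J)) = wk k + wt q (A `\` J))%N /\ wt q' J = wt q J
  /\ (wt q A = wt q (A `\` J) + wt q J)%N.
Proof.
move=> JA s q'; have sA : s \notin A by apply: freshP.
have sI : s \notin A `\` J by apply: fsubset_notin sA; apply: fsubsetDl.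
split; last split.
- rewrite wtU ?fdisjoint1X// wt1 /q' updE; congr addn.
  by apply: wt_ext; apply: upd_out.
- by apply: wt_ext => x xJ; apply: (upd_out q k sA); apply: (fsubsetP JA).
- by rewrite -{1}(fsetD_subU JA) wtU// fdisjointDl.
Qed.

Section Flow.
Variables (K : fieldType) (P : operad K).
Local Notation fam := (fam P).
Implicit Types (q : deco) (A J I : {fset label}) (d e : int) (k l : kind) (n : nat).

(** Without term in z alone: such a vector field raises the weight, so that each
coefficient of its exponential is a finite sum. *)
Definition heavy c (V : fam c) := forall q A d, wt q A = 0%N -> V q A d = 0.

(** The n-th power of the derivation V d/dz. *)
Definition flow (V : fam Wavy) e n c (a : fam c) : fam c :=
  iter n (fun b => star KZ e 1 b V) a.

Lemma flowS V e n c (a : fam c) : flow V e n.+1 a = star KZ e 1 (flow V e n a) V.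
Proof. by []. Qed.

Lemma flowSr V e n c (a : fam c) : flow V e n.+1 a = flow V e n (star KZ e 1 a V).
Proof. by rewrite /flow iterSr. Qed.

Lemma flow_linear V e n c : linear (fun a : fam c => flow V e n a).
Proof.
move=> z a b /=; elim: n => //= n IH; rewrite IH starDl starZl //.
Qed.
Lemma flowD V e n c (a b : fam c) : flow V e n (a + b) = flow V e n a + flow V e n b.
Proof. by have := flow_linear V e n 1 a b; rewrite !scale1r. Qed.
Lemma flow0 V e n c : flow V e n (0 : fam c) = 0.
Proof. by elim: n => //= n ->; rewrite star0l. Qed.
Lemma flowZ V e n c z (a : fam c) : flow V e n (z *: a) = z *: flow V e n a.
Proof. by have := flow_linear V e n z a 0; rewrite flow0 !addr0. Qed.

Lemma flow_reg V e n c (a : fam c) : regular 1 V -> regular e a -> regular e (flow V e n a).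
Proof.
move=> rV ra; elim: n => //= n IH.
by have := @star_regular _ P KZ _ _ _ _ V IH rV; rewrite addrK.
Qed.

Lemma flow_lacks V e n c (a : fam c) l : lacks l V -> lacks l a -> lacks l (flow V e n a).
Proof. by move=> fV fa; elim: n => //= n IH; apply: avoid_star. Qed.

Lemma star_eq k e e' c (a a' : fam c) (v v' : fam (kcol k)) q A d :
  (forall J, J `<=` A -> let s := (kcol k, fresh A) in let q' := upd q s k in
   forall d1 d2, ocomp (kcol k) (fresh A) (a q' (s |` (A `\` J)) d1) (v q' J d2) =
     ocomp (kcol k) (fresh A) (a' q' (s |` (A `\` J)) d1) (v' q' J d2) :> P A c d) ->
  star k e e' a v q A d = star k e e' a' v' q A d.
Proof.
move=> h; rewrite /star /star_sum; apply: eq_big_seq => J; rewrite fpowersetE => JA.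
by rewrite h.
Qed.

Lemma star_wt0 k e e' c (a : fam c) (v : fam (kcol k)) q A d i j :
  (forall q A d, (wt q A < i)%N -> a q A d = 0) -> (forall q A d, (wt q A < j)%N -> v q A d = 0) ->
  (wt q A < i + j)%N -> wk k = 0%N -> star k e e' a v q A d = 0.
Proof.
move=> ha hv hA k0; transitivity (star k e e' (0 : fam c) v q A d); last by rewrite star0l.
apply: star_eq.
move=> J JA s q' d1 d2; rewrite ocomp0l; have [w1 [w2 w3]] := wt_split q k JA.
have [hJ|hJ] := ltnP (wt q J) j; first by rewrite hv ?ocomp0r// w2.
by rewrite ha ?ocomp0l// w1 k0; lia.
Qed.

Lemma flow_wt V e n c (a : fam c) q A d : heavy V -> (wt q A < n)%N -> flow V e n a q A d = 0.
Proof.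
move=> hV; elim: n q A d => // n IH q A d hn /=.
apply: (@star_wt0 KZ _ _ _ _ _ _ _ _ n 1) => //; last by rewrite addn1.
by move=> q0 A0 d0; rewrite ltnS leqn0 => /eqP; apply: hV.
Qed.

(** The exponential of V d/dz. For a heavy V all powers beyond the weight of a
coefficient vanish on it. *)
Definition expf V e c (a : fam c) : fam c := fun q A d =>
  \sum_(n < (wt q A).+1) (n`!%:R)^-1 *: flow V e n a q A d.

Definition expn V e N c (a : fam c) : fam c := \sum_(n < N) (n`!%:R)^-1 *: flow V e n a.

Lemma expfE V e c (a : fam c) N q A d : heavy V -> (wt q A < N)%N ->
  expf V e a q A d = expn V e N a q A d.
Proof.
move=> hV hN; rewrite /expf /expn famE.
rewrite (big_ord_widen N (fun n => (n`!%:R)^-1 *: flow V e n a q A d) hN).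
rewrite big_mkcond; apply: eq_bigr => n _; rewrite famE; case: ltnP => // hn.
by rewrite flow_wt ?scaler0.
Qed.

Section Leibniz.
Hypothesis charK0 : [pchar K] =i pred0.
Variable V : fam Wavy.
Hypotheses (rV : regular 1 V) (fV : lacks KU V) (hV : heavy V).

(** V d/dz is a derivation for the substitution into u, because V is independent
of u. *)
Lemma flow_leibniz e e' c (b : fam c) (v : fam Wavy) : regular e b -> regular e' v ->
  star KZ (e + e' - 1) 1 (star KU e e' b v) V =
  star KU e e' (star KZ e 1 b V) v + star KU e e' b (star KZ e' 1 v V).
Proof.
move=> rb rv; have := @star_comm _ P KU KZ e e' 1 c b v V rb rv rV.
rewrite -[(parity_of KU)%:Z]/(1 : int) !addrK subrr muln0 expr0 scale1r.
by move=> ->; rewrite (star_lacks0 _ _ _ fV) star0r subr0 [RHS]addrC.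
Qed.

Lemma flow_star n e e' c (b : fam c) (v : fam Wavy) : regular e b -> regular e' v ->
  flow V (e + e' - 1) n (star KU e e' b v) =
  \sum_(i < n.+1) 'C(n, i)%:R *: star KU e e' (flow V e i b) (flow V e' (n - i) v).
Proof.
move=> rb rv; pose X i j := star KU e e' (flow V e i b) (flow V e' j v).
have XS i j : star KZ (e + e' - 1) 1 (X i j) V = X i.+1 j + X i j.+1.
  by rewrite /X flow_leibniz//; apply: flow_reg.
elim: n => [|n IH]; first by rewrite big_ord1 bin0 scale1r.
rewrite flowS IH star_suml.
transitivity (\sum_(i < n.+1) 'C(n, i)%:R *: X i.+1 (n - i)%N +
              \sum_(i < n.+1) 'C(n, i)%:R *: X i (n - i).+1).
  by rewrite -big_split; apply: eq_bigr => i _; rewrite starZl -/(X _ _) XS scalerDr.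
rewrite [RHS]big_ord_recl -/(X _ _) bin0 scale1r subn0 /=.
under [in RHS]eq_bigr => i _ do rewrite /bump/= add1n binS natrD scalerDl -/(X _ _) subSS.
rewrite big_split/= addrA addrC; congr (_ + _).
rewrite big_ord_recl [in RHS]big_ord_recr/= bin0 scale1r subn0 bin_small// scale0r addr0.
by congr (_ + _); apply: eq_bigr => i _; rewrite /bump/= add1n -subSn.
Qed.

Lemma fact_neq0 n : n`!%:R != 0 :> K.
Proof. by rewrite ((pcharf0P K).1 charK0) -lt0n fact_gt0. Qed.

(** The exponential of a derivation is multiplicative; here the product is
the substitution of v into u. The division by factorials uses characteristic 0. *)
Lemma expf_star e e' c (b : fam c) (v : fam Wavy) : regular e b -> regular e' v ->
  expf V (e + e' - 1) (star KU e e' b v) = star KU e e' (expf V e b) (expf V e' v).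
Proof.
move=> rb rv; apply: fam_ext => q A d; set N := (wt q A).+1.
have -> : star KU e e' (expf V e b) (expf V e' v) q A d =
          star KU e e' (expn V e N b) (expn V e' N v) q A d.
  apply: star_eq => J JA s q' d1 d2; have [w1 [w2 w3]] := wt_split q KU JA.
  by rewrite !(@expfE _ _ _ _ N)// /N ltnS w3 ?w1 ?w2 /= ?leq_addr ?leq_addl.
rewrite (@expfE _ _ _ _ N)// /expn star_suml !famE.
pose F i j := (i`!%:R * j`!%:R)^-1 *: star KU e e' (flow V e i b) (flow V e' j v) q A d.
transitivity (\sum_(n < N) \sum_(i < N | (i <= n)%N) F i (n - i)%N).
  apply: eq_bigr => n _; rewrite famE flow_star// famE scaler_sumr.
  rewrite (big_ord_widen N
    (fun i => (n`!%:R)^-1 *: ('C(n, i)%:R *: star KU e e' (flow V e i b) (flow V e' (n - i) v)) q A d))//.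
  apply: eq_big => [i|i]; first by rewrite ltnS.
  rewrite ltnS => /= hi; rewrite /F famE scalerA; congr (_ *: _).
  rewrite -(bin_fact hi) natrM natrM invfM mulrC mulrA divff ?mul1r//.
  by apply: contra (fact_neq0 n) => /eqP h0; rewrite -(bin_fact hi) natrM h0 mul0r.
transitivity (\sum_(i < N) \sum_(j < N) F i j); last first.
  apply: eq_bigr => i _; rewrite starZl famE star_sumr !famE scaler_sumr.
  by apply: eq_bigr => j _; rewrite starZr famE scalerA /F invfM.
rewrite (exchange_big_dep xpredT)//=; apply: eq_bigr => i _.
(* the terms with i + j above the weight vanish: a triangle of indices suffices *)
have F0 j : (wt q A < i + j)%N -> F i j = 0.
  move=> hij; rewrite /F (@star_wt0 KU _ _ _ _ _ _ _ _ i j) ?scaler0//;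
  by move=> *; apply: flow_wt.
transitivity (\sum_(j < N | (i + j < N)%N) F i j); last first.
  rewrite big_mkcond; apply: eq_bigr => j _; case: ltnP => // hij.
  by rewrite F0.
rewrite -(big_geq_mkord i N (fun=> true) (fun n => F i (n - i)%N)).
rewrite -{1}[nat_of_ord i]add0n big_addn big_mkord.
under eq_bigr do rewrite addnK.
rewrite (big_ord_widen N (fun j => F i j)) ?leq_subr//.
by apply: eq_bigl => j /=; rewrite ltn_subRL.
Qed.

End Leibniz.
End Flow.

(** * The vector field generating phi, and its component f *)

Section WSum.
Variables (K : fieldType) (P : operad K) (c : colour).
(** For families F n that vanish in weight less than n, the sum of all of them. *)
Definition wsum (Q : pred nat) (F : nat -> fam P c) : fam P c := fun q A d =>
  \sum_(n < (wt q A).+1 | Q n) F n q A d.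
Lemma wsum_reg e (Q : pred nat) (F : nat -> fam P c) :
  (forall n, regular e (F n)) -> regular e (wsum Q F).
Proof.
move=> rF; split=> [q A d nd|f q q' A D d rf h]; rewrite /wsum.
  by rewrite big1// => n _; rewrite (reg_hom (rF n)).
rewrite (wt_rel rf h) orel_sum scaler_sumr; apply: eq_bigr => n _.
exact: (reg_rel (rF n)).
Qed.
Lemma wsum_lacks k (Q : pred nat) (F : nat -> fam P c) :
  (forall n, lacks k (F n)) -> lacks k (wsum Q F).
Proof. by move=> fF q A d x xA qx; rewrite /wsum big1// => n _; rewrite (fF n _ _ _ x). Qed.
End WSum.

Section UnitExtra.
Variables (K : fieldType) (P : operad K).
Lemma unitf_heavy cc k : wk k = 1%N -> heavy (unitf P cc k).
Proof.
move=> k1 q A d hA; have [[z eA]|nA] := fset1_exP cc A; last exact: unitf_out.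
rewrite eA unitf1; case: eqP => // qz.
by move: hA; rewrite eA wt1 qz k1.
Qed.

(** A derivation kills the unit, which is idempotent. *)
Lemma dmap_unit (D : differential P) c z : dmap D (ounit P c z) = 0.
Proof.
have h : dmap D (ocomp c z (ounit P c z) (ounit P c z) : P [fset (c, z)] c 0) =
    dmap D (ounit P c z).
  by rewrite ocomp_unitl.
have e1 : ocomp c z (dmap D (ounit P c z)) (ounit P c z) = dmap D (ounit P c z).
  by apply: ocomp_unitr; rewrite inE.
have e2 : ocomp c z (ounit P c z) (dmap D (ounit P c z)) = dmap D (ounit P c z).
  exact: ocomp_unitl.
move: h; rewrite dmap_comp e1 e2 /koszul mulr0 expr0 scale1r => h.
by apply: (@addrI _ (dmap D (ounit P c z))); rewrite h addr0.
Qed.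

Lemma fdiff_unitf (D : differential P) cc k : fdiff D (unitf P cc k) = 0.
Proof.
apply: fam_ext => q A d; have [d1 ->] := deg_pred d; rewrite fdiffE famE.
have [[z ->]|nA] := fset1_exP cc A; last by rewrite unitf_out ?dmap0.
rewrite unitf1; case: eqP => _; last by rewrite dmap0.
have [->|nd] := eqVneq d1 0; last by rewrite dcast_neq// dmap0.
by rewrite dcast_id dmap_unit.
Qed.
End UnitExtra.

(** The properties of the coefficients phi and lambda on which the construction
of f rests: phi is a function of x without constant term, and lambda a function
of z without terms of order less than 2. *)
Record input (K : fieldType) (P : operad K) (phi lam : fam P Wavy) : Prop := Input {
  in_rphi : regular 1 phi;
  in_rlam : regular 2 lam;
  in_phi_lacks : forall k, k <> KX -> lacks k phi;
  in_lam_lacks : forall k, k <> KZ -> lacks k lam;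
  in_phi0 : forall q A d, (forall x, x \in A -> q x <> KX) -> phi q A d = 0;
  in_lam1 : forall q A d, (#|` A| < 2)%N -> lam q A d = 0
}.

Section Solve.
Variables (K : fieldType) (P : operad K).
Local Notation fam := (fam P).
Implicit Types (q : deco) (A J I : {fset label}) (d e : int) (k l : kind) (n : nat).
Variables (phi lam : fam Wavy).
Hypothesis H : input phi lam.
Let rphi := in_rphi H.
Let rlam := in_rlam H.
Let phi0 := in_phi0 H.
Let lam1 := in_lam1 H.
Let phiY : lacks KY phi. Proof. by apply: (in_phi_lacks H). Qed.
Let phiZ : lacks KZ phi. Proof. by apply: (in_phi_lacks H). Qed.
Let phiU : lacks KU phi. Proof. by apply: (in_phi_lacks H). Qed.
Let lamX : lacks KX lam. Proof. by apply: (in_lam_lacks H). Qed.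
Let lamY : lacks KY lam. Proof. by apply: (in_lam_lacks H). Qed.
Let lamU : lacks KU lam. Proof. by apply: (in_lam_lacks H). Qed.

Local Notation ups := (unitf P Wavy KY).
Local Notation zeta := (unitf P Wavy KZ).

(** The part of V that is linear in y: lambda with one z replaced by y. *)
Definition adj : fam Wavy := star KZ 2 0 lam (ups : fam (kcol KZ)).

(** The terms of order at least 2 in the exponential (2); the term of order 1 is
f itself since the restriction of adj to z = 0 vanishes. *)
Definition rest (f : fam Wavy) : fam Wavy :=
  wsum (leq 2) (fun n => (n`!%:R)^-1 *: kill KZ (flow (adj + f) 1 n zeta)).

Definition step (f : fam Wavy) : fam Wavy := phi - rest f.

Definition approx n : fam Wavy := iter n step 0.

(** The coefficients of weight w stabilise after w + 1 iterations of [step]. *)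
Definition solution : fam Wavy := fun q A d => approx (wt q A).+1 q A d.

Lemma adj_reg : regular 1 adj.
Proof. by have := @star_regular _ P KZ 2 0 _ _ (ups : fam (kcol KZ)) rlam (unitf_reg P Wavy KY). Qed.

Lemma adj_heavy : heavy adj.
Proof.
move=> q A d hA; apply: (@star_wt0 _ _ KZ _ _ _ _ _ _ _ _ 0 1) => //; last by rewrite hA.
by move=> q0 A0 d0; rewrite ltnS leqn0 => /eqP; apply: unitf_heavy.
Qed.

Lemma zeta_reg : regular 1 zeta. Proof. exact: (unitf_reg P Wavy KZ). Qed.

Lemma adj_lacksX : lacks KX adj. Proof. by apply: avoid_star => //; apply: unitf_lacks. Qed.
Lemma adj_lacksU : lacks KU adj. Proof. by apply: avoid_star => //; apply: unitf_lacks. Qed.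
Lemma zeta_lacksU : lacks KU zeta. Proof. exact: unitf_lacks. Qed.

Lemma phi_heavy : heavy phi.
Proof.
move=> q A d hA; apply: phi0 => x xA qx; move/eqP: hA; rewrite /wt sum_nat_seq_eq0.
by move=> /allP /(_ _ xA); rewrite qx.
Qed.

Lemma rest_heavy f : heavy (rest f).
Proof. by move=> q A d hA; rewrite /rest /wsum hA big1// => -[[|n] hn]. Qed.

Lemma step_heavy f : heavy (step f).
Proof. by move=> q A d hA; rewrite /step !famE phi_heavy// rest_heavy// subrr. Qed.

Lemma approx_heavy n : heavy (approx n).
Proof. by case: n => [|n] //; apply: step_heavy. Qed.

Lemma solution_heavy : heavy solution.
Proof. by move=> q A d hA; apply: approx_heavy. Qed.

Lemma heavyD (f g : fam Wavy) : heavy f -> heavy g -> heavy (f + g).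
Proof. by move=> hf hg q A d hA; rewrite famE hf// hg// addr0. Qed.

Definition agree n (f g : fam Wavy) := forall q A d, (wt q A < n)%N -> f q A d = g q A d.

Lemma flow1 (V : fam Wavy) : regular 1 V -> flow V 1 1 zeta = V.
Proof. exact: (@star_unitl _ P KZ 1 V). Qed.

(** One more application of V d/dz gains one more weight on which the two sides
agree: the inserted V has positive weight, and so does what it is inserted into. *)
Lemma flow_agree n m (V V' : fam Wavy) : regular 1 V -> regular 1 V' -> heavy V -> heavy V' ->
  agree n V V' -> (0 < m)%N ->
  agree n (flow V 1 m zeta) (flow V' 1 m zeta) /\
  agree n.+1 (flow V 1 m.+1 zeta) (flow V' 1 m.+1 zeta).
Proof.
move=> rV rV' hV hV' aV; case: m => // m _.
have aS i : agree n (flow V 1 i.+1 zeta) (flow V' 1 i.+1 zeta) ->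
    agree n.+1 (flow V 1 i.+2 zeta) (flow V' 1 i.+2 zeta).
  move=> ai q A d hA; rewrite flowS [in RHS]flowS; apply: star_eq => J JA s q' d1 d2.
  have [w1 [w2 w3]] := wt_split q KZ JA.
  have [hJ|hJ] := posnP (wt q J).
    by rewrite hV ?hV' ?w2// !ocomp0r.
  have [hI|hI] := posnP (wt q (A `\` J)).
    by rewrite !flow_wt ?ocomp0l// w1 hI.
  rewrite aV ?ai ?w2 ?w1//; move: hA; rewrite w3 ltnS => hA; apply: (leq_trans _ hA).
    by rewrite -[X in (X < _)%N]addn0 ltn_add2l.
  by rewrite -[X in (X < _)%N]add0n ltn_add2r.
have a1 i : agree n (flow V 1 i.+1 zeta) (flow V' 1 i.+1 zeta).
  elim: i => [|i IH]; first by rewrite !flow1.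
  by move=> q A d hA; apply: aS => //; apply: ltnW.
by split; [exact: a1|apply/aS/a1].
Qed.

Lemma step_agree n f g : regular 1 f -> regular 1 g -> heavy f -> heavy g ->
  agree n f g -> agree n.+1 (step f) (step g).
Proof.
move=> rf rg hf hg afg q A d hA; rewrite /step !famE; congr (_ - _).
rewrite /rest /wsum; apply: eq_bigr => -[[|[|m]] hm] //= _; rewrite !famE; congr (_ *: _).
rewrite /kill; case: ifP => // _.
have [] := @flow_agree n m.+1 (adj + f) (adj + g); rewrite //.
- exact: regularD adj_reg rf.
- exact: regularD adj_reg rg.
- exact: heavyD adj_heavy hf.
- exact: heavyD adj_heavy hg.
- by move=> q0 A0 d0 h0; rewrite !famE afg.
by move=> _; apply.
Qed.

Lemma step_reg f : regular 1 f -> regular 1 (step f).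
Proof.
move=> rf; apply: regularB => //; apply: wsum_reg => n; apply: regularZ; apply: kill_reg.
by apply: flow_reg zeta_reg; apply: regularD adj_reg rf.
Qed.

Lemma approx_reg n : regular 1 (approx n).
Proof. by elim: n => [|n IH]; [apply: regular0|apply: step_reg]. Qed.

Lemma approx_agree n : agree n (approx n) (approx n.+1).
Proof.
elim: n => [//|n IH]; apply: step_agree IH; rewrite -/(approx _) -?/(approx _.+1);
  (exact: approx_reg || exact: approx_heavy).
Qed.

Lemma approx_agree_le n m : (n <= m)%N -> agree n (approx n) (approx m).
Proof.
move=> /subnKC <-; elim: (m - n)%N => [|i IH] q A d hA; first by rewrite addn0.
by rewrite IH// addnS; apply: approx_agree; apply: leq_trans hA (leq_addr _ _).
Qed.

Lemma solution_agree n : agree n solution (approx n).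
Proof.
by move=> q A d hA; apply: approx_agree_le.
Qed.

Lemma solution_reg : regular 1 solution.
Proof.
split=> [q A d nd|f q q' A D d rf h]; rewrite /solution.
  by rewrite (reg_hom (approx_reg _)).
by rewrite (reg_rel (approx_reg _) d rf h) (wt_rel rf h).
Qed.

Lemma solutionE : step solution = solution.
Proof.
apply: fam_ext => q A d; rewrite [RHS](@solution_agree (wt q A).+1)//=.
by apply: (@step_agree (wt q A)) (@solution_agree _) _ _ _ _ => //;
  (exact: solution_reg || exact: approx_reg || exact: solution_heavy || exact: approx_heavy).
Qed.

Lemma solution_lacksZ : lacks KZ solution.
Proof.
rewrite -solutionE; apply: avoidD => //; rewrite -scaleN1r; apply: avoidZ.
by apply: wsum_lacks => n; apply: avoidZ; apply: lacks_kill.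
Qed.

Lemma approx_lacksU n : lacks KU (approx n).
Proof.
elim: n => [//|n IH]; apply: avoidD => //; rewrite -scaleN1r; apply: avoidZ.
apply: wsum_lacks => m; apply: avoidZ; apply: lacks_kill_other; apply: flow_lacks zeta_lacksU.
exact: avoidD adj_lacksU IH.
Qed.

Lemma solution_lacksU : lacks KU solution.
Proof. by move=> q A d x xA qx; apply: approx_lacksU qx. Qed.

Definition needXZ (a : fam Wavy) := forall q A d,
  (forall x, x \in A -> q x <> KX /\ q x <> KZ) -> a q A d = 0.

Lemma needXZ_star c e e' (a : fam c) (v : fam Wavy) q A d : needXZ v ->
  (forall x, x \in A -> q x <> KX /\ q x <> KZ) -> star KZ e e' a (v : fam (kcol KZ)) q A d = 0.
Proof.
move=> hv hA; transitivity (star KZ e e' (0 : fam c) (v : fam (kcol KZ)) q A d); last by rewrite star0l.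
apply: star_eq => J JA s q' d1 d2; rewrite hv ?ocomp0l ?ocomp0r// => x xJ.
have sA := freshP (kcol KZ) (leqnn (fresh A)).
by have xA := fsubsetP JA _ xJ; rewrite /q' /s (upd_out q KZ sA xA); apply: hA.
Qed.

Lemma lam_only q A d : (exists2 x, x \in A & q x <> KZ) -> lam q A d = 0.
Proof.
by move=> [x xA]; case e: (q x) => // _; [apply: lamX e|apply: lamY e|apply: lamU e].
Qed.

Lemma adj_noZ q A d : (forall x, x \in A -> q x <> KZ) -> adj q A d = 0.
Proof.
move=> hA; transitivity (star KZ 2 0 (0 : fam Wavy) (ups : fam (kcol KZ)) q A d); last by rewrite star0l.
apply: star_eq => J JA s q' d1 d2; rewrite !ocomp0l.
have sA := freshP (kcol KZ) (leqnn (fresh A)).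
have [e0|[x xI]] := fset_0Vmem (A `\` J).
  by rewrite lam1 ?ocomp0l// e0 fsetU0 cardfs1.
rewrite lam_only ?ocomp0l//; exists x; first by rewrite inE xI orbT.
by move: xI; rewrite inE => /andP[_ xA]; rewrite /q' /s (upd_out q KZ sA xA); apply: hA.
Qed.

Lemma adj_needXZ : needXZ adj.
Proof. by move=> q A d hA; apply: adj_noZ => x /hA[]. Qed.

(** Without x nothing moves the point z = 0, because adj vanishes there. *)
Lemma approx_noX n q A d : (forall x, x \in A -> q x <> KX) -> approx n q A d = 0.
Proof.
elim: n q A d => [//|n IH] q A d hA; rewrite /= /step !famE phi0// sub0r; apply/eqP.
rewrite oppr_eq0 /rest /wsum big1// => -[[|[|m]] hm] //= _; rewrite famE /kill.
case: hasP => [|hZ]; first by rewrite scaler0.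
rewrite needXZ_star ?scaler0//; last first.
  by move=> x xA; split; [apply: hA|move=> qx; apply: hZ; exists x; rewrite ?qx].
move=> q0 A0 d0 h0; rewrite famE adj_needXZ// add0r; apply: IH => x /h0[] //.
Qed.

Lemma solution_noX q A d : (forall x, x \in A -> q x <> KX) -> solution q A d = 0.
Proof. exact: approx_noX. Qed.

Definition field : fam Wavy := adj + solution.

Lemma field_reg : regular 1 field. Proof. exact: regularD adj_reg solution_reg. Qed.
Lemma field_heavy : heavy field. Proof. exact: heavyD adj_heavy solution_heavy. Qed.
Lemma field_lacksU : lacks KU field. Proof. exact: avoidD adj_lacksU solution_lacksU. Qed.

Lemma kill_zeta : kill KZ zeta = 0.
Proof.
apply: fam_ext => q A d; rewrite /kill famE; case: hasP => // hZ.
have [[z eA]|nA] := fset1_exP Wavy A; last exact: unitf_out.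
rewrite eA unitf1; case: eqP => // qz; case: hZ; exists (Wavy, z); rewrite ?eA ?inE//.
by rewrite qz.
Qed.

Lemma kill_adj : kill KZ adj = 0.
Proof.
apply: fam_ext => q A d; rewrite /kill famE; case: hasP => // hZ.
by apply: adj_noZ => x xA qx; apply: hZ; exists x; rewrite ?qx.
Qed.

(** The defining property of f: the flow of V at time one carries z = 0 to phi. *)
Lemma expf_zeta : kill KZ (expf field 1 zeta) = phi.
Proof.
apply: fam_ext => q A d.
have -> : kill KZ (expf field 1 zeta) q A d =
    \sum_(n < (wt q A).+1) (n`!%:R)^-1 *: kill KZ (flow field 1 n zeta) q A d.
  rewrite /kill /expf; case: ifP => // _.
  by rewrite big1// => n _; rewrite scaler0.
case e: (wt q A) => [|w].
  by rewrite big_ord1 /= kill_zeta famE scaler0 phi_heavy.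
have hs : solution q A d = step solution q A d by rewrite solutionE.
move: hs; rewrite /step /rest !famE /wsum e big_mkcond !big_ord_recl /= !add0r.
have f1 : star KZ 1 1 (zeta : fam Wavy) (field : fam (kcol KZ)) = field := flow1 field_reg.
rewrite kill_zeta famE scaler0 add0r f1 -/field {2}/field killD kill_adj add0r.
rewrite (kill_lacks solution_lacksZ) -[(bump 0 0)`!]/1%N invr1 scale1r => ->.
rewrite -[RHS]addr0 -addrA; congr (_ + _); apply/eqP; rewrite addrC subr_eq0; apply/eqP.
by apply: eq_bigr => n _; rewrite famE.
Qed.
Definition small M c (a : fam c) := forall q A d, (#|` A| <= M)%N -> a q A d = 0.

Lemma field_nil q A d : A = fset0 -> field q A d = 0.
Proof. by move=> ->; apply: field_heavy; rewrite /wt big_seq_fset0. Qed.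

Lemma card_slot A J s : s \notin A -> J `<=` A -> J <> fset0 ->
  (#|` s |` (A `\` J)| <= #|` A|)%N.
Proof.
move=> sA JA nJ; rewrite cardfsU1 (fsubset_notin (fsubsetDl A J) sA) /=.
rewrite (cardfsDS JA) add1n -subSn ?fsubset_leq_card// leq_subLR -add1n leq_add2r.
by rewrite cardfs_gt0; apply/eqP.
Qed.

(** V has no constant term, so that V d/dz never lowers the number of inputs on
which a family starts. *)
Lemma flow_small M e n c (a : fam c) : small M a -> small M (flow field e n a).
Proof.
move=> sa; elim: n => //= n IH q A d hA.
transitivity (star KZ e 1 (0 : fam c) (field : fam (kcol KZ)) q A d); last by rewrite star0l.
apply: star_eq => J JA s q' d1 d2; rewrite ocomp0l.
have [->|nJ] := eqVneq J fset0; first by rewrite field_nil ?ocomp0r.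
rewrite IH ?ocomp0l//; apply: leq_trans hA; apply: card_slot => //.
  exact: freshP.
exact/eqP.
Qed.

End Solve.

(** * The quadratic differential equation of f *)

Lemma cancel_adjoint_terms (G : zmodType) (x a s t : G) : - x + a - (s + (t - x)) + t = a - s.
Proof.
by rewrite opprD opprB [LHS](AC (2*(1*2)*1) ((2*3)*((4*1)*(5*6)))) /= subrr addNr !addr0.
Qed.

Lemma regroup_derivation_terms (G : zmodType) (x1 x2 x3 y1 y2 y3 y0 w : G) :
  - y1 + (x1 + y2 + (x2 + y3) + (x3 - y0 + w)) =
  x1 + x2 + x3 - (y1 - (y2 + y3 + w) + y0).
Proof.
by rewrite opprD opprB [LHS](AC (1*((2*2)*3)) ((2*4*6)*(((3*5*8)*1)*7))).
Qed.

Section KillDiff.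
Variables (K : fieldType) (P : operad K) (D : differential P).
Lemma kill_fdiff l c (a : fam P c) : kill l (fdiff D a) = fdiff D (kill l a).
Proof.
apply: fam_ext => q A d; have [d1 ->] := deg_pred d; rewrite /kill !fdiffE.
by case: ifP; rewrite ?dmap0.
Qed.
End KillDiff.

(** The L-infinity relations for ell and lambda, and the equation of an
L-infinity morphism for phi, whose sum of all lambda (phi, ..., phi) is written
as the restriction of exp (V d/dz) lambda to z = 0. *)
Record dg_input (K : fieldType) (P : operad K) (D : differential P)
   (phi lam : fam P Wavy) (ell : fam P Straight) : Prop := DgInput {
  dg_in : input phi lam;
  dg_rell : regular 2 ell;
  dg_ell_lacks : forall k, k <> KX -> lacks k ell;
  dg_ell : fdiff D ell = - star KX 2 2 ell (ell : fam P (kcol KX));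
  dg_lam : fdiff D lam = - star KZ 2 2 lam (lam : fam P (kcol KZ));
  dg_phi : fdiff D phi = star KX 1 2 phi (ell : fam P (kcol KX))
             - kill KZ (expf (field phi lam) 2 lam)
}.

Section Main.
Variables (K : fieldType) (P : operad K) (D : differential P).
Local Notation fam := (fam P).
Implicit Types (q : deco) (A J I : {fset label}) (d e : int) (k l : kind) (n : nat).
Variables (phi lam : fam Wavy) (ell : fam Straight).
Hypothesis H : dg_input D phi lam ell.
Hypothesis charK0 : [pchar K] =i pred0.
Let H0 := dg_in H.
Local Notation ups := (unitf P Wavy KY).
Local Notation zeta := (unitf P Wavy KZ).
Local Notation f := (solution phi lam).
Local Notation V := (field phi lam).
Let rf := solution_reg H0.
Let rV := field_reg H0.
Let rlam := in_rlam H0.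
Let rell := dg_rell H.
Let fZ := solution_lacksZ H0.
Let fU := solution_lacksU H0.

(** The derivation Q with components ell, f and lambda, up to sign, added to
the differential, on families of total degree e. *)
Definition hvf e c (a : fam c) : fam c := fdiff D a + (-1) ^+ absz e *:
  (star KX e 2 a (ell : fam (kcol KX)) + star KY e 1 a (f : fam (kcol KY))
   + star KZ e 2 a (lam : fam (kcol KZ))).

(** The failure of f to satisfy its differential equation. *)
Definition defect : fam Wavy := fdiff D f -
  (star KX 1 2 f (ell : fam (kcol KX)) + star KY 1 1 f (f : fam (kcol KY))).

Lemma hvf_linear e c : linear (@hvf e c).
Proof.
move=> z a b; rewrite /hvf fdiffD fdiffZ !starDl !starZl.
set x1 := star KX _ _ a _; set x2 := star KX _ _ b _; set y1 := star KY _ _ a _.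
set y2 := star KY _ _ b _; set z1 := star KZ _ _ a _; set z2 := star KZ _ _ b _.
have -> : z *: x1 + x2 + (z *: y1 + y2) + (z *: z1 + z2) = z *: (x1 + y1 + z1) + (x2 + y2 + z2).
  by rewrite !scalerDr [LHS](AC (2*2*2) ((1*3*5)*(2*4*6))).
by rewrite !scalerDr !scalerA [_ * z]mulrC addrACA.
Qed.

Lemma defect_lacksZ : lacks KZ defect.
Proof.
apply: avoidD; first exact: fdiff_avoid.
apply: avoidN; apply: avoidD; apply: avoid_star => //.
by apply: (dg_ell_lacks H).
Qed.

Lemma defect_reg : regular 2 defect.
Proof.
apply: regularB; first exact: (fdiff_reg D rf).
apply: regularD; first exact: (@star_regular _ P KX 1 2 _ _ _ rf rell).
exact: (@star_regular _ P KY 1 1 _ _ _ rf rf).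
Qed.

(** The commutator of Q and V d/dz is the defect. The terms in lambda and adj
cancel by the L-infinity relation for lambda, differentiated in the direction
of y: they are instances of the pre-Lie identity. *)
Lemma field_ident :
  fdiff D V - (star KX 1 2 V (ell : fam (kcol KX)) + star KY 1 1 V (f : fam (kcol KY))
     + star KZ 1 2 V (lam : fam (kcol KZ))) + star KZ 2 1 lam (V : fam (kcol KZ)) = defect.
Proof.
have uX : lacks KX ups by apply: unitf_lacks.
have uZ : lacks KZ ups by apply: unitf_lacks.
have lX : lacks KX lam by apply: (in_lam_lacks H0).
have lY : lacks KY lam by apply: (in_lam_lacks H0).
have rups := unitf_reg P Wavy KY.
have E1 : fdiff D (adj lam) = - star KZ 3 0 (star KZ 2 2 lam (lam : fam (kcol KZ))) (ups : fam (kcol KZ)).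
  rewrite /adj fdiff_star fdiff_unitf star0r scaler0 addr0.
  by rewrite (dg_lam H) starNl.
have E2 : star KX 1 2 (adj lam) (ell : fam (kcol KX)) = 0.
  by apply: star_lacks0; apply: (adj_lacksX H0).
have E3 : star KY 1 1 (adj lam) (f : fam (kcol KY)) = star KZ 2 1 lam (f : fam (kcol KZ)).
  have -> : star KY 1 1 (adj lam) (f : fam (kcol KY)) =
      star KZ 2 1 lam (star KY 0 1 ups (f : fam (kcol KY)) : fam (kcol KZ)) +
      (-1) ^+ 1 *: (star KZ 3 0 (star KY 2 1 lam (f : fam (kcol KY))) (ups : fam (kcol KZ))
        - star KY 2 0 lam (star KZ 1 0 f (ups : fam (kcol KZ)) : fam (kcol KY))).
    exact: (@star_comm _ P KZ KY 2 0 1 _ lam ups f rlam rups rf).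
  rewrite (@star_lacks0 _ P KY 2 1 _ lam f lY) (@star_lacks0 _ P KY 2 0 _ lam _ lY).
  rewrite star0l subrr scaler0 addr0; congr (star KZ 2 1 _ _).
  exact: (@star_unitl _ P KY 1 f rf).
have E4 : star KZ 1 2 f (lam : fam (kcol KZ)) = 0 by apply: star_lacks0.
have E5 : star KZ 1 2 (adj lam) (lam : fam (kcol KZ)) =
    star KZ 2 1 lam (adj lam : fam (kcol KZ))
    - star KZ 3 0 (star KZ 2 2 lam (lam : fam (kcol KZ))) (ups : fam (kcol KZ)).
  have -> : star KZ 1 2 (adj lam) (lam : fam (kcol KZ)) =
      star KZ 2 1 lam (star KZ 0 2 ups (lam : fam (kcol KZ)) : fam (kcol KZ)) +
      (-1) ^+ 1 *: (star KZ 3 0 (star KZ 2 2 lam (lam : fam (kcol KZ))) (ups : fam (kcol KZ))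
        - star KZ 2 1 lam (star KZ 2 0 lam (ups : fam (kcol KZ)) : fam (kcol KZ))).
    exact: (@star_comm _ P KZ KZ 2 0 2 _ lam ups lam rlam rups rlam).
  by rewrite (@star_lacks0 _ P KZ 0 2 _ ups lam uZ) star0r add0r expr1 scaleN1r opprB.
have VD k e e' (v : fam (kcol k)) : star k e e' V v = star k e e' (adj lam) v + star k e e' f v.
  exact: starDl.
have lV : star KZ 2 1 lam (V : fam (kcol KZ)) =
  star KZ 2 1 lam (adj lam : fam (kcol KZ)) + star KZ 2 1 lam (f : fam (kcol KZ)).
  exact: starDr.
have dV : fdiff D V = fdiff D (adj lam) + fdiff D f by exact: fdiffD.
rewrite dV lV !VD E1 E2 E3 E4 E5 /defect !addr0 add0r.
set x := star KZ 3 0 _ _; set z := star KZ 2 1 _ _; set y := star KZ 2 1 _ _.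
set a1 := fdiff D f; set a2 := star KX _ _ _ _; set a3 := star KY _ _ _ _.
have -> : a2 + (z + a3) + (y - x) = (a2 + a3) + (y + z - x).
  by rewrite [LHS](AC (1*2*2) ((1*3)*(4*2*5))).
exact: cancel_adjoint_terms.
Qed.

(** Q passes through V d/dz up to their commutator. *)
Lemma hvf_star e c (a : fam c) : regular e a ->
  hvf e (star KZ e 1 a (V : fam (kcol KZ))) =
  star KZ (e + 1) 1 (hvf e a) (V : fam (kcol KZ))
  - (-1) ^+ absz e *: star KZ e 2 a (defect : fam (kcol KZ)).
Proof.
move=> ra.
have comm k e1 (u : fam (kcol k)) : regular e1 u -> e1 - (parity_of k)%:Z = 1 ->
    star k e e1 (star KZ e 1 a (V : fam (kcol KZ))) u =
    star KZ (e + 1) 1 (star k e e1 a u) (V : fam (kcol KZ))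
    - star k e e1 a (star KZ e1 1 u (V : fam (kcol KZ)))
    + star KZ e 2 a (star k 1 e1 V u : fam (kcol KZ)).
  move=> ru he1; have := @star_comm _ P k KZ e e1 1 c a u V ra ru rV.
  rewrite -[(parity_of KZ)%:Z]/(1 : int) subrr muln0 expr0 scale1r !addrK.
  rewrite -[e + e1 - _]addrA -[1 + e1 - _]addrA he1 => ->.
  by rewrite [X in _ = X - _ + _]addrC addrK subrK.
have ce : star KX e 2 (star KZ e 1 a (V : fam (kcol KZ))) (ell : fam (kcol KX)) =
    star KZ (e + 1) 1 (star KX e 2 a (ell : fam (kcol KX))) (V : fam (kcol KZ))
    + star KZ e 2 a (star KX 1 2 V (ell : fam (kcol KX)) : fam (kcol KZ)).
  rewrite (comm KX 2 ell rell erefl) (_ : star KZ 2 1 ell _ = 0) ?star0r ?subr0//.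
  by apply: star_lacks0; apply: (dg_ell_lacks H).
have cf : star KY e 1 (star KZ e 1 a (V : fam (kcol KZ))) (f : fam (kcol KY)) =
    star KZ (e + 1) 1 (star KY e 1 a (f : fam (kcol KY))) (V : fam (kcol KZ))
    + star KZ e 2 a (star KY 1 1 V (f : fam (kcol KY)) : fam (kcol KZ)).
  rewrite (comm KY 1 f rf erefl) (_ : star KZ 1 1 f _ = 0) ?star0r ?subr0//.
  exact: star_lacks0.
have cl := comm KZ 2 lam rlam erefl.
have cd : fdiff D (star KZ e 1 a (V : fam (kcol KZ))) =
    star KZ (e + 1) 1 (fdiff D a) (V : fam (kcol KZ))
    - (-1) ^+ absz e *: star KZ e 2 a (fdiff D V : fam (kcol KZ)).
  by rewrite fdiff_star exprD expr1 mulrN1 scaleNr.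
rewrite /hvf cd ce cf cl -field_ident.
set B := star KX 1 2 V _ + _ + _; set W := star KZ 2 1 lam _.
have -> : star KZ e 2 a ((fdiff D V - B + W) : fam (kcol KZ)) =
   star KZ e 2 a (fdiff D V : fam (kcol KZ))
   - (star KZ e 2 a (star KX 1 2 V (ell : fam (kcol KX)) : fam (kcol KZ))
     + star KZ e 2 a (star KY 1 1 V (f : fam (kcol KY)) : fam (kcol KZ))
     + star KZ e 2 a (star KZ 1 2 V (lam : fam (kcol KZ)) : fam (kcol KZ)))
   + star KZ e 2 a (W : fam (kcol KZ)).
  by rewrite starDr starDr starNr /B !starDr.
rewrite [star KZ (e + 1) 1 (_ + _) _]starDl starZl !starDl.
set z := (-1) ^+ _.
set x0 := star KZ (e+1) 1 (fdiff D a) _.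
set x1 := star KZ (e+1) 1 _ _; set x2 := star KZ (e+1) 1 _ _; set x3 := star KZ (e+1) 1 _ _.
set y1 := star KZ e 2 a _; set y2 := star KZ e 2 a _; set y3 := star KZ e 2 a _.
set y0 := star KZ e 2 a _; set w := star KZ e 2 a _.
rewrite -[x0 - _ + _]addrA -[x0 + _ - _]addrA; congr (_ + _).
rewrite -scalerBr -scalerN -scalerDr; congr (_ *: _).
exact: regroup_derivation_terms.
Qed.

Lemma hvf_zeta : hvf 1 zeta = - lam.
Proof.
rewrite /hvf fdiff_unitf add0r expr1 scaleN1r.
rewrite (@star_lacks0 _ P KX) ?(@star_lacks0 _ P KY) ?add0r; try by apply: unitf_lacks.
by congr (- _); exact: (@star_unitl _ P KZ 2 lam rlam).
Qed.

(** Iterating [hvf_star] from Q z = - lambda. *)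
Lemma hvf_flow n : hvf 1 (flow V 1 n zeta) = - flow V 2 n lam +
  \sum_(i < n) flow V 2 (n - i.+1) (star KZ 1 2 (flow V 1 i zeta) (defect : fam (kcol KZ))).
Proof.
elim: n => [|n IH]; first by rewrite big_ord0 addr0 hvf_zeta.
rewrite flowS hvf_star; last exact: flow_reg rV (zeta_reg P).
rewrite IH expr1 scaleN1r opprK big_ord_recr /= subnn starDl starNl addrA; congr (_ + _ + _).
rewrite star_suml; apply: eq_bigr => i _; rewrite subSS -[(n - i)%N]/(n - i)%N.
by rewrite -[in RHS](subnSK (ltn_ord i)).
Qed.

(** A positive power of V d/dz applied to z has positive weight: at least one
of its inputs is not the slot of the defect. *)
Lemma star_defect_small M i : (forall q A d, (#|` A| < M)%N -> defect q A d = 0) ->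
  small M (star KZ 1 2 (flow V 1 i.+1 zeta) (defect : fam (kcol KZ))).
Proof.
move=> hM q A d hA.
transitivity (star KZ 1 2 (0 : fam Wavy) (defect : fam (kcol KZ)) q A d); last by rewrite star0l.
apply: star_eq => J JA s q' d1 d2; rewrite ocomp0l.
have [/eqP eJ|nJ] := boolP (A `\` J == fset0); last first.
  rewrite hM ?ocomp0r//; apply: leq_trans hA.
  by rewrite -subn_gt0 -(cardfsDS JA) cardfs_gt0.
rewrite eJ fsetU0 (flow_wt _ _ _ (field_heavy H0)) ?ocomp0l// wt1 /q' /s updE //.
Qed.

(** Since lambda has no constant term, Q is tangent to the locus z = 0. *)
Lemma kill_hvf (a : fam Wavy) : kill KZ (hvf 1 a) = fdiff D (kill KZ a) -
  (star KX 1 2 (kill KZ a) (ell : fam (kcol KX)) + star KY 1 1 (kill KZ a) (f : fam (kcol KY))).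
Proof.
rewrite /hvf killD kill_fdiff expr1 scaleN1r; congr (_ + _).
rewrite -scaleN1r killZ scaleN1r !killD; congr (- _).
have -> : kill KZ (star KZ 1 2 a (lam : fam (kcol KZ))) = 0.
  apply: fam_ext => q A d; rewrite /kill; case: hasP => // hZ.
  transitivity (star KZ 1 2 (0 : fam Wavy) (lam : fam (kcol KZ)) q A d); last by rewrite star0l.
  apply: star_eq => J JA s q' d1 d2; rewrite ocomp0l.
  have [->|[x xJ]] := fset_0Vmem J; first by rewrite (in_lam1 H0) ?cardfs0// ocomp0r.
  rewrite (lam_only H0) ?ocomp0r//; exists x => // qx; apply: hZ; exists x.
    exact: (fsubsetP JA).
  have sA := freshP (kcol KZ) (leqnn (fresh A)).
  by move: qx; rewrite /q' /s (upd_out q KZ sA) => [->//|]; apply: (fsubsetP JA).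
rewrite addr0 !kill_star//; congr (star KX 1 2 _ _ + star KY 1 1 _ _).
  by apply: kill_lacks; apply: (dg_ell_lacks H).
exact: kill_lacks.
Qed.

Lemma hvf_sum N (x : nat -> K) (a : nat -> fam Wavy) :
  hvf 1 (\sum_(n < N) x n *: a n) = \sum_(n < N) x n *: hvf 1 (a n).
Proof.
have h0 : hvf 1 (0 : fam Wavy) = 0.
  by have := hvf_linear 1 (-1) (0 : fam Wavy) 0; rewrite !scaleN1r oppr0 !addr0 addNr.
elim/big_rec2: _ => [//|n y z _ <-]; exact: hvf_linear.
Qed.

(** Apply Q to the equation defining f, in two ways: through the powers of
V d/dz, and through the equation of an L-infinity morphism for phi. The
difference is the sum of all terms linear in the defect. *)
Lemma defect_sum q A d : let N := (wt q A).+2 in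
  (\sum_(n < N) (n`!%:R)^-1 *: kill KZ (\sum_(i < n)
    flow V 2 (n - i.+1) (star KZ 1 2 (flow V 1 i zeta) (defect : fam (kcol KZ))))) q A d = 0.
Proof.
move=> N; pose S n := \sum_(i < n)
    flow V 2 (n - i.+1) (star KZ 1 2 (flow V 1 i zeta) (defect : fam (kcol KZ))).
have E1 : kill KZ (hvf 1 (expn V 1 N zeta)) q A d =
   - kill KZ (expf V 2 lam) q A d + (\sum_(n < N) (n`!%:R)^-1 *: kill KZ (S n)) q A d.
  rewrite /expn (hvf_sum N (fun n => (n`!%:R)^-1) (fun n => flow V 1 n zeta)) kill_sum.
  have -> : \sum_(n < N) kill KZ ((n`!%:R)^-1 *: hvf 1 (flow V 1 n zeta)) =
     - kill KZ (expn V 2 N lam) + \sum_(n < N) (n`!%:R)^-1 *: kill KZ (S n).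
    rewrite /expn kill_sum -sumrN -big_split; apply: eq_bigr => n _ /=.
    by rewrite !killZ hvf_flow killD -[- flow _ _ _ _]scaleN1r killZ scaleN1r scalerDr scalerN.
  rewrite famE; congr (_ + _); rewrite !famE; congr (- _); rewrite /kill.
  by case: ifP => // _; rewrite (@expfE _ _ V 2 _ lam N q A d (field_heavy H0))// /N.
have E2 : kill KZ (hvf 1 (expn V 1 N zeta)) q A d = - kill KZ (expf V 2 lam) q A d.
  have ag q0 A0 d0 : (wt q0 A0 < N)%N -> kill KZ (expn V 1 N zeta) q0 A0 d0 = phi q0 A0 d0.
    move=> h0; rewrite -[in RHS](expf_zeta H0) /kill; case: ifP => // _.
    by rewrite (@expfE _ _ V 1 _ zeta N q0 A0 d0 (field_heavy H0) h0).
  rewrite kill_hvf !famE; have [d1 ->] := deg_pred d; rewrite fdiffE ag -?fdiffE; last by rewrite /N.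
  rewrite (_ : star KX 1 2 _ _ _ _ _ = star KX 1 2 phi (ell : fam (kcol KX)) q A (d1 + 1)); last first.
    apply: star_eq => J JA s q' d2 d3; have [w1 [w2 w3]] := wt_split q KX JA.
    by rewrite ag// w1 /N w3 /= !ltnS leq_addr.
  rewrite (_ : star KY 1 1 _ _ _ _ _ = star KY 1 1 phi (f : fam (kcol KY)) q A (d1 + 1)); last first.
    apply: star_eq => J JA s q' d2 d3; have [w1 [w2 w3]] := wt_split q KY JA.
    by rewrite ag// w1 /N w3 /= !ltnS leq_addr.
  rewrite (@star_lacks0 _ P KY 1 1 _ phi f); last exact: (in_phi_lacks H0).
  by rewrite addr0 (dg_phi H) !famE addrAC subrr add0r.
by apply: (@addrI _ (- kill KZ (expf V 2 lam) q A d)); rewrite addr0 -E1 E2.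
Qed.

(** In the sum of [defect_sum] the index n = 1 gives the defect itself. For
n > 1 and i = 0 the defect is differentiated in the direction z on which it does
not depend, and for i > 0 it only occurs with fewer inputs. *)
Lemma defect0 : defect = 0.
Proof.
suff h M q A d : (#|` A| < M)%N -> defect q A d = 0.
  by apply: fam_ext => q A d; apply: (h (#|` A|).+1).
elim: M q A d => // M IH q A d hA.
have := defect_sum q A d; rewrite /=.
case: (pselect (exists2 x, x \in A & q x = KZ)) => [[x xA qx] _|hZ].
  exact: defect_lacksZ qx.
rewrite big_ord_recl big_ord0 kill0 scaler0 add0r big_ord_recl.
have z0 : star KZ 1 2 zeta (defect : fam (kcol KZ)) = defect.
  exact: (@star_unitl _ P KZ 2 defect defect_reg).
rewrite big_ord_recl big_ord0 addr0 /= z0 -[(bump 0 0)`!]/1%N invr1 scale1r famE (kill_lacks defect_lacksZ).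
rewrite famE big1 ?addr0// => n _; rewrite famE kill_sum famE big1 ?scaler0// => i _.
rewrite /kill; case: ifP => // _.
case: i => -[|i] hi /=.
  rewrite z0 -flowS flowSr (@star_lacks0 _ P KZ 2 1 _ defect V defect_lacksZ) flow0 //.
by apply: (flow_small H0 (M := M)); [apply: star_defect_small|].
Qed.
End Main.

(** * The exponential applied to lambda *)

Section Subst.
Variables (K : fieldType) (P : operad K).
Local Notation fam := (fam P).
Implicit Types (q : deco) (A J I : {fset label}) (d e : int) (k l : kind) (n : nat).
Hypothesis charK0 : [pchar K] =i pred0.
Local Notation zeta := (unitf P Wavy KZ).

(** The slots are chosen one after the other: for v independent of u this is n!
times the term of order n in the substitution of v for u. *)
Definition subst (v : fam Wavy) n (a : fam Wavy) : fam Wavy :=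
  iter n (fun b => star KU 2 1 b (v : fam (kcol KU))) a.

Variable G : forall A d, P A Wavy d.
Hypothesis Gw : forall A d x, x \in A -> x.1 = Straight -> G A d = 0.
Hypothesis rG : forall k, parity_of k = 1%N -> regular 2 (pure G k).

Definition nZ q A : nat := (\sum_(x <- A) (q x == KZ))%N.

Lemma subst_reg v n a : regular 1 v -> regular 2 a -> regular 2 (subst v n a).
Proof.
by move=> rv ra; elim: n => //= n IH; exact: (@star_regular _ P KU 2 1 _ _ _ IH rv).
Qed.

(** Substituting z into n of the variables u, one after the other, produces each
coefficient with n variables z once per ordering of these. *)
Lemma subst_zeta n q A d : subst zeta n (pure G KU) q A d =
  if all (fun x => (q x == KZ) || (q x == KU)) A && (nZ q A == n) then n`!%:R *: G A d else 0.
Proof.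
case: (pselect (exists2 x, x \in A & x.1 = Straight)) => [[x xA xs]|nS].
  rewrite (Gw _ xA xs) scaler0 if_same.
  elim: n q => [|n IH] q /=; first by rewrite /pure (Gw _ xA xs) if_same.
  rewrite (@star_unitr _ P KU KZ) /=; last exact: (subst_reg n (unitf_reg P Wavy KZ) (rG _)).
  by rewrite big1// => y _; rewrite IH scaler0.
elim: n q => [|n IH] q /=.
  rewrite fact0 scale1r /pure.
  suff -> : all (fun x => q x == KU) A =
      all (fun x => (q x == KZ) || (q x == KU)) A && (nZ q A == 0%N) by [].
  apply/allP/andP => [h|[/allP h1 h2] x xA].
    split; first by apply/allP => x /h ->; rewrite orbT.
    by rewrite /nZ big_seq big1// => x /h /eqP ->.
  have /orP[qx|//] := h1 _ xA; move: h2; rewrite /nZ sum_nat_seq_eq0 => /allP /(_ _ xA).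
  by rewrite qx.
rewrite (@star_unitr _ P KU KZ) /=; last exact: (subst_reg n (unitf_reg P Wavy KZ) (rG _)).
have E x : x \in A -> q x = KZ -> nZ q A = (nZ (upd q x KU) A).+1 /\
    all (fun x => (q x == KZ) || (q x == KU)) A =
    all (fun y => (upd q x KU y == KZ) || (upd q x KU y == KU)) A.
  move=> xA qx; split.
    rewrite /nZ (big_fsetD1 x)//= [in RHS](big_fsetD1 x)//= updE qx add1n; congr _.+1.
    apply: eq_big_seq => y; rewrite !inE => /andP[yx _].
    by rewrite /upd (negPf yx).
  by apply: eq_in_all => y _; rewrite /upd; case: (eqVneq y x) => [->|//]; rewrite qx.
rewrite (_ : (if _ then _ else _) = \sum_(x <- A | (x.1 == Wavy) && (q x == KZ))
   (if all (fun x => (q x == KZ) || (q x == KU)) A && (nZ q A == n.+1) then n`!%:R *: G A d else 0)).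
  rewrite big_seq_cond [RHS]big_seq_cond; apply: eq_bigr => x /and3P[xA _ /eqP qx].
  have [e1 e2] := E _ xA qx; rewrite IH e1 e2 eqSS.
  have -> : iv q [fset x] (A `\ x) = iv (upd q x KU) [fset x] (A `\ x).
    rewrite /iv !big_seq_fset1 updE qx; apply: eq_big_seq => y; rewrite !inE => /andP[yx _].
    by rewrite /upd (negPf yx).
  rewrite mul0n add0n addnn -mul2n exprM sqrrN expr1n expr1n scale1r //.
set v := (X in _ = \sum_(x <- A | _) X); transitivity (\sum_(x <- A) (q x == KZ)%:R *: v).
  rewrite -scaler_suml -natr_sum -/(nZ q A) /v.
  by case: ifP => [/andP[_ /eqP ->]|_]; rewrite ?scaler0// scalerA -natrM -factS.
rewrite [RHS]big_mkcond; apply: eq_big_seq => x xA.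
have -> /= : x.1 == Wavy by apply/eqP; case e: x.1 => //; case: nS; exists x.
by case: ifP; rewrite ?scale1r ?scale0r.
Qed.

Lemma nZ_all q A : all (fun x => q x == KZ) A -> nZ q A = #|` A|.
Proof.
by move=> /allP h; rewrite /nZ (eq_big_seq (fun=> 1%N)) ?sum1_size// => x /h ->.
Qed.

(** The Taylor expansion of lambda (z) at 0, written through lambda (u). *)
Lemma pure_taylor N q A d : (#|` A| < N)%N ->
  pure G KZ q A d = (\sum_(n < N) (n`!%:R)^-1 *: kill KU (subst zeta n (pure G KU))) q A d.
Proof.
move=> hN; rewrite !famE (eq_bigr (fun n : 'I_N => if n == #|` A| :> nat then pure G KZ q A d else 0)).
  rewrite -big_mkcond /= (big_pred1 (Ordinal hN)) //.
move=> n _; rewrite !famE {1}/kill subst_zeta /pure.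
have [hU|hU] := boolP (has (fun x => q x == KU) A).
  rewrite scaler0; case: allP => [h|]; last by rewrite if_same.
  by case/hasP: hU => x /h /eqP ->.
have -> : all (fun x => (q x == KZ) || (q x == KU)) A = all (fun x => q x == KZ) A.
  apply: eq_in_all => x xA; rewrite orbC; case: eqP => //= qx.
  by case/hasP: hU; exists x => //; rewrite qx.
have [hA|hA] := boolP (all (fun x => q x == KZ) A); last by rewrite /= scaler0 if_same.
rewrite (nZ_all hA) eq_sym; case: eqP => _ /=; last by rewrite scaler0.
by rewrite scalerA mulVf ?scale1r// fact_neq0.
Qed.

Section ExpLam.
Variable phi : fam Wavy.
Hypothesis H0 : input phi (pure G KZ).
Local Notation V := (field phi (pure G KZ)).

Let rV := field_reg H0.

Lemma flow_agree_small n c (a b : fam c) q A d :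
  (forall q B d, (#|` B| <= #|` A|)%N -> a q B d = b q B d) ->
  flow V 2 n a q A d = flow V 2 n b q A d.
Proof.
move=> h; apply/eqP; rewrite -subr_eq0 -famB.
have <- : flow V 2 n (a - b) = flow V 2 n a - flow V 2 n b.
  by rewrite -scaleN1r flowD flowZ scaleN1r.
apply/eqP; apply: (flow_small H0 (M := #|` A|)) => // q0 B d0 hB.
by rewrite famB h// subrr.
Qed.

Lemma kill_comm k l c (a : fam c) : kill k (kill l a) = kill l (kill k a).
Proof. by apply: fam_ext => q A d; rewrite /kill; case: ifP; case: ifP. Qed.

Lemma kill_expf k e c (a : fam c) : k <> KZ -> lacks k V ->
  kill k (expf V e a) = expf V e (kill k a).
Proof.
move=> kZ fV.
have hf n : kill k (flow V e n a) = flow V e n (kill k a).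
  by elim: n => //= n IH; rewrite kill_star// IH (kill_lacks (a := V)).
apply: fam_ext => q A d; rewrite /expf.
under [RHS]eq_bigr do rewrite -hf.
rewrite /kill; case: ifP => // _.
by rewrite big1// => n _; rewrite scaler0.
Qed.

Lemma expf_reg e c (a : fam c) : regular e a -> regular e (expf V e a).
Proof.
move=> ra; apply: (@wsum_reg _ _ _ _ xpredT (fun n => (n`!%:R)^-1 *: flow V e n a)) => n.
by apply: regularZ; apply: flow_reg.
Qed.

(** A function that is independent of z is fixed by the flow. *)
Lemma expf_const e c (a : fam c) : lacks KZ a -> expf V e a = a.
Proof.
move=> fa; apply: fam_ext => q A d; rewrite /expf big_ord_recl fact0 invr1 scale1r.
rewrite big1 ?addr0// => n _; rewrite flowSr.
by rewrite (@star_lacks0 _ P KZ e 1 _ a V fa) flow0 scaler0.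
Qed.

(** Multiplicativity of the exponential, and exp (V d/dz) z = phi at z = 0. *)
Lemma exp_subst n : kill KZ (expf V 2 (subst zeta n (pure G KU))) = subst phi n (pure G KU).
Proof.
elim: n => [|n IH] /=.
  by rewrite expf_const ?kill_lacks//; apply: pure_lacks.
have h := expf_star charK0 rV (field_lacksU H0) (field_heavy H0)
  (subst_reg n (unitf_reg P Wavy KZ) (@rG KU erefl)) (unitf_reg P Wavy KZ).
transitivity (kill KZ (star KU 2 1 (expf V 2 (subst zeta n (pure G KU))) (expf V 1 zeta : fam (kcol KU)))).
  by congr (kill KZ _); exact: h.
by rewrite kill_star// IH (expf_zeta H0).
Qed.

(** The flow maps lambda (z) to lambda (phi). *)
Lemma exp_lam N q A d : (#|` A| < N)%N -> kill KZ (expf V 2 (pure G KZ)) q A d =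
  (\sum_(n < N) (n`!%:R)^-1 *: kill KU (subst phi n (pure G KU))) q A d.
Proof.
move=> hN.
have -> : kill KZ (expf V 2 (pure G KZ)) q A d =
   kill KZ (expf V 2 (\sum_(n < N) (n`!%:R)^-1 *: kill KU (subst zeta n (pure G KU)))) q A d.
  rewrite /kill; case: ifP => // _; rewrite /expf; apply: eq_bigr => n _; congr (_ *: _).
  apply: flow_agree_small => q0 B d0 hB; apply: pure_taylor.
  exact: leq_ltn_trans hN.
have expfS (F : nat -> fam Wavy) : expf V 2 (\sum_(n < N) F n) = \sum_(n < N) expf V 2 (F n).
  elim/big_rec2: _ => [|n y z _ <-]; apply: fam_ext => q0 A0 d0; rewrite /expf.
    by rewrite big1// => n _; rewrite flow0 scaler0.
  by rewrite famE -big_split; apply: eq_bigr => m _; rewrite flowD famE scalerDr.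
have expfZ z (a : fam Wavy) : expf V 2 (z *: a) = z *: expf V 2 a.
  apply: fam_ext => q0 A0 d0; rewrite famE /expf scaler_sumr; apply: eq_bigr => n _.
  by rewrite flowZ famE !scalerA mulrC.
rewrite (expfS (fun n => (n`!%:R)^-1 *: kill KU (subst zeta n (pure G KU)))) kill_sum.
rewrite !famE; apply: eq_bigr => n _; rewrite expfZ killZ !famE; congr (_ *: _).
rewrite -kill_expf//; last exact: (field_lacksU H0).
by rewrite kill_comm exp_subst.
Qed.
End ExpLam.
End Subst.

(** * Iterated choices of disjoint subsets *)

Section Nest.
Variable V : zmodType.

(** A sum over the ordered partitions of A into k blocks, possibly empty, unrolled
block by block so as to match iterated insertion. *)
Fixpoint nest k (A : {fset label}) (F : seq {fset label} -> V) : V :=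
  if k is k'.+1 then \sum_(J <- fpowerset A) nest k' (A `\` J) (fun l => F (J :: l))
  else if A == fset0 then F [::] else 0.

Fixpoint parts (l : seq {fset label}) (A : {fset label}) : bool :=
  if l is J :: l' then (J `<=` A) && parts l' (A `\` J) else A == fset0.

Lemma nest_ext k A F F' :
  (forall l, size l = k -> parts l A -> F l = F' l) -> nest k A F = nest k A F'.
Proof.
elim: k A F F' => [|k IH] A F F' h /=; first by case: eqP => // A0; apply: h => //=; apply/eqP.
apply: eq_big_seq => J; rewrite fpowersetE => JA; apply: IH => l sl pl.
by apply: h; rewrite /= ?sl// JA.
Qed.

Lemma parts_sum l A (F : label -> nat) : parts l A ->
  (\sum_(J <- l) \sum_(x <- J) F x = \sum_(x <- A) F x)%N.
Proof.
elim: l A => [|J l IH] A /=; first by move=> /eqP ->; rewrite big_nil big_seq_fset0.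
move=> /andP[JA pl]; rewrite big_cons (IH _ pl) -[in RHS](fsetD_subU JA) sumnU_disj ?fdisjointDl//.
by rewrite addnC.
Qed.

Section Blocks.
Variables (T : finType) (lab : T -> label).
Hypothesis lab_inj : injective lab.
Variables (k : nat) (dflt : 'I_k).

Definition labs (I : {set T}) : {fset label} := [fset lab i | i in I].
Definition bl (I : {set T}) (b : {ffun T -> 'I_k}) (a : nat) : {fset label} :=
  labs [set i in I | b i == a :> nat].
Definition bounded j (I : {set T}) (b : {ffun T -> 'I_k}) :=
  [forall i, if i \in I then (b i < j)%N else b i == dflt].

Lemma labs_in (I : {set T}) i : (lab i \in labs I) = (i \in I).
Proof.
apply/imfsetP/idP => /= [[j jI /lab_inj ->]//|iI]; by exists i.
Qed.

Lemma labsP (I : {set T}) x : reflect (exists2 i, i \in I & x = lab i) (x \in labs I).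
Proof. exact: imfsetP. Qed.

Lemma labs_inj : injective labs.
Proof. by move=> I J e; apply/setP => i; rewrite -!labs_in e. Qed.

Lemma labsD (I J : {set T}) : labs (I :\: J) = labs I `\` labs J.
Proof.
apply/fsetP => x; rewrite inE; apply/labsP/andP => [[i]|[xJ /labsP[i iI ex]]].
  by rewrite inE => /andP[iJ iI] ->; rewrite !labs_in.
by exists i => //; rewrite inE iI andbT -labs_in -ex.
Qed.

(** A map b with values less than j splits I into its fibres over j - 1, ..., 0;
removing the first of them leaves a map with values less than j - 1. Outside I
the map b is pinned to a default value, so that it is counted once. *)
Lemma nest_bounded j I (F : seq {fset label} -> V) : (j <= k)%N ->
  \sum_(b | bounded j I b) F [seq bl I b a | a <- rev (iota 0 j)] = nest j (labs I) F.
Proof.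
elim: j I F => [|j IH] I F jk /=.
  have -> : (labs I == fset0) = (I == set0).
    apply/eqP/eqP => [h|->]; last by apply/fsetP => x; rewrite !inE; apply/labsP => -[i]; rewrite inE.
    by apply/setP => i; rewrite -labs_in h !inE.
  case: eqP => [->|/eqP /set0Pn[i iI]]; last first.
    by rewrite big_pred0// => b; apply/negP => /forallP /(_ i); rewrite iI.
  rewrite (big_pred1 [ffun=> dflt])// => b; apply/forallP/eqP => /= [h|-> i].
    by apply/ffunP => i; have := h i; rewrite inE ffunE => /eqP.
  by rewrite inE ffunE.
have -> : rev (iota 0 j.+1) = j :: rev (iota 0 j).
  by rewrite -addn1 iotaD rev_cat.
rewrite (sum_bij_seq (S1 := index_enum _) (h := labs) (P := fun J : {set T} => J \subset I) (Q := predT));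
  rewrite ?index_enum_uniq ?fset_uniq//; last 2 first.
- by move=> J J' _ _ _ _ /labs_inj.
- move=> y; rewrite andbT fpowersetE; apply: (iffP idP) => [yI|[J [_ JI ->]]].
    exists [set i | lab i \in y]; split; first by rewrite mem_index_enum.
      by apply/subsetP => i; rewrite inE => /(fsubsetP yI); rewrite labs_in.
    apply/fsetP => x; apply/idP/labsP => [xy|[i]]; last by rewrite inE => iy ->.
    by have /labsP[i iI ex] := fsubsetP yI _ xy; exists i; rewrite // inE -ex.
  by apply/fsubsetP => x /labsP[i iJ ->]; rewrite labs_in; apply: (subsetP JI).
rewrite (partition_big (fun b : {ffun T -> 'I_k} => [set i in I | b i == j :> nat])
   (fun J : {set T} => J \subset I)) /=; last first.
  by move=> b _; apply/subsetP => i; rewrite inE => /andP[].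
apply: eq_bigr => J JI; rewrite -labsD -IH; last exact: ltnW.
rewrite (reindex_onto (fun b' : {ffun T -> 'I_k} => [ffun i => if i \in J then Ordinal jk else b' i])
  (fun b : {ffun T -> 'I_k} => [ffun i => if i \in J then dflt else b i])) /=; last first.
  move=> b /andP[_ /eqP hJ]; apply/ffunP => i; rewrite !ffunE; case: (boolP (i \in J)) => // iJ.
  by apply: val_inj; rewrite /=; move: iJ; rewrite -hJ inE => /andP[_ /eqP].
apply: eq_big => [b'|b' /andP[/andP[/forallP hb /eqP hJ] _]].
  apply/andP/idP => [[/andP[/forallP hb /eqP hJ] /eqP hd]|/forallP hb].
    apply/forallP => i; have := hb i; have /setP/(_ i) := hJ; rewrite -hd !inE !ffunE.
    case: (boolP (i \in J)) => iJ /=; first by rewrite eqxx.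
    case: (boolP (i \in I)) => iI //= hne.
    by rewrite ltnS leq_eqVlt hne.
  have out i : i \notin J -> i \in I -> (b' i < j)%N.
    by move=> iJ iI; have := hb i; rewrite inE iJ iI.
  split; last first.
    apply/eqP/ffunP => i; rewrite !ffunE; case: (boolP (i \in J)) => // iJ.
    by have := hb i; rewrite inE iJ => /eqP ->.
  apply/andP; split.
    apply/forallP => i; rewrite ffunE; have := hb i; rewrite !inE.
    case: (boolP (i \in J)) => iJ /=; first by rewrite (subsetP JI _ iJ).
    by case: ifP => // _ /ltnW.
  apply/eqP/setP => i; rewrite inE ffunE; case: (boolP (i \in J)) => iJ.
    by rewrite (subsetP JI _ iJ) eqxx.
  case: (boolP (i \in I)) => //= iI; have := out _ iJ iI.
  by rewrite ltn_neqAle => /andP[/negPf].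
rewrite /= {1}/bl hJ; congr (F (_ :: _)); apply/eq_in_map => a.
rewrite mem_rev mem_iota add0n => /andP[_ aj]; rewrite /bl; congr labs.
apply/setP => i; rewrite !inE ffunE; case: (boolP (i \in J)) => iJ //=.
by rewrite gtn_eqF// andbF.
Qed.
End Blocks.

Lemma nest_block m k F : (0 < k)%N ->
  \sum_(b : {ffun 'I_m -> 'I_k}) F (rev [seq block b a | a <- enum 'I_k]) =
  nest k (labels Straight 1 m) F.
Proof.
case: k => // k _.
pose lab (i : 'I_m) : label := (Straight, i.+1).
have li : injective lab by move=> i j [] /val_inj.
have -> : labels Straight 1 m = labs lab [set: 'I_m].
  apply/fsetP => x; apply/imfsetP/labsP => /= [[i]|[i _ ->]].
    rewrite mem_iota => /andP[i1 i2] ->.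
    have hi : (i.-1 < m)%N by lia.
    by exists (Ordinal hi); rewrite ?inE// /lab /= prednK.
  by exists i.+1 => //; rewrite mem_iota; have := ltn_ord i; lia.
rewrite -(nest_bounded li ord0 [set: 'I_m] F (leqnn k.+1)); apply: eq_big => b.
  by apply/esym/forallP => i; rewrite inE ltn_ord.
move=> _; congr F; rewrite -map_rev -[in RHS]val_enum_ord -map_rev -map_comp; apply: eq_map => a /=.
rewrite /block /bl /labs; apply: eq_imfset => // i.
by rewrite !inE.
Qed.
End Nest.

(** * Standard sets of labels *)

Section Standard.
Implicit Types (A D : {fset label}) (m n : nat).

(** The sets of inputs used to state the differentials of HS_infinity. *)
Definition std m n : {fset label} := labels Straight 1 m `|` labels Wavy m.+1 n.

Lemma in_labels c i n x : (x \in labels c i n) = (x.1 == c) && (i <= x.2 < i + n)%N.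
Proof.
apply/imfsetP/andP => /= [[k]|[/eqP <-]]; rewrite ?mem_iota => hk.
  by move=> ->; rewrite eqxx.
by exists x.2; rewrite ?mem_iota//; apply: surjective_pairing.
Qed.

Lemma card_labels c i n : #|` labels c i n| = n.
Proof.
rewrite /labels card_imfset; last by move=> x y [].
by rewrite /= undup_id ?iota_uniq// size_iota.
Qed.

(** Listing the numbers of the inputs of one colour renames these inputs to their
positions. *)
Definition nums A c : seq nat := [seq x.2 | x <- enum_fset [fset x in A | x.1 == c]].

Lemma nums_size A c : size (nums A c) = nin A c.
Proof. by rewrite size_map. Qed.

Lemma mem_nums A c i : (i \in nums A c) = ((c, i) \in A).
Proof.
apply/mapP/idP => [[[c' j]]|h]; last by exists (c, i); rewrite // !inE h eqxx.
by rewrite !inE /= => /andP[jA /eqP <-] ->.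
Qed.

Lemma nums_uniq A c : uniq (nums A c).
Proof.
rewrite map_inj_in_uniq ?fset_uniq// => -[c1 i] [c2 j].
by rewrite !inE /= => /andP[_ /eqP->] /andP[_ /eqP->] ->.
Qed.

Definition first_number m c := if c is Straight then 1%N else m.+1.

Lemma in_std m n x : (x \in std m n) =
  (first_number m x.1 <= x.2 < first_number m x.1 + (if x.1 is Straight then m else n))%N.
Proof. by case: x => -[] i; rewrite /std in_fsetU !in_labels /= ?orbF. Qed.

Lemma relabels_std A : exists f, relabels f (std (nin A Straight) (nin A Wavy)) A.
Proof.
set m := nin A Straight; set n := nin A Wavy.
pose f : renaming := fun c i => nth 0%N (nums A c) (i - first_number m c).
have fA x : x \in std m n -> (x.2 - first_number m x.1 < size (nums A x.1))%N.
  rewrite in_std nums_size => /andP[h1 h2].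
  have -> : nin A x.1 = (if x.1 is Straight then m else n) by case: x.1.
  by rewrite ltn_subLR.
exists f; split.
  move=> [c i] [c' j] hx hy; rewrite /rename /f /= => -[ec]; subst c' => /eqP.
  rewrite nth_uniq ?nums_uniq//; [|exact: (fA _ hx)|exact: (fA _ hy)].
  move: hx hy; rewrite !in_std /= => /andP[h1 _] /andP[h2 _] /eqP e.
  by congr (_, _); rewrite -(subnK h1) e subnK.
apply/fsetP => -[c i]; apply/idP/imfsetP => /= [ciA|[x hx ->]]; last first.
  by rewrite /rename -mem_nums mem_nth// fA.
have iA : i \in nums A c by rewrite mem_nums.
have hi : (index i (nums A c) < nin A c)%N by rewrite -nums_size index_mem.
exists (c, (index i (nums A c) + first_number m c)%N).
  by rewrite in_std /= leq_addl addnC ltn_add2l /m /n; case: c iA hi {ciA}.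
by rewrite /rename /f /= addnK nth_index.
Qed.

Lemma nin_std m n : nin (std m n) Straight = m /\ nin (std m n) Wavy = n.
Proof.
rewrite /nin; split.
  rewrite -[RHS](card_labels Straight 1); congr #|` _|; apply/fsetP => -[[] i];
  by rewrite !inE !in_labels /= ?andbT ?andbF ?orbF.
rewrite -[RHS](card_labels Wavy m.+1); congr #|` _|; apply/fsetP => -[[] i];
by rewrite !inE !in_labels /= ?andbT ?andbF ?orbF.
Qed.
End Standard.

(** The kinds of the inputs determined by their colours, w being the kind of the
wavy ones. *)
Definition cdeco (w : kind) : deco := fun x => if x.1 is Straight then KX else w.
Notation coloured w := (avoid (fun x k => k <> cdeco w x)).

Section StdExt.
Variables (K : fieldType) (P : operad K).
Local Notation fam := (fam P).
Implicit Types (q : deco) (A J I : {fset label}) (d e : int) (k l : kind) (n : nat).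

(** By equivariance, an identity between families that only use one kind of
variable for each colour can be checked on the standard sets of inputs. *)
Lemma fam_std_ext w e c (a b : fam c) : regular e a -> regular e b ->
  coloured w a -> coloured w b ->
  (forall m n, let A := std m n in let d := e - (od (cdeco w) A)%:Z in
     a (cdeco w) A d = b (cdeco w) A d) -> a = b.
Proof.
move=> ra rb ca cb h; apply: fam_ext => q A d.
have [ed|nd] := eqVneq d (e - (od q A)%:Z); last by rewrite (reg_hom ra)// (reg_hom rb).
case: (pselect (exists2 x, x \in A & q x <> cdeco w x)) => [[x xA qx]|hA].
  by rewrite (ca _ _ _ _ xA qx) (cb _ _ _ _ xA qx).
have qA x : x \in A -> q x = cdeco w x.
  by move=> xA; case: (eqVneq (q x) (cdeco w x)) => // /eqP ne; case: hA; exists x.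
have [f rf] := relabels_std A; set S := std _ _ in rf.
have hq : {in S, forall x, q (rename f x) = cdeco w x}.
  move=> x xS; rewrite qA//; have [_ ->] := rf; exact: in_imfset.
have odS : od q A = od (cdeco w) S by have [fi ->] := rf; apply: od_rel.
have X (g : fam c) : regular e g -> g q A d =
    (-1) ^+ rinv (cdeco w) f S *: orel f (g (cdeco w) S d).
  by move=> rg; rewrite (reg_rel rg d rf hq) scalerA -exprD addnn -mul2n exprM sqrrN expr1n expr1n scale1r.
by rewrite (X a ra) (X b rb) ed odS h.
Qed.

End StdExt.

(** * Corollas as families, and the structure sums as insertions *)

Section StructureSums.
Variables (K : fieldType) (P : operad K).
Local Notation fam := (fam P).
Implicit Types (q : deco) (A J I : {fset label}) (d e : int) (k l : kind) (n : nat).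

Lemma in_iv0 q s A : (forall x, x \in A -> lab_lt x s = false) -> iv q [fset s] A = 0%N.
Proof.
by move=> h; rewrite /iv big_seq_fset1 big_seq big1// => x xA; rewrite h// muln0.
Qed.

Lemma iv_shuffle q J I c : (forall x, x \in J -> x.1 = c /\ parity_of (q x) = 1%N) ->
  (forall x, x \in I -> x.1 = c /\ parity_of (q x) = 1%N) -> iv q J I = shuffle J I.
Proof.
move=> hJ hI; rewrite /iv /shuffle; apply: eq_big_seq => x /hJ[x1 ->].
apply: eq_big_seq => y /hI[y1 ->]; rewrite !mul1n /lab_lt x1 y1.
by case: c {hJ hI x1 y1}.
Qed.

Lemma od_card q A : (forall x, x \in A -> parity_of (q x) = 1%N) -> od q A = #|` A|.
Proof. by move=> h; rewrite /od (eq_big_seq (fun=> 1%N)) ?sum1_size// => x /h. Qed.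

Lemma slot0_notin c A : (forall x, x \in A -> (0 < x.2)%N) -> (c, 0%N) \notin A.
Proof. by move=> h; apply/negP => /h. Qed.

(** The L-infinity relations, with their signs, are insertions: the slot named 0
is the smallest input, hence already in front. *)
Lemma Linf_sumE k (G : forall A d, P A (kcol k) d) q A d : parity_of k = 1%N ->
  regular 2 (pure G k) -> (forall A d, (#|` A| < 2)%N -> G A d = 0) ->
  (forall x, x \in A -> x.1 = kcol k /\ (0 < x.2)%N) -> (forall x, x.1 = kcol k -> q x = k) ->
  star k 2 2 (pure G k) (pure G k) q A d = - Linf_sum G A d.
Proof.
move=> k1 rG G0 hA hq.
have sA : (kcol k, 0%N) \notin A by apply: slot0_notin => x /hA[].
have qs : q (kcol k, 0%N) = k by apply: hq.
have qA x : x \in A -> q x = k by move=> /hA[+ _] => /hq.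
have pE (B : {fset label}) d0 : (forall x, x \in B -> q x = k) -> pure G k q B d0 = G B d0.
  by move=> h; rewrite /pure (_ : all _ _)//; apply/allP => x /h ->.
rewrite (starE d rG rG qs sA) /star_sum /Linf_sum [in RHS]big_mkcond -sumrN.
apply: eq_big_seq => J; rewrite fpowersetE => JA.
have qJ x : x \in J -> q x = k by move=> /(fsubsetP JA); apply: qA.
have qI x : x \in A `\` J -> q x = k by rewrite inE => /andP[_]; apply: qA.
have sI := fsubset_notin (fsubsetDl A J) sA.
have odI : od q (A `\` J) = #|` A `\` J| by apply: od_card => x /qI ->.
have odJ : od q J = #|` J| by apply: od_card => x /qJ ->.
rewrite !pE ?odU1// ?qs ?odI ?odJ ?k1; last first.
  by move=> x; rewrite in_fset1U => /orP[/eqP->//|/qI].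
rewrite add1n addn1; case: ifP => hc; last first.
  rewrite oppr0; move/negbT: hc; rewrite negb_and -leqNgt -ltnNge => /orP[hJ|hI].
    by rewrite (G0 J)// ocomp0r scaler0.
  rewrite (G0 (_ |` _)) ?ocomp0l ?scaler0// cardfsU1 sI.
  by rewrite ltnS.
rewrite -scaleNr; congr (_ *: _); rewrite -[RHS]mulN1r -exprS; apply: (@sign_mod2 _ _ _ 1 0).
rewrite /ssign odI k1 in_iv0 ?(@iv_shuffle _ _ _ (kcol k)).
- by rewrite -[absz _]/1%N; clear; lia.
- by move=> x xJ; rewrite qJ//; have [] := hA _ (fsubsetP JA _ xJ).
- by move=> x xI; rewrite qI//; have [] := hA _ (fsubsetP (fsubsetDl A J) _ xI).
- move=> x; rewrite inE => /andP[_ /hA[x1 x2]]; rewrite /lab_lt x1 /=.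
  by case: (kcol k).
Qed.

Lemma Linf_src_sumE (G : forall A d, P A Straight d) (h : fam Wavy) A (W : {fset label}) d :
  regular 2 (pure G KX) -> regular 1 h -> (forall A d, (#|` A| < 2)%N -> G A d = 0) ->
  (forall x, x \in A -> x.1 = Straight /\ (0 < x.2)%N) -> (forall x, x \in W -> x.1 = Wavy) ->
  star KX 1 2 h (pure G KX : fam (kcol KX)) (cdeco KY) (A `|` W) d =
  Linf_src_sum G (fun A d => h (cdeco KY) A d) A W (A `|` W) d.
Proof.
move=> rG rh G0 hA hW; set q := cdeco KY.
pose s : label := (Straight, 0%N).
have sA : s \notin A by apply: slot0_notin => x /hA[].
have sW : s \notin W by apply/negP => /hW.
have sAW : s \notin A `|` W by rewrite inE negb_or sA.
have qs : q s = KX by [].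
have qA x : x \in A -> q x = KX by move=> /hA[x1 _]; rewrite /q /cdeco x1.
have qW x : x \in W -> q x = KY by move=> /hW x1; rewrite /q /cdeco x1.
have dAW : [disjoint A & W]%fset.
  by apply/fdisjointP => x /hA[x1 _]; apply/negP => /hW; rewrite x1.
rewrite (@starE _ P KX 1 2 _ h (pure G KX) q _ 0 d rh rG qs sAW) /star_sum.
rewrite sum_fpowersetU// /Linf_src_sum [in RHS]big_mkcond; apply: eq_big_seq => J; rewrite fpowersetE => JA.
have f0 : fset0 \in fpowerset W by rewrite fpowersetE fsub0set.
rewrite (big_fsetD1 _ f0)/= [X in _ + X]big_seq [X in _ + X]big1 ?addr0; last first.
  move=> L; rewrite !inE fpowersetE => /andP[nL LW].
  have [x xL] : exists x, x \in L by apply/fset0Pn.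
  have qx := qW _ (fsubsetP LW _ xL).
  rewrite /pure (_ : all _ _ = false) ?ocomp0r ?scaler0//.
  by apply/allP => /(_ x); rewrite inE xL orbT qx => /(_ isT).
rewrite fsetU0.
have qJ x : x \in J -> q x = KX by move=> /(fsubsetP JA); apply: qA.
have sJ d0 : pure G KX q J d0 = G J d0.
  by rewrite /pure (_ : all _ _)//; apply/allP => x /qJ ->.
have eAW : (A `|` W) `\` J = (A `\` J) `|` W.
  rewrite fsetDUl; congr (_ `|` _); apply/fsetDidPl; rewrite fdisjoint_sym.
  exact: fdisjointWl dAW.
have dJW : [disjoint A `\` J & W]%fset by apply: fdisjointWl dAW; apply: fsubsetDl.
have odW : od q W = 0%N by rewrite /od big_seq big1// => x /qW ->.
have odI : od q (A `\` J) = #|` A `\` J|.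
  by apply: od_card => x; rewrite inE => /andP[_ /qA ->].
have odJ : od q J = #|` J| by apply: od_card => x /qJ ->.
have sI : s \notin (A `\` J) `|` W.
  by rewrite inE negb_or sW (fsubset_notin (fsubsetDl A J) sA).
rewrite eAW sJ -/s odU1// odU// odI odW odJ qs addn0 fsetUA add1n addn1.
have ivJW : iv q J W = 0%N.
  by rewrite /iv big1// => x _; rewrite big_seq big1// => y /qW ->; rewrite muln0.
case: ifP => hc; last by rewrite (G0 J) ?ocomp0r ?scaler0// ltnNge hc.
congr (_ *: _); apply: signP; rewrite /ssign odU// odI odW in_iv0 ?addn0 ?ivUr//.
  rewrite ivJW (@iv_shuffle _ _ _ Straight).
  - by rewrite add0n addn0 mul1n addnC.
  - by move=> x xJ; rewrite qJ//; have [] := hA _ (fsubsetP JA _ xJ).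
  - by move=> x; rewrite inE => /andP[_ xA]; rewrite qA//; have [] := hA _ xA.
move=> x; rewrite inE => /orP[|/hW x1]; last by rewrite /lab_lt x1.
by rewrite inE => /andP[_ /hA[x1 x2]]; rewrite /lab_lt x1.
Qed.
End StructureSums.

Section Target.
Variable K : fieldType.
Local Notation fam := (fam (LPinf K)).
Implicit Types (q : deco) (A J I : {fset label}) (d e : int) (k l : kind) (n : nat).

Definition phiF : fam Wavy := pure (LPinf_map K) KX.
Definition lamF k : fam Wavy := pure (LPinf_lambda K) k.
Definition ellF : fam Straight := pure (LPinf_ell K) KX.

Lemma phiF_reg : regular 1 phiF.
Proof.
apply: (@pure_reg _ _ _ (@free_interp K LPinf_sig) LPinf_phi KX) => //= m n /andP[_ /eqP->].
by rewrite addn0.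
Qed.
Lemma lamF_reg k : parity_of k = 1%N -> regular 2 (lamF k).
Proof.
move=> k1; apply: (@pure_reg _ _ _ (@free_interp K LPinf_sig) LPinf_lam k) => //= m n.
by move=> /andP[/eqP-> _]; rewrite add0n.
Qed.
Lemma ellF_reg : regular 2 ellF.
Proof.
apply: (@pure_reg _ _ _ (@free_interp K LPinf_sig) LPinf_l KX) => //= m n /andP[_ /eqP->].
by rewrite addn0.
Qed.

Lemma nin_le A c : (nin A c <= #|` A|)%N.
Proof. by rewrite -nin_card; case: c; rewrite ?leq_addr ?leq_addl. Qed.

Lemma nin_gt0 A x : x \in A -> (0 < nin A x.1)%N.
Proof.
by move=> xA; rewrite /nin cardfs_gt0; apply/fset0Pn; exists x; rewrite !inE xA eqxx.
Qed.

Lemma lambda_out A d : (nin A Straight != 0)%N || (#|` A| < 2)%N -> LPinf_lambda K A d = 0.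
Proof.
move=> h; apply: (@ival_out _ _ _ (@free_interp K LPinf_sig) LPinf_lam); rewrite /valid /=; apply/negP => /andP[/andP[/eqP h1 h2] _].
move: h; rewrite h1 /= => h3; move: (leq_trans h2 (nin_le A Wavy)).
by rewrite leqNgt h3.
Qed.

Lemma ell_out A d : (nin A Wavy != 0)%N || (#|` A| < 2)%N -> LPinf_ell K A d = 0.
Proof.
move=> h; apply: (@ival_out _ _ _ (@free_interp K LPinf_sig) LPinf_l); rewrite /valid /=; apply/negP => /andP[/andP[h2 /eqP h1] _].
move: h; rewrite h1 /= => h3; move: (leq_trans h2 (nin_le A Straight)).
by rewrite leqNgt h3.
Qed.

Lemma map_out A d : (nin A Wavy != 0)%N || (nin A Straight == 0)%N -> LPinf_map K A d = 0.
Proof.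
move=> h; apply: (@ival_out _ _ _ (@free_interp K LPinf_sig) LPinf_phi); rewrite /valid /=; apply/negP => /andP[/andP[h2 /eqP h1] _].
by move: h h2; rewrite h1 /= => /eqP ->.
Qed.

Lemma input_F : input phiF (lamF KZ).
Proof.
split.
- exact: phiF_reg.
- exact: lamF_reg.
- by move=> k hk; apply: pure_lacks.
- by move=> k hk; apply: pure_lacks.
- move=> q A d hA; rewrite /phiF /pure; case: allP => // h.
  have [->|[x xA]] := fset_0Vmem A; last by case: (hA _ xA); apply/eqP/h.
  apply: map_out; apply/orP; right; rewrite -leqn0.
  by apply: leq_trans (nin_le _ _) _; rewrite cardfs0.
- by move=> q A d hA; rewrite /lamF /pure; case: ifP => // _; apply: lambda_out; rewrite hA orbT.
Qed.

(** The sign [block_sign] computed from the list of blocks, the last block of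
the partition coming first in the list. *)
Fixpoint bsign (l : seq {fset label}) : nat :=
  if l is J :: l' then
    (\sum_(J' <- l') (#|` J'| * (#|` J| + 1) + shuffle J' J) + bsign l')%N
  else 0%N.

Lemma block_signE m (r : nat) (b : {ffun 'I_m -> 'I_r}) :
  block_sign b = bsign (rev [seq block b a | a <- enum 'I_r]).
Proof.
case: r b => [|r] b.
  rewrite /block_sign big_ord0; have -> : enum 'I_0 = [::] by apply: size0nil; rewrite size_enum_ord.
  by [].
pose Bk (a : nat) := block b (inord a).
pose h a a' := (#|` Bk a| * (#|` Bk a'| + 1) + shuffle (Bk a) (Bk a'))%N.
have -> : [seq block b a | a <- enum 'I_r.+1] = mkseq Bk r.+1.
  rewrite /mkseq -val_enum_ord -map_comp; apply: eq_map => a /=.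
  by rewrite /Bk inord_val.
have -> : block_sign b = (\sum_(a < r.+1) \sum_(a' < r.+1 | (a < a')%N) h a a')%N.
  apply: eq_bigr => a _; apply: eq_bigr => a' _; by rewrite /h /Bk !inord_val.
move: (r.+1) => N; elim: N => [|N IH]; first by rewrite big_ord0.
rewrite /mkseq -addn1 iotaD map_cat rev_cat /= add0n -IH addn1 big_ord_recr /=.
rewrite [X in (_ + X)%N]big1 ?addn0; last first.
  by move=> a' ha; move: ha; rewrite ltnNge -ltnS ltn_ord.
rewrite big_rev big_map (_ : iota 0 N = index_iota 0 N) ?big_mkord; last by rewrite /index_iota subn0.
rewrite -big_split; apply: eq_bigr => a _ /=.
by rewrite big_mkcond big_ord_recr /= -big_mkcond /= ltn_ord addnC.
Qed.
End Target.

(** * Iterated substitution as iterated composition *)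

Lemma subst_nest_sign (K : fieldType) (i s1 s2 b p o : nat) : (s1 + s2 = p)%N ->
  (-1) ^+ (i + s1 + 0 * o + b)%N = (-1) ^+ (p + i + s2 + b)%N :> K.
Proof. by move=> h; apply: (@sign_mod2 _ _ _ s2 0); lia. Qed.

Section IterComp.
Variables (K : fieldType) (P : operad K).
Local Notation fam := (fam P).
Implicit Types (q : deco) (A J I T : {fset label}) (d e : int) (k : kind) (n : nat).

Lemma nest_linear (V W : lmodType K) (g : V -> W) (g0 : g 0 = 0)
    (gD : forall x y, g (x + y) = g x + g y) j A (F : seq {fset label} -> V) :
  g (nest j A F) = nest j A (fun l => g (F l)).
Proof.
have gS (I : Type) (r : seq I) (H : I -> V) : g (\sum_(i <- r) H i) = \sum_(i <- r) g (H i).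
  by elim/big_rec2: _ => // i x y _ <-.
elim: j A F => [|j IH] A F /=; first by case: ifP.
by rewrite gS; apply: eq_bigr => J _; rewrite IH.
Qed.

Variables mp lm : forall A d, P A Wavy d.
Hypothesis rmp : regular 1 (pure mp KX).
Hypothesis rlm : regular 2 (pure lm KU).

Fixpoint iter_comp (Js : seq {fset label}) (D : {fset label}) (d : int) : P D Wavy d :=
  if Js is J :: Js' then
    ocomp Wavy (size Js)
      (iter_comp Js' ((Wavy, size Js) |` (D `\` J)) (d - (1 - #|` J|%:Z)))
      (mp J (1 - #|` J|%:Z))
  else lm D d.

(** Each substitution into a variable u chooses the inputs J of the inserted
operation among those that are left. Every new slot precedes the slots that are
already there, so that the sign of the ordered partition is the only one left. *)
Lemma subst_nest j A T d :
  (forall x, x \in A -> x.1 = Straight) -> (forall x, x \in T -> x.1 = Wavy /\ (j < x.2)%N) ->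
  d = 2 - (od (cdeco KU) (A `|` T))%:Z ->
  subst (pure mp KX) j (pure lm KU) (cdeco KU) (A `|` T) d =
  nest j A (fun l => (-1) ^+ bsign l *: iter_comp l (A `|` T) d).
Proof.
set q := cdeco KU; elim: j A T d => [|j IH] A T d hA hT ed.
  rewrite /= scale1r /pure; case: (fset_0Vmem A) => [A0|[x xA]].
    rewrite A0 fset0U eqxx ifT//; apply/allP => y /hT[y1 _].
    by rewrite /q /cdeco y1.
  have -> : (A == fset0) = false by apply/negP => /eqP A0; rewrite A0 in xA.
  case: allP => // /(_ x); rewrite !inE xA => /(_ isT).
  by rewrite /q /cdeco (hA _ xA).
pose s : label := (Wavy, j.+1).
have sA : s \notin A by apply/negP => /hA.
have sT : s \notin T by apply/negP => /hT[_] /=; rewrite ltnn.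
have sAT : s \notin A `|` T by rewrite inE negb_or sA.
have qs : q s = KU by [].
have dAT : [disjoint A & T]%fset.
  by apply/fdisjointP => x /hA x1; apply/negP => /hT[]; rewrite x1.
have rs := subst_reg j rmp rlm.
rewrite /= (@starE _ _ KU 2 1 _ _ (pure mp KX) q _ j.+1 d rs rmp qs sAT) /star_sum -/s.
rewrite sum_fpowersetU//; apply: eq_big_seq => J; rewrite fpowersetE => JA.
have f0 : fset0 \in fpowerset T by rewrite fpowersetE fsub0set.
rewrite (big_fsetD1 _ f0)/= [X in _ + X]big_seq [X in _ + X]big1 ?addr0; last first.
  move=> L; rewrite !inE fpowersetE => /andP[nL LT].
  have [x xL] : exists x, x \in L by apply/fset0Pn.
  have qx : q x = KU by rewrite /q /cdeco; have [-> _] := hT _ (fsubsetP LT _ xL).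
  rewrite [pure mp KX _ _ _](_ : _ = 0) ?ocomp0r ?scaler0//.
  by apply: (@pure_lacks _ _ _ mp KX KU _ _ _ _ x) => //; rewrite inE xL orbT.
rewrite fsetU0.
have qJ x : x \in J -> q x = KX by move=> /(fsubsetP JA) /hA x1; rewrite /q /cdeco x1.
have pJ d0 : pure mp KX q J d0 = mp J d0.
  by rewrite /pure (_ : all _ _)//; apply/allP => x /qJ ->.
have eAT : (A `|` T) `\` J = (A `\` J) `|` T.
  rewrite fsetDUl; congr (_ `|` _); apply/fsetDidPl; rewrite fdisjoint_sym.
  exact: fdisjointWl dAT.
have eS : s |` ((A `\` J) `|` T) = (A `\` J) `|` (s |` T) by rewrite fsetUCA.
have dJT : [disjoint A `\` J & T]%fset by apply: fdisjointWl dAT; apply: fsubsetDl.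
have okT x : x \in T -> parity_of (q x) = 1%N by move=> /hT[x1 _]; rewrite /q /cdeco x1.
have okA x : x \in A -> parity_of (q x) = 1%N by move=> /hA x1; rewrite /q /cdeco x1.
have okI x : x \in A `\` J -> parity_of (q x) = 1%N by rewrite inE => /andP[_ /okA].
have odI : od q (A `\` J) = #|` A `\` J| by apply: od_card.
have odJ : od q J = #|` J| by apply: od_card => x /qJ ->.
have odA : od q A = (#|` A `\` J| + #|` J|)%N.
  by rewrite -{1}(fsetD_subU JA) odU ?fdisjointDl// odI odJ.
have sI : s \notin (A `\` J) `|` T.
  by rewrite inE negb_or sT (fsubset_notin (fsubsetDl A J) sA).
rewrite eAT pJ odJ eS.
set d' := 2 - _.
have ed' : d' = d - (1 - #|` J|%:Z).
  rewrite /d' ed -eS odU1// !odU// qs odA odI !PoszD; rewrite -[parity_of KU]/1%N; clear; lia.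
rewrite (IH (A `\` J) (s |` T) d') //; last 2 first.
- by move=> x; rewrite inE => /andP[_]; apply: hA.
- by move=> x; rewrite in_fset1U => /orP[/eqP->|/hT[-> /ltnW]].
pose g (x : P (A `\` J `|` (s |` T)) Wavy d') : P (A `|` T) Wavy d :=
  (-1) ^+ ssign KU 1 q s J (A `\` J `|` T) *: ocomp Wavy j.+1 x (mp J (1 - #|` J|%:Z)).
rewrite -/(g _) (@nest_linear _ _ g) /g; last 2 first.
- by rewrite ocomp0l scaler0.
- by move=> x y; rewrite ocompDl scalerDr.
apply: nest_ext => l sl pl; rewrite ocompZl scalerA /= sl ?eAT ?eS -ed'.
congr (_ *: _); rewrite -exprD.
have c1 : (\sum_(J' <- l) #|` J'| = #|` A `\` J|)%N.
  have := parts_sum (fun=> 1%N) pl; rewrite sum1_size => <-.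
  by apply: eq_bigr => J' _; rewrite sum1_size.
have c2 : (\sum_(J' <- l) shuffle J' J = shuffle (A `\` J) J)%N.
  exact: (parts_sum (fun a => \sum_(b <- J) (b.2 < a.2))%N pl).
have dIJ : [disjoint A `\` J & J]%fset := fdisjointDl A J.
have i1 : iv q [fset s] (A `\` J `|` T) = #|` A `\` J|.
  rewrite ivUr// [X in (_ + X)%N]in_iv0; last first.
    by move=> x /hT[x1 x2]; rewrite /lab_lt x1 /= ltnNge ltnW.
  rewrite addn0 /iv big_seq_fset1 qs -odI; apply: eq_big_seq => x.
  rewrite inE => /andP[_ /hA x1]; rewrite /lab_lt x1 /= /q /cdeco x1; by [].
have i2 : iv q J (A `\` J `|` T) = iv q J (A `\` J).
  rewrite ivUr// [X in (_ + X)%N](_ : _ = 0%N) ?addn0// /iv big_seq big1// => x xJ.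
  rewrite big_seq big1// => y /hT[y1 _].
  by rewrite /lab_lt (hA _ (fsubsetP JA _ xJ)) y1 muln0.
have sh (J1 J2 : {fset label}) : J1 `<=` A -> J2 `<=` A -> iv q J1 J2 = shuffle J1 J2.
  move=> h1 h2; apply: (@iv_shuffle _ _ _ Straight) => x hx;
    [have xA := fsubsetP h1 _ hx|have xA := fsubsetP h2 _ hx]; by rewrite (hA _ xA) okA.
have := ivC q dIJ; rewrite odI odJ !sh ?fsubsetDl// => e0.
rewrite /ssign i1 i2 sh ?fsubsetDl// big_split/= c2.
under eq_bigr do rewrite mulnDr muln1.
rewrite big_split/= -big_distrl/= c1.
exact: (subst_nest_sign _ _ _ _ e0).
Qed.

Lemma iter_comp_nil l A d : (forall d, mp fset0 d = 0) -> fset0 \in l -> iter_comp l A d = 0.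
Proof.
move=> mp0; elim: l A d => //= J l IH A d; rewrite inE => /orP[/eqP <-|/IH h].
  by rewrite mp0 ocomp0r.
by rewrite h ocomp0l.
Qed.
End IterComp.

(** * The Taylor coefficients in the resolution of LP *)

Section LPinfInput.
Variable K : fieldType.
Hypothesis charK0 : [pchar K] =i pred0.
Variables (dLP : differential (LPinf K)) (dLPE : LPinf_differential dLP).
Local Notation fam := (fam (LPinf K)).
Implicit Types (q : deco) (A J I T : {fset label}) (d e : int) (k : kind) (n : nat).

Lemma std0r m : std m 0 = labels Straight 1 m.
Proof.
apply/fsetP => -[[] i]; rewrite in_std in_labels /= ?andbF//.
by rewrite addn0 ltnS; case: (leqP i m).
Qed.
Lemma std0l n : std 0 n = labels Wavy 1 n.
Proof.
apply/fsetP => -[[] i]; rewrite in_std in_labels //=.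
by case: i => [|[|i]].
Qed.

Lemma labels_col c i n x : x \in labels c i n -> x.1 = c /\ (i <= x.2)%N.
Proof. by rewrite in_labels => /andP[/eqP -> /andP[]]. Qed.

Lemma od_labels w m : od (cdeco w) (labels Straight 1 m) = m.
Proof.
rewrite -[RHS](card_labels Straight 1); apply: od_card => x /labels_col[x1 _].
by rewrite /cdeco x1.
Qed.

Lemma iter_comp_phi l A d : iter_comp (LPinf_map K) (LPinf_lambda K) l A d = lambda_phi K l A d.
Proof. by elim: l A d => [|J l IH] A d //; rewrite [LHS]/= IH. Qed.

Lemma lambda_phi_nil l A d : fset0 \in l -> lambda_phi K l A d = 0.
Proof.
move=> hl; rewrite -iter_comp_phi; apply: iter_comp_nil => // d0.
apply: map_out; apply/orP; right; rewrite -leqn0.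
by apply: leq_trans (nin_le _ _) _; rewrite cardfs0.
Qed.

(** A map that is not surjective has an empty fibre, on which phi has no
corolla. *)
Lemma target_surj m (k : nat) d : \sum_(b : {ffun 'I_m -> 'I_k} | [forall a, a \in codom b])
      (-1) ^+ block_sign b *:
      lambda_phi K (rev [seq block b a | a <- enum 'I_k]) (labels Straight 1 m) d =
  \sum_(b : {ffun 'I_m -> 'I_k}) (-1) ^+ bsign (rev [seq block b a | a <- enum 'I_k]) *:
      lambda_phi K (rev [seq block b a | a <- enum 'I_k]) (labels Straight 1 m) d.
Proof.
rewrite big_mkcond; apply: eq_bigr => b _; rewrite block_signE.
case: ifP => // /negbT; rewrite negb_forall => /existsP[a ab].
rewrite lambda_phi_nil ?scaler0// mem_rev; apply/mapP; exists a; first by rewrite mem_enum.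
apply/esym/fsetP => x; rewrite inE; apply/negP => /imfsetP[/= i + _].
by rewrite !inE => /eqP e; move/negP: ab; apply; rewrite -e codom_f.
Qed.

(** The sum of all lambda (phi, ..., phi) is exp (V d/dz) lambda at z = 0: it is
the substitution of phi into lambda, divided by k! because the slots of lambda
are interchangeable. The terms with k < 2 vanish since lambda starts in arity 2. *)
Lemma target_exp m d : (0 < m)%N -> d = 2 - m%:Z ->
  kill KZ (expf (field (phiF K) (lamF K KZ)) 2 (lamF K KZ)) (cdeco KY) (labels Straight 1 m) d =
  LPinf_target_sum K m d.
Proof.
move=> m0 ed.
have Gw A d0 x : x \in A -> x.1 = Straight -> LPinf_lambda K A d0 = 0.
  by move=> xA x1; apply: lambda_out; rewrite -lt0n -x1 (nin_gt0 xA).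
rewrite (exp_lam charK0 Gw (@lamF_reg K) (input_F K) (N := m.+1)) ?card_labels// !famE.
set A := labels Straight 1 m.
have AX x : x \in A -> x.1 = Straight by move=> /labels_col[].
have rS n : regular 2 (subst (phiF K) n (pure (LPinf_lambda K) KU)).
  exact: subst_reg (@phiF_reg K) (@lamF_reg K KU erefl).
have kE n : kill KU (subst (phiF K) n (pure (LPinf_lambda K) KU)) (cdeco KY) A d =
    subst (phiF K) n (pure (LPinf_lambda K) KU) (cdeco KU) A d.
  rewrite /kill (_ : has _ _ = false).
    by apply: (reg_ext _ (rS n)) => x /AX x1; rewrite /cdeco x1.
  by apply/negP => /hasP[x /AX x1]; rewrite /cdeco x1.
rewrite /LPinf_target_sum -(big_mkord xpredT (fun n => ((n`!%:R)^-1 *: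
  kill KU (subst (phiF K) n (pure (LPinf_lambda K) KU))) (cdeco KY) A d)).
have s0 : subst (phiF K) 0 (pure (LPinf_lambda K) KU) (cdeco KU) A d = 0.
  have x0 : (Straight, 1%N) \in A by rewrite in_labels /= ?ltnS.
  exact: (pure_lacks (LPinf_lambda K) (k := KU) (l := KX) _ d x0).
have s1 : subst (phiF K) 1 (pure (LPinf_lambda K) KU) (cdeco KU) A d = 0.
  transitivity (star KU 2 1 (0 : fam Wavy) (phiF K : fam (kcol KU)) (cdeco KU) A d); last by rewrite star0l.
  apply: star_eq => J JA s q' d1 d2; rewrite ocomp0l.
  have [e0|[x xI]] := fset_0Vmem (A `\` J).
    rewrite e0 fsetU0 [pure _ _ _ _ _](_ : _ = 0) ?ocomp0l// /pure; case: ifP => // _.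
    by apply: lambda_out; rewrite cardfs1 orbT.
  rewrite [pure _ _ _ _ _](_ : _ = 0) ?ocomp0l//.
  apply: (pure_lacks (LPinf_lambda K) (k := KU) (l := KX) _ _ (_ : x \in _)) => //.
    by rewrite inE xI orbT.
  move: xI; rewrite inE => /andP[_ xA]; rewrite /q' (upd_out _ _ _ xA) ?/cdeco ?AX//.
  exact: freshP.
rewrite big_ltn// big_ltn ?ltnS// !famE !kE s0 s1 !scaler0 !add0r.
apply: eq_big_nat => n /andP[n2 _]; rewrite famE kE; congr (_ *: _).
rewrite target_surj (@nest_block _ m n (fun l => (-1) ^+ bsign l *: lambda_phi K l A d)); last exact: ltnW.
have eA : A `|` fset0 = A := fsetU0 A.
have := @subst_nest _ _ (LPinf_map K) (LPinf_lambda K) (@phiF_reg K) (@lamF_reg K KU erefl) n A fset0 d AX _ _.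
rewrite eA => -> //; last by rewrite od_labels.
Qed.

Lemma phiF_coloured : coloured KY (phiF K).
Proof.
move=> q A d x xA; rewrite /phiF /pure; case: allP => // /(_ _ xA) /eqP ->.
rewrite /cdeco; case e: x.1 => // _.
by apply: map_out; rewrite -lt0n -e (nin_gt0 xA).
Qed.

Lemma ellF_coloured w : coloured w (ellF K).
Proof.
move=> q A d x xA; rewrite /ellF /pure; case: allP => // /(_ _ xA) /eqP ->.
rewrite /cdeco; case e: x.1 => // _.
by apply: ell_out; rewrite -lt0n -e (nin_gt0 xA).
Qed.

Lemma lamF_coloured : coloured KZ (lamF K KZ).
Proof.
move=> q A d x xA; rewrite /lamF /pure; case: allP => // /(_ _ xA) /eqP ->.
rewrite /cdeco; case e: x.1 => // _.
by apply: lambda_out; rewrite -lt0n -e (nin_gt0 xA).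
Qed.

Lemma lambda_straight B d0 y : y \in B -> y.1 = Straight -> LPinf_lambda K B d0 = 0.
Proof. by move=> yB y1; apply: lambda_out; rewrite -lt0n -y1 (nin_gt0 yB). Qed.

Lemma exp_avoid (B : label -> kind -> Prop) : avoid B (phiF K) ->
  avoid B (kill KZ (expf (field (phiF K) (lamF K KZ)) 2 (lamF K KZ))).
Proof.
move=> aphi q A d x xA qx.
rewrite (exp_lam charK0 lambda_straight (@lamF_reg K) (input_F K) (N := (#|` A|).+1))//.
rewrite !famE big1// => n _.
rewrite famE /kill; case: hasP => [_|hU]; first by rewrite scaler0.
suff -> : subst (phiF K) n (pure (LPinf_lambda K) KU) q A d = 0 by rewrite scaler0.
have av : avoid (fun x k => B x k /\ k <> KU) (subst (phiF K) n (pure (LPinf_lambda K) KU)).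
  elim: (nat_of_ord n) => [|i IH] /=; last first.
    by apply: avoid_star => // q0 A0 d0 y yA [qy _]; apply: aphi qy.
  move=> q0 A0 d0 y yA [_ qy].
  exact: (@pure_lacks _ _ _ (LPinf_lambda K) KU (q0 y) qy q0 A0 d0 y yA erefl).
by apply: (av q A d x xA); split=> // qU; apply: hU; exists x; [exact: xA|rewrite qU].
Qed.

Lemma ellF_lacks k : k <> KX -> lacks k (ellF K).
Proof. by move=> hk; apply: pure_lacks. Qed.

Lemma ell_small A d : (#|` A| < 2)%N -> LPinf_ell K A d = 0.
Proof. by move=> h; apply: ell_out; rewrite h orbT. Qed.
Lemma lambda_small A d : (#|` A| < 2)%N -> LPinf_lambda K A d = 0.
Proof. by move=> h; apply: lambda_out; rewrite h orbT. Qed.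

Lemma Linf_sum_small c (G : forall A d, LPinf K A c d) A d : (#|` A| < 2)%N -> Linf_sum G A d = 0.
Proof.
move=> hA; rewrite /Linf_sum big_seq_cond big1// => J /andP[].
rewrite fpowersetE => /fsubset_leq_card JA /andP[J2 _].
by move: (leq_trans J2 JA); rewrite leqNgt hA.
Qed.

Lemma pure_on (c : colour) (G : forall A d, LPinf K A c d) k q A d :
  (forall x, x \in A -> q x = k) -> pure G k q A d = G A d.
Proof. by move=> h; rewrite /pure ifT//; apply/allP => x /h ->. Qed.

(** The three equations are those of the differential, translated to insertions
and extended from standard inputs to all inputs. *)
Lemma dg_input_F : dg_input dLP (phiF K) (lamF K KZ) (ellF K).
Proof.
case: dLPE => dl dlam dphi.
have rphi := @phiF_reg K; have rl := @ellF_reg K; have rlam := @lamF_reg K KZ erefl.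
have SX m x : x \in labels Straight 1 m -> cdeco KY x = KX.
  by move=> /labels_col[x1 _]; rewrite /cdeco x1.
have WZ m x : x \in labels Wavy 1 m -> cdeco KZ x = KZ.
  by move=> /labels_col[x1 _]; rewrite /cdeco x1.
split.
- exact: input_F.
- exact: ellF_reg.
- exact: ellF_lacks.
- apply: (@fam_std_ext _ _ KY 3).
  + exact: (fdiff_reg dLP rl).
  + exact/regularN/(@star_regular _ _ KX 2 2 _ _ _ rl rl).
  + exact/fdiff_avoid/ellF_coloured.
  + by apply: avoidN; apply: avoid_star; apply: ellF_coloured.
  move=> m [|n] A d; last first.
    have yA : (Wavy, m.+1) \in A by rewrite in_std /= leqnn addnS ltnS leq_addr.
    have fY : lacks KY (ellF K) by apply: ellF_lacks.
    have z1 := fdiff_avoid dLP fY; have z2 := avoidN (avoid_star (k := KX) 2 2 fY fY).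
    by rewrite (z1 _ _ _ _ yA erefl); apply/esym/(z2 _ _ _ _ yA erefl).
  rewrite /d /A std0r od_labels.
  have -> : 3 - m%:Z = 2 - m%:Z + 1 :> int by clear; lia.
  rewrite fdiffE famN (@Linf_sumE K (LPinf K) KX (LPinf_ell K) _ _ _ erefl rl) ?opprK//; last 3 first.
  + by move=> *; apply: ell_small.
  + by move=> x /labels_col[].
  + by move=> x x1; rewrite /cdeco x1.
  rewrite /ellF pure_on; last exact: SX.
  case: (leqP 2 m) => m2; first by rewrite dl.
  by rewrite ell_small ?card_labels// dmap0 Linf_sum_small ?card_labels.
- apply: (@fam_std_ext _ _ KZ 3).
  + exact: (fdiff_reg dLP rlam).
  + exact/regularN/(@star_regular _ _ KZ 2 2 _ _ _ rlam rlam).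
  + exact/fdiff_avoid/lamF_coloured.
  + by apply: avoidN; apply: avoid_star; apply: lamF_coloured.
  move=> [|m] n A d; last first.
    have yA : (Straight, 1%N) \in A by rewrite in_std.
    have fX : lacks KX (lamF K KZ) by apply: pure_lacks.
    have z1 := fdiff_avoid dLP fX; have z2 := avoidN (avoid_star (k := KZ) 2 2 fX fX).
    by rewrite (z1 _ _ _ _ yA erefl); apply/esym/(z2 _ _ _ _ yA erefl).
  rewrite /d /A std0l.
  have -> : od (cdeco KZ) (labels Wavy 1 n) = n.
    by rewrite -[RHS](card_labels Wavy 1); apply: od_card => x /WZ ->.
  have -> : 3 - n%:Z = 2 - n%:Z + 1 :> int by clear; lia.
  rewrite fdiffE famN (@Linf_sumE K (LPinf K) KZ (LPinf_lambda K) _ _ _ erefl rlam) ?opprK//; last 3 first.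
  + by move=> *; apply: lambda_small.
  + by move=> x /labels_col[].
  + by move=> x x1; rewrite /cdeco x1.
  rewrite /lamF pure_on; last exact: WZ.
  case: (leqP 2 n) => n2; first by rewrite dlam.
  by rewrite lambda_small ?card_labels// dmap0 Linf_sum_small ?card_labels.
- have rV := field_reg (input_F K).
  apply: (@fam_std_ext _ _ KY 2).
  + exact: (fdiff_reg dLP rphi).
  + apply: regularB; first exact: (@star_regular _ _ KX 1 2 _ _ _ rphi rl).
    apply: kill_reg; exact: (expf_reg (input_F K) rlam).
  + exact/fdiff_avoid/phiF_coloured.
  + apply: avoidD; last exact/avoidN/exp_avoid/phiF_coloured.
    by apply: avoid_star; [apply: phiF_coloured|apply: ellF_coloured].
  move=> m [|n] A d; last first.
    have yA : (Wavy, m.+1) \in A by rewrite in_std /= leqnn addnS ltnS leq_addr.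
    have fY : lacks KY (phiF K) by apply: pure_lacks.
    have z1 := fdiff_avoid dLP fY.
    have z2 := avoid_star (k := KX) 1 2 fY (ellF_lacks (k := KY) _).
    have z3 := avoidD (z2 _) (avoidN (exp_avoid fY)).
    by rewrite (z1 _ _ _ _ yA erefl); apply/esym/(z3 _ _ _ _ _ yA erefl).
  rewrite /d /A std0r od_labels.
  have e1 : 2 - m%:Z = 1 - m%:Z + 1 :> int by clear; lia.
  case: (posnP m) => m0.
    have A0 : labels Straight 1 m = fset0.
      by apply/eqP; rewrite -cardfs_eq0 card_labels m0.
    have p0 d0 : phiF K (cdeco KY) fset0 d0 = 0.
      by apply: (in_phi0 (input_F K)) => x; rewrite inE.
    rewrite A0 e1 fdiffE p0 dmap0; apply/esym; rewrite famB.
    have -> : star KX 1 2 (phiF K) (ellF K : fam (kcol KX)) (cdeco KY) fset0 (1 - m%:Z + 1) = 0.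
      transitivity (star KX 1 2 (0 : fam Wavy) (ellF K : fam (kcol KX)) (cdeco KY) fset0 (1 - m%:Z + 1));
        last by rewrite star0l.
      apply: star_eq => J; rewrite fsubset0 => /eqP -> s q' d1 d2.
      rewrite (_ : ellF K q' fset0 d2 = 0) ?ocomp0r// /ellF /pure.
      by rewrite ell_small ?if_same// cardfs0.
    rewrite sub0r (_ : kill KZ _ _ _ _ = 0) ?oppr0// /kill; case: has => //.
    rewrite /expf big1// => i _.
    rewrite (flow_small (input_F K) (M := 0)) ?scaler0 ?cardfs0// => q0 B0 d0 hB.
    by apply: (in_lam1 (input_F K)); rewrite ltnW// ltnS.
  rewrite famB (target_exp m0 erefl) e1 fdiffE.
  rewrite {1}/phiF pure_on; last exact: SX.
  rewrite dphi//; congr (_ - _).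
  have := @Linf_src_sumE K (LPinf K) (LPinf_ell K) (phiF K) (labels Straight 1 m) fset0 (1 - m%:Z + 1) rl rphi.
  rewrite fsetU0 => -> //; last 2 first.
  + by move=> *; apply: ell_small.
  + by move=> x /labels_col[].
  rewrite /Linf_src_sum big_seq_cond [RHS]big_seq_cond; apply: eq_bigr => J /andP[].
  rewrite fpowersetE => JA _; congr (_ *: ocomp _ _ _ _).
  rewrite /phiF pure_on// => x; rewrite fsetU0 in_fset1U inE => /orP[/eqP->//|/andP[_]].
  exact: SX.
Qed.
End LPinfInput.

(** * The morphism, and its compatibility with the differentials *)

Section ActionSum.
Variables (K : fieldType) (P : operad K).
Local Notation fam := (fam P).
Implicit Types (q : deco) (A J I V W : {fset label}) (d e : int) (k : kind) (n : nat).

(** The remaining sum in the differential of f is the insertion of f into its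
own wavy slots; terms with no straight inputs on one of the two sides vanish. *)
Lemma action_sumE (h : fam Wavy) A W d : regular 1 h ->
  (forall q A d, (forall x, x \in A -> q x <> KX) -> h q A d = 0) ->
  (forall x, x \in A -> x.1 = Straight /\ (0 < x.2)%N) ->
  (forall x, x \in W -> x.1 = Wavy /\ (0 < x.2)%N) ->
  star KY 1 1 h (h : fam (kcol KY)) (cdeco KY) (A `|` W) d =
  \sum_(J <- fpowerset A | (1 <= #|` J|)%N && (1 <= #|` A `\` J|)%N)
  \sum_(V <- fpowerset W)
    (-1) ^+ (#|` J| * (#|` A `\` J| + 1) + shuffle J (A `\` J)) *:
    ocomp Wavy 0
      (h (cdeco KY) (J `|` ((Wavy, 0%N) |` V)) (1 - #|` J|%:Z))
      (h (cdeco KY) ((A `\` J) `|` (W `\` V)) (1 - #|` A `\` J|%:Z)).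
Proof.
move=> rh hX hA hW; set q := cdeco KY.
pose s : label := (Wavy, 0%N).
have sA : s \notin A by apply/negP => /hA[].
have sW : s \notin W by apply: slot0_notin => x /hW[].
have sAW : s \notin A `|` W by rewrite inE negb_or sA.
have qs : q s = KY by [].
have qA x : x \in A -> q x = KX by move=> /hA[x1 _]; rewrite /q /cdeco x1.
have qW x : x \in W -> q x = KY by move=> /hW[x1 _]; rewrite /q /cdeco x1.
have dAW : [disjoint A & W]%fset.
  by apply/fdisjointP => x /hA[x1 _]; apply/negP => /hW[]; rewrite x1.
rewrite (@starE _ P KY 1 1 _ h h q _ 0 d rh rh qs sAW) /star_sum -/s.
rewrite sum_fpowersetU// [LHS]sum_fpowersetD [in RHS]big_mkcond.
apply: eq_big_seq => J; rewrite fpowersetE => JA.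
have qJ x : x \in J -> q x = KX by move=> /(fsubsetP JA); apply: qA.
have qI x : x \in A `\` J -> q x = KX by rewrite inE => /andP[_]; apply: qA.
have odI : od q (A `\` J) = #|` A `\` J| by apply: od_card => x /qI ->.
have odJ : od q J = #|` J| by apply: od_card => x /qJ ->.
rewrite sum_fpowersetD.
have term V : V `<=` W ->
   let M := (A `\` J) `|` (W `\` V) in
   [/\ (A `|` W) `\` M = J `|` V, od q M = #|` A `\` J|, od q (s |` (J `|` V)) = #|` J|
     & odd (ssign KY 1 q s M (J `|` V)) = odd (#|` J| * (#|` A `\` J| + 1) + shuffle J (A `\` J))].
  move=> VW M.
  have qV x : x \in V -> q x = KY by move=> /(fsubsetP VW); apply: qW.
  have qWV x : x \in W `\` V -> q x = KY by rewrite inE => /andP[_]; apply: qW.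
  have dJV : [disjoint J & V]%fset by apply: fdisjointWl JA _; apply: fdisjointWr dAW.
  have dIV : [disjoint A `\` J & W `\` V]%fset.
    by apply: fdisjointWl (fsubsetDl A J) _; apply: fdisjointWr dAW; apply: fsubsetDl.
  have od0W B : (forall x, x \in B -> q x = KY) -> od q B = 0%N.
    by move=> hB; rewrite /od big_seq big1// => x /hB ->.
  have iv0r B C : (forall x, x \in B -> q x = KY) -> iv q C B = 0%N.
    by move=> hB; rewrite /iv big1// => x _; rewrite big_seq big1// => y /hB ->; rewrite muln0.
  have iv0l B C : (forall x, x \in B -> q x = KY) -> iv q B C = 0%N.
    by move=> hB; rewrite /iv big_seq big1// => x /hB ->; rewrite big1.
  have sJV : s \notin J `|` V.
    by rewrite inE negb_or (fsubset_notin JA sA) (fsubset_notin VW sW).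
  split.
  - apply/fsetP => x; rewrite /M !inE.
    have := fdisjointP dAW x; move: (fsubsetP JA x) (fsubsetP VW x).
    by fset_cases.
  - by rewrite /M odU// odI (od0W _ qWV) addn0.
  - by rewrite odU1// qs odU// odJ (od0W _ qV) addn0.
  rewrite /ssign odU// odJ (od0W _ qV) addn0 (iv0l [fset s]); last by move=> x; rewrite inE => /eqP ->.
  rewrite /M ivUl// (iv0l _ _ qWV) addn0 ivUr// (iv0r _ _ qV) addn0 add0n.
  have dIJ : [disjoint A `\` J & J]%fset := fdisjointDl A J.
  have := ivC q dIJ; rewrite odI odJ => e0.
  rewrite -(@iv_shuffle q J (A `\` J) Straight).
  - have -> : absz (1 - (parity_of KY)%:Z) = 1%N by [].
    rewrite mul1n mulnDr muln1 mulnC -e0; clear; lia.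
  - by move=> x xJ; rewrite qJ//; have [] := hA _ (fsubsetP JA _ xJ).
  - by move=> x xI; rewrite qI//; have [] := hA _ (fsubsetP (fsubsetDl A J) _ xI).
case: ifP => hc.
  apply: eq_big_seq => V; rewrite fpowersetE => VW; have [t1 t2 t3 t4] := term V VW.
  rewrite t1 t2 t3; congr (_ *: _); first exact: signP.
  by rewrite fsetUCA.
rewrite big_seq big1// => V; rewrite fpowersetE => VW; have [t1 t2 t3 t4] := term V VW.
rewrite t1; move/negbT: hc; rewrite negb_and -!leqNgt !leqn0 !cardfs_eq0 => /orP[/eqP J0|/eqP I0].
  rewrite (hX _ (s |` (J `|` V))) ?ocomp0l ?scaler0// J0 fset0U => x.
  by rewrite in_fset1U => /orP[/eqP->|/(fsubsetP VW) /qW ->]; rewrite ?qs.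
rewrite [X in ocomp _ _ _ X](hX _ _) ?ocomp0r ?scaler0// I0 fset0U => x.
by rewrite inE => /andP[_ /qW ->].
Qed.
End ActionSum.

Section DgGens.
Variables (K : fieldType) (S : signature) (R : relators K S) (P : operad K).
Variables (dO : differential (presented R)) (dP : differential P).
Variable h : morphism (presented R) P.

(** Both sides are derivations along the morphism, so it suffices to compare
them on the generators. *)
Lemma dg_morphism_gens :
  (forall g A d, mmap h (dmap dO (gen_interp R g A d)) = dmap dP (mmap h (gen_interp R g A d))) ->
  dg_morphism dO dP h.
Proof.
move=> hg A c d x; rewrite -[x]reprK -/(qclass R _) -eval_gen.
move: (repr x) => {x}; elim=> {A c d} [A c d|A c d e1 IH1 e2 IH2|A c d k e1 IH1|c0 z|A B D c0 c' z d1 d2 d0 e1 IH1 e2 IH2|f A D c0 d0 e1 IH1|g B d0].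
- by rewrite [eval _ _]/= dmap0 !mmap0 dmap0.
- by rewrite [eval _ _]/= dmapD !mmapD dmapD IH1 IH2.
- by rewrite [eval _ _]/= dmapZ !mmapZ dmapZ IH1.
- by rewrite [eval _ _]/= dmap_unit mmap0 mmap_unit dmap_unit.
- rewrite -[eval _ _]/(ocomp c' z (eval (gen_interp R) e1) (eval (gen_interp R) e2)).
  by rewrite dmap_comp mmapD mmapZ !mmap_comp dmap_comp IH1 IH2.
- rewrite -[eval _ _]/(orel f (eval (gen_interp R) e1)).
  by rewrite dmap_rel !mmap_rel dmap_rel IH1.
- exact: hg.
Qed.
End DgGens.

Section JBinf.
Variable K : fieldType.
Local Notation f := (solution (phiF K) (lamF K KZ)).
Let rf : regular 1 f := solution_reg (input_F K).

Definition JBf A d : LPinf K A Wavy d := f (cdeco KY) A d.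

Lemma od_cdeco A : od (cdeco KY) A = nin A Straight.
Proof.
rewrite /nin -[RHS]addn0.
have -> : A = [fset x in A | x.1 == Straight] `|` [fset x in A | x.1 == Wavy].
  by apply/fsetP => -[[] z]; rewrite !inE /= ?andbT ?andbF ?orbF.
rewrite odU; last first.
  by apply/fdisjointP => -[[] z]; rewrite !inE /= ?andbF.
congr addn.
  rewrite od_card; last by move=> x; rewrite !inE => /andP[_ /eqP x1]; rewrite /cdeco x1.
  congr #|` _|; apply/fsetP => -[[] z]; by rewrite !inE /= ?andbT ?andbF ?orbF.
rewrite /od big_seq big1// => x; rewrite !inE => /andP[_ /eqP x1].
by rewrite /cdeco x1.
Qed.

Lemma nin0 A c : nin A c = 0%N -> forall x, x \in A -> x.1 <> c.
Proof. by move=> h x xA x1; have := nin_gt0 xA; rewrite x1 h. Qed.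

Lemma nin_rel g A D c : relabels g A D -> nin D c = nin A c.
Proof.
move=> [gi ->]; rewrite /nin.
have -> : [fset x in rename g @` A | x.1 == c] = rename g @` [fset x in A | x.1 == c].
  apply/fsetP => y; apply/idP/idP.
    rewrite !inE => /andP[/imfsetP[x /= xA ->] xc].
    by apply/imfsetP; exists x => //=; rewrite !inE /= xA.
  case/imfsetP => x /=; rewrite !inE => /andP[xA xc] ->.
  by apply/andP; split=> //; apply/imfsetP; exists x.
rewrite card_in_imfset// => x y; rewrite !inE => /andP[xA _] /andP[yA _]; exact: gi.
Qed.

(** The generators f go to the Taylor coefficients of [solution]. *)
Definition JB_interp : interp HSinf_sig (LPinf K).
Proof.
refine (@Interp K HSinf_sig (LPinf K)
  (fun g => match g return forall A d, LPinf K A (gout (g : gen HSinf_sig)) d with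
            | HSinf_l => @LPinf_ell K
            | HSinf_f => @JBf
            end) _ _).
- case=> A d nv.
  + apply: (@ival_out _ _ _ (@free_interp K LPinf_sig) LPinf_l).
    exact: nv.
  + rewrite /JBf; case: (posnP (nin A Straight)) => h0.
      apply: (solution_noX (input_F K)) => x xA; rewrite /cdeco.
      by have := nin0 h0 xA; case: x.1.
    apply: (reg_hom rf); apply: contra nv => /eqP ->.
    by rewrite /valid /= h0 od_cdeco /=.
- move=> g [] A D d rg.
  + case: (posnP (nin A Wavy)) => [h0|h0]; last first.
      rewrite !ell_out ?(nin_rel _ rg) -?lt0n ?h0//.
      by rewrite orel0 scaler0.
    rewrite (ival_rel (@free_interp K LPinf_sig) LPinf_l d rg); congr (_ ^+ _ *: _).
    apply: eq_big_seq => x xA; apply: eq_big_seq => y yA /=.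
    by have := nin0 h0 xA; case: x.1.
  + rewrite /JBf (reg_rel rf d rg (q' := cdeco KY))//; congr (_ ^+ _ *: _).
    apply: eq_big_seq => x xA; apply: eq_big_seq => y yA /=.
    case: x y {xA yA} => [[] i] [[] j]; rewrite /cdeco /lab_lt /parity_of /= ?mul1n ?muln0 ?mul0n//.
Defined.

Definition JBinf : morphism (HSinf K) (LPinf K) := Defs.lift (no_relators JB_interp).

Lemma JBinf_op A d : mmap JBinf (HSinf_op K A d) = JBf A d.
Proof. exact: (lift_gen (no_relators JB_interp) (HSinf_f : gen HSinf_sig)). Qed.
Lemma JBinf_ell A d : mmap JBinf (HSinf_ell K A d) = LPinf_ell K A d.
Proof. exact: (lift_gen (no_relators JB_interp) (HSinf_l : gen HSinf_sig)). Qed.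
End JBinf.

Section Coloured.
Variables (K : fieldType) (S : signature) (P : operad K) (I : interp S P) (g : gen S).
Hypothesis skew_g : forall c, gskew g c = (c == Straight).

(** A generator that is skewsymmetric in straight inputs and symmetric in wavy
ones, as a function of x and y. *)
Definition corolla : fam P (gout g) := fun q A d =>
  if all (fun x => q x == cdeco KY x) A then I g A d else 0.

Lemma corolla_cdeco A d : corolla (cdeco KY) A d = I g A d.
Proof. by rewrite /corolla; case: allP => // -[] x _. Qed.

Lemma corolla_coloured : coloured KY corolla.
Proof.
move=> q A d x xA hx; rewrite /corolla; case: allP => // h; case: hx; apply/eqP; exact: h.
Qed.

Lemma corolla_reg e : (forall m n, gok g m n -> gdeg g m n = e - m%:Z) -> regular e corolla.
Proof.
move=> he; split.
- move=> q A d hd; rewrite /corolla; case: allP => // h.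
  have oq : od q A = nin A Straight.
    by rewrite -od_cdeco; apply: od_ext => x /h /eqP.
  apply: ival_out; apply: contra hd => /andP[ok /eqP ->].
  by rewrite (he _ _ ok) oq.
- move=> f q q' A D d rf hq; rewrite /corolla.
  have -> : all (fun x => q' x == cdeco KY x) D = all (fun x => q x == cdeco KY x) A.
    case: rf => _ ->; apply/allP/allP => h x.
      by move=> xA; rewrite -(hq x xA); apply: (h (rename f x)); apply/imfsetP; exists x.
    by case/imfsetP => y /= yA ->; rewrite hq//; apply: h.
  case: allP => h; last by rewrite orel0 scaler0.
  rewrite ival_rel//; congr (_ ^+ _ *: _).
  apply: eq_big_seq => x xA; apply: eq_big_seq => y yA.
  rewrite skew_g (eqP (h x xA)) (eqP (h y yA)).
  by case: x y {xA yA} => [[] i] [[] j]; rewrite /cdeco /lab_lt /parity_of /= ?mul1n ?muln0 ?mul0n.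
Qed.
End Coloured.

Section JBdg.
Variable K : fieldType.
Hypothesis charK0 : [pchar K] =i pred0.
Variables (dHS : differential (HSinf K)) (dHSE : HSinf_differential dHS).
Variables (dLP : differential (LPinf K)) (dLPE : LPinf_differential dLP).
Local Notation f := (solution (phiF K) (lamF K KZ)).
Let rf : regular 1 f := solution_reg (input_F K).

Lemma JBinf_src A W D d :
  mmap (JBinf K) (Linf_src_sum (HSinf_ell K) (HSinf_op K) A W D d) =
  Linf_src_sum (LPinf_ell K) (@JBf K) A W D d.
Proof.
rewrite mmap_sum; apply: eq_bigr => J _.
by rewrite mmapZ mmap_comp JBinf_op JBinf_ell.
Qed.

Lemma JBinf_action A W d :
  mmap (JBinf K) (HSinf_action_sum K A W d) =
  \sum_(J <- fpowerset A | (1 <= #|` J|)%N && (1 <= #|` A `\` J|)%N)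
  \sum_(V <- fpowerset W)
    (-1) ^+ (#|` J| * (#|` A `\` J| + 1) + shuffle J (A `\` J)) *:
    ocomp Wavy 0
      (JBf K (J `|` ((Wavy, 0%N) |` V)) (1 - #|` J|%:Z))
      (JBf K ((A `\` J) `|` (W `\` V)) (1 - #|` A `\` J|%:Z)).
Proof.
rewrite mmap_sum; apply: eq_bigr => J _; rewrite mmap_sum; apply: eq_bigr => V _.
by rewrite mmapZ mmap_comp !JBinf_op.
Qed.

Lemma JBinf_Linf A d :
  mmap (JBinf K) (Linf_sum (HSinf_ell K) A d) = Linf_sum (LPinf_ell K) A d.
Proof.
rewrite mmap_sum; apply: eq_bigr => J _.
by rewrite mmapZ mmap_comp !JBinf_ell.
Qed.

Lemma fdiff_f : fdiff dLP f =
  star KX 1 2 f (ellF K : fam (LPinf K) (kcol KX)) + star KY 1 1 f (f : fam (LPinf K) (kcol KY)).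
Proof.
have := defect0 (dg_input_F charK0 dLPE); rewrite /defect => h.
by apply/eqP; rewrite -subr_eq0 h.
Qed.

Lemma JBinf_dg_op A d :
  mmap (JBinf K) (dmap dHS (HSinf_op K A d)) = dmap dLP (mmap (JBinf K) (HSinf_op K A d)).
Proof.
pose c := corolla (free_interp K) (HSinf_f : gen HSinf_sig).
have rc : regular 1 c by apply: corolla_reg => // -[].
have cc : coloured KY c by apply: corolla_coloured.
suff: fmap (JBinf K) (fdiff dHS c) = fdiff dLP (fmap (JBinf K) c).
  move/(congr1 (fun a : fam (LPinf K) Wavy => a (cdeco KY) A (d + 1))).
  by rewrite fdiffE /fmap fdiffE /c corolla_cdeco.
apply: (@fam_std_ext _ _ KY 2).
- by apply: fmap_reg; apply: (@fdiff_reg _ _ _ _ 1).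
- by apply: (@fdiff_reg _ _ _ _ 1); apply: fmap_reg.
- by move=> q B d0 x xB hx; rewrite /fmap (fdiff_avoid dHS cc _ xB)// mmap0.
- apply: fdiff_avoid => q B d0 x xB hx; by rewrite /fmap (cc _ _ _ _ xB)// mmap0.
move=> m n B d0; have [nm nn] := nin_std m n; rewrite /d0 od_cdeco nm {d0}.
have -> : 2 - m%:Z = (1 - m%:Z) + 1 :> int by clear; lia.
rewrite fdiffE /fmap fdiffE /c corolla_cdeco.
(* without straight inputs both sides vanish *)
case: (posnP m) => m0.
  have -> : free_interp K (HSinf_f : gen HSinf_sig) B (1 - m%:Z) = 0.
    by apply: ival_out; rewrite /valid /= nm m0.
  by rewrite dmap0 !mmap0 dmap0.
have := (dHSE.2 m n m0); rewrite -/(std m n) -/B /HSinf_op => ->.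
rewrite mmapD JBinf_src JBinf_action [X in dmap _ X]JBinf_op /JBf -fdiffE fdiff_f famD.
congr (_ + _).
  rewrite Linf_src_sumE//; [exact: ellF_reg|exact: ell_small| |].
  - by move=> x; rewrite in_labels => /andP[/eqP -> /andP[h _]].
  - by move=> x; rewrite in_labels => /andP[/eqP -> _].
rewrite action_sumE//; [exact: solution_noX (input_F K)| |].
- by move=> x; rewrite in_labels => /andP[/eqP -> /andP[h _]].
- move=> x; rewrite in_labels => /andP[/eqP -> /andP[h _]]; split=> //; exact: leq_ltn_trans h.
Qed.

Lemma JBinf_dg_ell A d :
  mmap (JBinf K) (dmap dHS (HSinf_ell K A d)) = dmap dLP (mmap (JBinf K) (HSinf_ell K A d)).
Proof.
pose c := corolla (free_interp K) (HSinf_l : gen HSinf_sig).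
have rc : regular 2 c by apply: corolla_reg => // -[].
have cc : coloured KY c by apply: corolla_coloured.
suff: fmap (JBinf K) (fdiff dHS c) = fdiff dLP (fmap (JBinf K) c).
  move/(congr1 (fun a : fam (LPinf K) Straight => a (cdeco KY) A (d + 1))).
  by rewrite fdiffE /fmap fdiffE /c corolla_cdeco.
apply: (@fam_std_ext _ _ KY 3).
- by apply: fmap_reg; apply: (@fdiff_reg _ _ _ _ 2).
- by apply: (@fdiff_reg _ _ _ _ 2); apply: fmap_reg.
- by move=> q B d0 x xB hx; rewrite /fmap (fdiff_avoid dHS cc _ xB)// mmap0.
- apply: fdiff_avoid => q B d0 x xB hx; by rewrite /fmap (cc _ _ _ _ xB)// mmap0.
move=> m n B d0; have [nm nn] := nin_std m n; rewrite /d0 od_cdeco nm {d0}.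
have -> : 3 - m%:Z = (2 - m%:Z) + 1 :> int by clear; lia.
rewrite fdiffE /fmap fdiffE /c corolla_cdeco.
case: (boolP ((1 < m)%N && (n == 0)%N)) => [/andP[m1 /eqP n0]|hmn].
  rewrite -[free_interp K _ _ _]/(HSinf_ell K B (2 - m%:Z)) JBinf_ell.
  rewrite /B n0 std0r dHSE.1//; case: dLPE => -> // _ _.
  exact: JBinf_Linf.
have -> : free_interp K (HSinf_l : gen HSinf_sig) B (2 - m%:Z) = 0.
  by apply: ival_out; rewrite /valid /= nm nn (negbTE hmn).
by rewrite dmap0 !mmap0 dmap0.
Qed.

Lemma JBinf_dg : dg_morphism dHS dLP (JBinf K).
Proof. by apply: dg_morphism_gens => -[] A d; [exact: JBinf_dg_ell|exact: JBinf_dg_op]. Qed.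
End JBdg.

(** * Naturality, binary brackets and Bernoulli numbers *)

Section Naturality.
Variables (K : fieldType) (O P : operad K) (h : morphism O P).

Lemma fmap0 c : fmap h (0 : fam O c) = 0.
Proof. by apply: fam_ext => q A d; rewrite /fmap mmap0. Qed.

Lemma fmapB c (a b : fam O c) : fmap h (a - b) = fmap h a - fmap h b.
Proof. by rewrite -scaleN1r fmapD fmapZ scaleN1r. Qed.

Lemma fmap_kill l c (a : fam O c) : fmap h (kill l a) = kill l (fmap h a).
Proof. by apply: fam_ext => q A d; rewrite /fmap /kill; case: ifP => _; rewrite ?mmap0. Qed.

Lemma fmap_unitf cc k : fmap h (unitf O cc k) = unitf P cc k.
Proof.
apply: fam_ext => q A d; rewrite /fmap /unitf mmap_sum; apply: eq_bigr => x _.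
by rewrite mmap_comp !mmap_unit.
Qed.

Lemma fmap_flow V e n c (a : fam O c) : fmap h (flow V e n a) = flow (fmap h V) e n (fmap h a).
Proof. by elim: n => //= n IH; rewrite fmap_star IH. Qed.

Lemma fmap_lacks k c (a : fam O c) : lacks k a -> lacks k (fmap h a).
Proof. by move=> fa q A d x xA qx; rewrite /fmap (fa _ _ _ _ xA)// mmap0. Qed.

Lemma input_fmap phi lam : input phi lam -> input (fmap h phi) (fmap h lam).
Proof.
move=> H; split.
- exact/fmap_reg/(in_rphi H).
- exact/fmap_reg/(in_rlam H).
- by move=> k hk; apply/fmap_lacks/(in_phi_lacks H).
- by move=> k hk; apply/fmap_lacks/(in_lam_lacks H).
- by move=> q A d hA; rewrite /fmap (in_phi0 H)// mmap0.
- by move=> q A d hA; rewrite /fmap (in_lam1 H)// mmap0.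
Qed.

Lemma fmap_step phi lam f : fmap h (step phi lam f) = step (fmap h phi) (fmap h lam) (fmap h f).
Proof.
rewrite /step fmapB; congr (_ - _); apply: fam_ext => q A d.
rewrite {1}/fmap /rest /wsum mmap_sum; apply: eq_bigr => n _.
rewrite -[mmap h _]/(fmap h (_ *: _) q A d) fmapZ fmap_kill fmap_flow fmap_unitf fmapD.
by rewrite /adj fmap_star fmap_unitf.
Qed.

(** The construction of f only uses insertions and units, which a morphism of
operads preserves. *)
Lemma fmap_solution phi lam :
  fmap h (solution phi lam) = solution (fmap h phi) (fmap h lam).
Proof.
have ap n : fmap h (approx phi lam n) = approx (fmap h phi) (fmap h lam) n.
  by elim: n => [|n IH]; rewrite ?fmap0//= fmap_step IH.
apply: fam_ext => q A d; rewrite /solution -ap; by [].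
Qed.
End Naturality.

Section Binary.
Variables (K : fieldType) (P : operad K) (phi lam : fam P Wavy).
Local Notation fam := (fam P).
Implicit Types (q : deco) (A J I : {fset label}) (d e : int) (k l : kind) (n : nat).
Hypothesis H : input phi lam.
Hypothesis lam2 : forall q A d, #|` A| != 2%N -> lam q A d = 0.
Local Notation L := (adj lam).
Local Notation f := (solution phi lam).
Local Notation V := (field phi lam).
Local Notation zeta := (unitf P Wavy KZ).
Let rL := adj_reg H.
Let rf := solution_reg H.
Let rV := field_reg H.

(** When lambda is a Lie bracket, the bracket with y. *)
Definition ad (v : fam Wavy) : fam Wavy := star KZ 1 1 L (v : fam (kcol KZ)).

(** For a binary lambda, adj is linear in z and in y. *)
Lemma adj_out q A d :
  (forall s y, s != y -> q s = KZ -> q y = KY -> A <> [fset s; y]) -> L q A d = 0.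
Proof.
move=> hA; rewrite /adj (@star_unitr K P KZ KY 2 _ lam q A d (in_rlam H)).
rewrite big_seq_cond big1// => x /andP[xA /andP[_ /eqP qx]].
suff -> : lam (upd q x KZ) A d = 0 by rewrite scaler0.
have [c2|c2] := eqVneq #|` A| 2%N; last exact: lam2.
have c1 : #|` A `\ x| = 1%N by have := cardfsD1 x A; rewrite xA c2 => -[].
have /cardfs1P[z Az] : #|` A `\ x| == 1%N by apply/eqP.
have zA : z \in A `\ x by rewrite Az inE.
move: zA; rewrite !inE => /andP[zx zA].
apply: (in_lam_lacks H _ _ zA (erefl _)); rewrite /upd (negbTE zx) => qz.
apply: (hA z x) => //; apply/fsetP => w; rewrite !inE.
have /fsetP/(_ w) := Az; rewrite !inE; case: (eqVneq w x) => [->|_] /= h; first by rewrite xA orbT.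
by rewrite h orbF.
Qed.

Lemma adj_twoZ q A d s t : s != t -> s \in A -> t \in A -> q s = KZ -> q t = KZ -> L q A d = 0.
Proof.
move=> st sA tA qs qt; apply: adj_out => z y zy qz qy eA.
have zy' x : x \in A -> q x = KZ -> x = z.
  by rewrite eA !inE => /orP[/eqP//|/eqP ->]; rewrite qy.
by rewrite (zy' s)// (zy' t)// eqxx in st.
Qed.

Lemma ad_reg v : regular 1 v -> regular 1 (ad v).
Proof. by move=> rv; apply: (@star_regular _ _ KZ 1 1 _ _ _ rL rv). Qed.

Lemma adn_reg n v : regular 1 v -> regular 1 (iter n ad v).
Proof. by move=> rv; elim: n => //= n; apply: ad_reg. Qed.

(** Since adj is linear in z, its associator vanishes. *)
Lemma ad_star v w : regular 1 v -> regular 1 w ->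
  star KZ 1 1 (ad v) (w : fam (kcol KZ)) = ad (star KZ 1 1 v (w : fam (kcol KZ))).
Proof.
move=> rv rw; have rvw := @star_regular _ _ KZ 1 1 _ _ _ rv rw.
have r1 := @star_regular _ _ KZ 1 1 _ _ _ (ad_reg rv) rw.
have r2 := ad_reg rvw.
apply: fam_ext => q A d; have [dE|dE] := eqVneq d (1 - (od q A)%:Z); last first.
  by rewrite (reg_hom r1)// (reg_hom r2).
set n := fresh A; pose s : label := (Wavy, n); pose t : label := (Wavy, n.+1).
pose q' := upd (upd q s KZ) t KZ.
have st : s != t by apply/eqP => -[] /eqP; rewrite -[_ == _]/(n == n.+1) ltn_eqF.
have sA : s \notin A by apply: freshP.
have tA : t \notin A by apply: freshP; rewrite leqnSn.
have qs : q' s = KZ by rewrite /q' /upd (negbTE st) eqxx.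
have qt : q' t = KZ by rewrite /q' /upd eqxx.
have qq : {in A, q =1 q'}.
  by move=> x xA; rewrite /q' /upd; case: eqP => [e|_]; [rewrite -e xA in tA|case: eqP => // e; rewrite -e xA in sA].
rewrite (reg_ext _ r1 qq) (reg_ext _ r2 qq).
have dE' : d = 1 + 1 + 1 - (parity_of KZ)%:Z - (parity_of KZ)%:Z - (od q' A)%:Z.
  by rewrite dE (od_ext qq).
have := @star_assoc K P n n.+1 KZ KZ 1 1 1 _ L v w q' A d rL rv rw qs qt st sA tA dE'.
rewrite /ad => ->.
rewrite -[RHS]addr0; congr (_ + _).
rewrite /par_sum big1// => J _; rewrite big1// => J' _.
rewrite (@adj_twoZ _ _ _ s t)// ?ocomp0l ?ocomp0l ?scaler0//; last by rewrite !inE eqxx orbT.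
by rewrite !inE eqxx.
Qed.

Lemma adn_star n v w : regular 1 v -> regular 1 w ->
  star KZ 1 1 (iter n ad v) (w : fam (kcol KZ)) = iter n ad (star KZ 1 1 v (w : fam (kcol KZ))).
Proof.
by move=> rv rw; elim: n => //= n IH; rewrite ad_star ?IH//; apply: adn_reg.
Qed.

(** V is affine in z, with linear part ad, and f does not depend on z. *)
Lemma flow_binary n : flow V 1 n.+1 zeta = iter n ad V.
Proof.
elim: n => [|n IH]; first by rewrite (flow1 rV).
rewrite flowS IH adn_star// iterSr; congr (iter n ad _).
rewrite {1}/field starDl (star_lacks0 _ _ _ (solution_lacksZ H)) addr0; by [].
Qed.

Lemma kill_ad v : kill KZ (ad v) = ad (kill KZ v).
Proof.
apply: fam_ext => q A d; rewrite {1}/kill; case: hasP => [[x xA /eqP qx]|hA].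
  apply/esym; transitivity (star KZ 1 1 L (0 : fam (kcol KZ)) q A d); last by rewrite star0r.
  apply: star_eq => J JA s q' d1 d2; rewrite ocomp0r.
  have sA : s \notin A by apply: freshP.
  have q'x : q' x = KZ by rewrite /q' /upd; case: eqP.
  case: (boolP (x \in J)) => xJ.
    by rewrite /kill; case: hasP => [_|[]]; rewrite ?ocomp0r//; exists x => //; apply/eqP.
  rewrite (@adj_twoZ _ _ _ s x) ?ocomp0l// ?inE ?eqxx ?xJ ?xA ?orbT//; last by rewrite /q' updE.
  by apply: contraNneq sA => ->.
apply: star_eq => J JA s q' d1 d2; rewrite /kill; case: hasP => // -[x xJ /eqP qx].
case: hA; exists x; first exact: (fsubsetP JA).
move: qx; rewrite /q' /upd; case: eqP => [e|_ ->//].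
by have := freshP Wavy (leqnn (fresh A)); rewrite -[(_, _)]/s -e (fsubsetP JA).
Qed.

Lemma kill_field : kill KZ V = f.
Proof. by rewrite /field killD (kill_adj H) (kill_lacks (solution_lacksZ H)) add0r. Qed.

Lemma kill_flow_binary n : kill KZ (flow V 1 n.+1 zeta) = iter n ad f.
Proof. by rewrite flow_binary; elim: n => [|n IH] /=; rewrite ?kill_field// kill_ad IH. Qed.

Definition low N (a : fam Wavy) := forall q A d, (wt q A < N)%N -> a q A d = 0.

Lemma low_ad N v : low N v -> low N.+1 (ad v).
Proof.
move=> lv q A d hw; apply: (@star_wt0 _ _ _ _ _ _ _ _ _ _ _ 1 N) => // q' B d' hB.
by apply: adj_heavy; apply/eqP; rewrite -leqn0 -ltnS.
Qed.

Lemma low_adn n N v : low N v -> low (n + N) (iter n ad v).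
Proof. by move=> lv; elim: n => //= n IH; apply: low_ad. Qed.

Lemma low_f : low 1 f.
Proof. by move=> q A d hw; apply: (solution_heavy H); apply/eqP; rewrite -leqn0 -ltnS. Qed.

Lemma adn_sum n T (r : seq T) (x : T -> K) (a : T -> fam Wavy) :
  iter n ad (\sum_(i <- r) x i *: a i) = \sum_(i <- r) x i *: iter n ad (a i).
Proof.
elim: n => //= n ->; rewrite /ad star_sumr; apply: eq_bigr => i _; exact: starZr.
Qed.

Lemma adnB n a b : iter n ad (a - b) = iter n ad a - iter n ad b.
Proof. by elim: n => //= n ->; rewrite /ad starDr starNr. Qed.

(** The equation (exp (V d/dz) z) at z = 0 for an affine V: the power series
(e^t - 1) / t evaluated at ad, applied to f. *)
Lemma phi_binary N : low N (phi - \sum_(n < N) (n.+1`!%:R)^-1 *: iter n ad f).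
Proof.
move=> q A d hN; have lf n : (wt q A <= n)%N -> iter n ad f q A d = 0.
  by move=> h; apply: (low_adn (n := n) low_f); rewrite addn1.
have := congr1 (fun a : fam Wavy => a q A d) (solutionE H).
rewrite /= /step famB famB fam_sum /rest /wsum.
under [X in _ - X = _]eq_bigr => n n2.
  rewrite famZ -(prednK (ltnW n2)) kill_flow_binary; over.
set w := wt q A in hN lf *.
move=> /eqP; rewrite subr_eq => /eqP ->.
apply/eqP; rewrite subr_eq0; apply/eqP.
transitivity (\sum_(n < w) (n.+1`!%:R)^-1 *: iter n ad f q A d); last first.
  rewrite (big_ord_widen _ (fun n => (n.+1`!%:R)^-1 *: iter n ad f q A d) (ltnW hN)) big_mkcond.
  by apply: eq_bigr => i _; rewrite famZ; case: ltnP => // h; rewrite lf// scaler0.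
rewrite big_mkcond big_ord_recl /= add0r.
case: (w) lf => [|u] lf; first by rewrite !big_ord0 addr0; exact: (lf 0%N).
rewrite !big_ord_recl /= add0r invr1 scale1r; congr (_ + _).
Qed.

(** The power series t / (e^t - 1) evaluated at ad inverts [phi_binary]. *)
Lemma solution_bernoulli (B : nat -> K) (BE : bernoulli B) N q A d : (wt q A < N)%N ->
  f q A d = \sum_(k < N) (B k / k`!%:R) *: iter k ad phi q A d.
Proof.
move=> hN.
have lf n : (N <= n)%N -> iter n ad f q A d = 0.
  by move=> h; apply: (low_adn (n := n) low_f); rewrite addn1 ltnS ltnW// (leq_trans hN).
(* both series may be cut at N, since ad raises the weight *)
have ap (k : nat) : iter k ad phi q A d = \sum_(n < N) (n.+1`!%:R)^-1 *: iter (k + n) ad f q A d.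
  have /(_ q A d) := low_adn (n := k) (@phi_binary N).
  rewrite adnB adn_sum famB => /(_ (leq_trans hN (leq_addl _ _)))/eqP.
  rewrite subr_eq0 => /eqP ->; rewrite fam_sum; apply: eq_bigr => n _.
  by rewrite famZ iterD.
under eq_bigr => k _ do rewrite ap scaler_sumr.
transitivity (\sum_(k < N) \sum_(m < N | (k <= m)%N)
   (B k / k`!%:R / (m.+1 - k)`!%:R) *: iter m ad f q A d); last first.
  apply: eq_bigr => k _.
  pose F m := (B k / k`!%:R / (m.+1 - k)`!%:R) *: iter m ad f q A d.
  have kN : (k <= N)%N := ltnW (ltn_ord k).
  transitivity (\sum_(0 <= n < N) F (n + k)%N).
    have -> : \sum_(0 <= n < N) F (n + k)%N = \sum_(k <= m < N + k) F m.
      by rewrite (big_addn 0 _ k) addnK.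
    rewrite (@big_cat_nat _ _ _ N)//=; last exact: leq_addr.
    rewrite [X in _ + X]big_nat_cond [X in _ + X]big1 ?addr0; last first.
      by move=> m /andP[/andP[Nm _] _]; rewrite /F lf// scaler0.
    by rewrite big_geq_mkord.
  rewrite big_mkord; apply: eq_bigr => n _.
  by rewrite /F -addSn addnK scalerA (addnC k).
rewrite (exchange_big_dep xpredT)//=.
transitivity (\sum_(m < N) (m == 0 :> nat)%:R *: iter m ad f q A d).
  case: N hN {lf ap} => // N hN; rewrite big_ord_recl /= scale1r big1 ?addr0// => i _.
  by rewrite scale0r.
apply: eq_bigr => m _; rewrite -scaler_suml; congr (_ *: _).
have := BE m.+1; rewrite eqSS => <-.
rewrite (big_ord_widen N (fun (k : nat) => B k / k`!%:R / (m.+1 - k)`!%:R) (ltn_ord m)).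
by apply: eq_bigl => k.
Qed.
End Binary.

(** * The square over the Jacobi-Bernoulli morphism *)

Lemma sum_permutations (V : nmodType) (X : seq nat) (F : seq nat -> V) : uniq X -> X != [::] ->
  \sum_(xs <- permutations X) F xs =
  \sum_(x <- X) \sum_(ys <- permutations (rem x X)) F (x :: ys).
Proof.
move=> uX X0; rewrite -(big_allpairs_dep (h := fun (x : nat) ys => x :: ys) (F := F)) /=.
by rewrite (perm_big _ (permutationsE _)) ?undup_id// lt0n size_eq0.
Qed.

(** Both sides list the arrangements of 2, ..., n + 1 once each. *)
Lemma sum_perm_permutations (V : nmodType) n (F : seq nat -> V) :
  \sum_(s : 'S_n) F (rev [seq (s i : nat).+2 | i <- enum 'I_n]) =
  \sum_(xs <- permutations (iota 2 n)) F xs.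
Proof.
pose g (s : 'S_n) := rev [seq (s i : nat).+2 | i <- enum 'I_n].
have gi : injective g.
  move=> s t /(congr1 rev); rewrite !revK => /eq_in_map e; apply/permP => i.
  by have := e i (mem_enum _ i) => -[] /val_inj.
rewrite -(big_map g xpredT F); apply: perm_big; apply: uniq_perm.
- by rewrite map_inj_uniq// /index_enum -enumT enum_uniq.
- exact: permutations_uniq.
have gs : {subset [seq g s | s <- index_enum 'S_n] <= permutations (iota 2 n)}.
  move=> xs /mapP[s _ ->]; rewrite mem_permutations /g perm_rev.
  apply: uniq_perm; rewrite ?iota_uniq//.
    by rewrite map_inj_uniq ?enum_uniq// => i j [] /val_inj /perm_inj.
  move=> x; rewrite mem_iota; apply/mapP/idP => [[i _ ->]|/andP[h1 h2]].
    by have := ltn_ord (s i); lia.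
  have hx : (x.-2 < n)%N by move: h1 h2; lia.
  exists ((s^-1)%g (Ordinal hx)); first by rewrite mem_enum.
  by rewrite permKV /=; move: h1; lia.
suff h : (size (permutations (iota 2 n)) <= size [seq g s | s <- index_enum 'S_n])%N.
  have ug : uniq [seq g s | s <- index_enum 'S_n].
    by rewrite map_inj_uniq// /index_enum -enumT enum_uniq.
  by have [] := uniq_min_size ug gs h.
rewrite size_permutations ?iota_uniq// size_iota size_map /index_enum -enumT -cardE.
by rewrite card_Sn.
Qed.

Section Composite.
Variables (K : fieldType) (O P Q : operad K) (g : morphism P Q) (f : morphism O P).

Definition morphism_comp : morphism O Q.
Proof.
refine (@Morphism K O Q (fun A c d x => mmap g (mmap f x)) _ _ _ _).
- by move=> *; rewrite !mmap_linear.
- by move=> *; rewrite !mmap_unit.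
- by move=> *; rewrite !mmap_comp.
- by move=> *; rewrite !mmap_rel.
Defined.
End Composite.

Local Notation slot := ((Wavy, 0%N) : label).

Section BracketFormula.
Variables (K : fieldType) (P : operad K) (G : forall A d, P A Wavy d) (phi : fam P Wavy).
Local Notation fam := (fam P).
Local Notation lam := (pure G KZ).
Implicit Types (q : deco) (A J I : {fset label}) (d e : int) (k : kind) (n : nat).
Hypothesis H : input phi lam.
Hypothesis lam2 : forall q A d, #|` A| != 2%N -> lam q A d = 0.
Local Notation qs := (upd (cdeco KY) slot KZ).

(** The sign of [star_unitr] is trivial: the slot 0 precedes y, and moving the odd
variable past it cancels the sign of the odd substitution. *)
Lemma adj_bracket y d : y.1 = Wavy -> (0 < y.2)%N ->
  adj lam qs [fset slot; y] d = G [fset slot; y] d.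
Proof.
case: y => c i /= -> i0; set y : label := (Wavy, i).
have sy : slot != y by apply/eqP => -[] e; rewrite -e in i0.
have ys : y != slot by rewrite eq_sym.
have qy : qs y = KY by rewrite /upd (negbTE ys).
have sy' : slot \notin [fset y] by rewrite inE.
rewrite /adj (@star_unitr K P KZ KY 2 _ lam qs _ d (in_rlam H)).
rewrite big_mkcond big_fsetU_disj; last by rewrite fdisjoint1X.
rewrite !big_seq_fset1 qy updE /= add0r.
have -> : [fset slot; y] `\ y = [fset slot].
  by apply/fsetP => x; rewrite !inE; case: (eqVneq x y) => [->|]; rewrite ?(negbTE ys) ?orbF.
rewrite od1 updE /pure.
have -> : all (fun x => upd qs y KZ x == KZ) [fset slot; y].
  by apply/allP => x; rewrite !inE => /orP[] /eqP ->; rewrite ?updE// /upd (negbTE sy) eqxx.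
have -> : iv qs [fset y] [fset slot] = 0%N.
  by rewrite /iv !big_seq_fset1 qy.
have -> : iv (upd qs y KZ) [fset y] [fset slot] = 1%N.
  by rewrite /iv !big_seq_fset1 !updE /upd (negbTE sy) eqxx /lab_lt /= i0.
by rewrite /= -signr_odd /= scale1r.
Qed.

(** Only insertions that leave a single wavy input y beside the slot contribute,
and they give the bracket with y. *)
Lemma adE (v : fam Wavy) A : regular 1 v -> slot \notin A ->
  ad lam v (cdeco KY) A (1 - (od (cdeco KY) A)%:Z) =
  \sum_(y <- A | y.1 == Wavy)
     ocomp Wavy 0 (G [fset slot; y] 0)
       (v (cdeco KY) (A `\ y) (1 - (od (cdeco KY) A)%:Z)).
Proof.
move=> rv sA; set d := 1 - _.
have ra : regular 1 (ad lam v) := ad_reg H rv.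
have qq : {in A, cdeco KY =1 qs} by move=> x xA; rewrite (upd_out _ _ sA).
have qA B : B `<=` A -> {in B, qs =1 cdeco KY}.
  by move=> BA x xB; rewrite qq// (fsubsetP BA).
rewrite (reg_ext _ ra qq) /ad (@starE _ P KZ 1 1 _ _ _ qs _ 0 d (adj_reg H) rv (updE _ _ _) sA).
rewrite /star_sum sum_fpowersetD.
pose R (J : {fset label}) := (#|` J| == 1)%N && all (fun x => x.1 == Wavy) J.
rewrite (bigID R) /= [X in _ + X]big_seq_cond [X in _ + X]big1 ?addr0; last first.
  move=> J /andP[]; rewrite fpowersetE => JA /negP nR.
  rewrite (adj_out H lam2) ?ocomp0l ?scaler0// => s y sy qs0 qy.
  rewrite fsetDK// => e; apply: nR.
  have sJ : slot \notin J by apply: contra sA; apply: (fsubsetP JA).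
  have yJ : y \in J.
    have : y \in slot |` J by rewrite e !inE eqxx orbT.
    by rewrite !inE => /orP[/eqP ey|//]; move: qy; rewrite ey updE.
  have ss : s = slot.
    have : s \in slot |` J by rewrite e !inE eqxx.
    rewrite !inE => /orP[/eqP //|sJ']; move: qs0; rewrite (qA _ JA)// /cdeco; by case: (s.1).
  have eJ : J = [fset y].
    apply/fsetP => x; have /fsetP/(_ x) := e; rewrite ss !inE.
    case: (eqVneq x slot) => [->|_] /=; last by [].
    by rewrite (negbTE sJ) => _; apply/esym/negbTE; rewrite -ss.
  rewrite /R eJ cardfs1 /=; apply/allP => x; rewrite inE => /eqP ->.
  by move: qy; rewrite (qA _ JA)// /cdeco; case: (y.1).
rewrite (@big_fset_bij _ _ _ A _ (fun y => [fset y]) (fun y => y.1 == Wavy)); first last.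
- move=> J; rewrite fpowersetE /R; apply: (iffP andP).
    case=> JA /andP[/cardfs1P[y ey] h]; exists y; rewrite ey in JA h *; split=> //.
      by apply: (fsubsetP JA); rewrite inE.
    by apply: (allP h); rewrite inE.
  case=> y [yA y1 ->]; rewrite fsub1set cardfs1; split=> //.
  by apply/allP => x; rewrite inE => /eqP ->.
- by move=> x y _ _ _ _ /fset1_inj.
rewrite big_seq_cond [RHS]big_seq_cond; apply: eq_bigr => y /andP[yA /eqP y1].
have yA' : [fset y] `<=` A by rewrite fsub1set.
have DA : A `\` [fset y] `<=` A by apply: fsubsetDl.
have cy : cdeco KY y = KY by rewrite /cdeco y1.
have qy : qs y = KY by rewrite (qA _ yA') ?inE.
have ys : y != slot by apply: contraNneq sA => <-.
have y2 : (0 < y.2)%N by case: y y1 ys {yA yA' DA cy qy} => c [|i] //= ->.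
have odD : od qs (A `\` [fset y]) = od (cdeco KY) A.
  rewrite (od_ext (qA _ DA)) -[in RHS](fsetD_subU yA') odU ?od1 ?cy ?addn0//.
  exact: fdisjointDl.
have ods : od qs (slot |` [fset y]) = 1%N.
  by rewrite odU1 ?inE 1?eq_sym// updE od1 qy.
rewrite fsetDK// odD ods -/d.
have -> : ssign KZ 1 qs slot (A `\` [fset y]) [fset y] = 0%N.
  rewrite /ssign mul0n addn0 /iv big_seq_fset1 big_seq_fset1 qy muln0 add0n.
  by rewrite big1// => x _; rewrite big_seq_fset1 qy muln0.
rewrite scale1r (reg_ext _ rv (qA _ DA)).
congr (ocomp _ _ _ _); exact: adj_bracket.
Qed.
End BracketFormula.

Section Target.
Variable K : fieldType.
Local Notation P := (LP K).
Local Notation fam := (fam P).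
Implicit Types (q : deco) (A J I : {fset label}) (d e : int) (k : kind) (n : nat).

Definition phiP : fam Wavy := pure (LP_map K) KX.
Definition lamP : fam Wavy := pure (LP_bracketh K) KZ.

Lemma fmap_phiF : fmap (LP_projection K) (phiF K) = phiP.
Proof.
apply: fam_ext => q A d; rewrite /fmap /phiF /phiP /pure; case: ifP => _; last by rewrite mmap0.
exact: (lift_gen (no_relators (LP_projection_interp K)) (LPinf_phi : gen LPinf_sig)).
Qed.

Lemma fmap_lamF : fmap (LP_projection K) (lamF K KZ) = lamP.
Proof.
apply: fam_ext => q A d; rewrite /fmap /lamF /lamP /pure; case: ifP => _; last by rewrite mmap0.
exact: (lift_gen (no_relators (LP_projection_interp K)) (LPinf_lam : gen LPinf_sig)).
Qed.

Lemma input_P : input phiP lamP.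
Proof. by rewrite -fmap_phiF -fmap_lamF; apply/input_fmap/input_F. Qed.

Lemma bracketh_out A d : (nin A Straight != 0)%N || (nin A Wavy != 2)%N -> LP_bracketh K A d = 0.
Proof.
move=> h; apply: (@ival_out _ _ _ (gen_interp (@LP_rel K)) LP_brh); rewrite /valid /=.
by apply: contraL h => /andP[/andP[-> ->]].
Qed.

Lemma LPmap_out A d : (nin A Straight != 1)%N || (nin A Wavy != 0)%N -> LP_map K A d = 0.
Proof.
move=> h; apply: (@ival_out _ _ _ (gen_interp (@LP_rel K)) LP_phi); rewrite /valid /=.
by apply: contraL h => /andP[/andP[-> ->]].
Qed.

Lemma lamP2 q A d : #|` A| != 2%N -> lamP q A d = 0.
Proof.
move=> h; rewrite /lamP /pure; case: ifP => // _; apply: bracketh_out.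
by apply: contraR h; rewrite negb_or !negbK -nin_card => /andP[/eqP -> /eqP ->].
Qed.

Lemma ninD1 A y c : y \in A -> nin A c = ((y.1 == c) + nin (A `\ y) c)%N.
Proof.
move=> yA; rewrite /nin; have -> : [fset x in A `\ y | x.1 == c] = [fset x in A | x.1 == c] `\ y.
  by apply/fsetP => x; rewrite !inE andbA.
by rewrite (cardfsD1 y) !inE yA.
Qed.

Lemma adn_phi_out n A d : slot \notin A -> (nin A Straight != 1)%N || (nin A Wavy != n)%N ->
  iter n (ad lamP) phiP (cdeco KY) A d = 0.
Proof.
have rphi := in_rphi input_P.
elim: n A d => [|n IH] A d sA hA.
  by rewrite /phiP [LHS]/pure; case: ifP => // _; apply: LPmap_out.
have [->|dE] := eqVneq d (1 - (od (cdeco KY) A)%:Z); last first.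
  by apply: (reg_hom (adn_reg input_P n.+1 rphi)).
rewrite iterS (adE input_P lamP2 (adn_reg input_P n rphi) sA).
rewrite big_seq_cond big1// => y /andP[yA /eqP y1]; rewrite IH ?ocomp0r//.
  by apply: contra sA; rewrite !inE => /andP[].
by move: hA; rewrite !(ninD1 _ yA) y1 eqSS.
Qed.

Lemma nested_bracket_cons x xs A : nested_bracket K (x :: xs) A =
  ocomp Wavy 0 (LP_bracketh K [fset slot; (Wavy, x)] 0) (nested_bracket K xs (A `\ (Wavy, x))).
Proof. by []. Qed.

(** Applying ad once more brackets with one of the remaining wavy inputs, which
becomes the last entry of the nested bracket. *)
Lemma adn_phi (X : seq nat) A : uniq X -> 0%N \notin X ->
  (forall x, (x \in A) = (x == (Straight, 1%N)) || (x.1 == Wavy) && (x.2 \in X)) ->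
  iter (size X) (ad lamP) phiP (cdeco KY) A 0 = \sum_(xs <- permutations X) nested_bracket K xs A.
Proof.
have rphi := in_rphi input_P.
move Dn: (size X) => n; elim: n X A Dn => [|n IH] X A Dn uX X0 hA.
  move/size0nil: Dn hA => -> hA; rewrite (_ : permutations [::] = [:: [::] : seq nat]) // big_seq1.
  rewrite -[nested_bracket _ _ _]/(LP_map K A 0) [LHS]/phiP /pure; case: allP => // -[] x.
  by rewrite hA andbF orbF => /eqP ->.
have sA : slot \notin A by rewrite hA negb_or /= X0.
have nA : od (cdeco KY) A = 1%N.
  rewrite od_cdeco -(cardfs1 (Straight, 1%N) : #|` [fset ((Straight, 1%N) : label)]| = 1%N).
  congr #|` _|; apply/fsetP => -[c i]; rewrite !inE hA /=.
  by case: c; rewrite ?andbF ?orbF ?andbT.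
have d0 : 1 - (od (cdeco KY) A)%:Z = 0 :> int by rewrite nA.
have := adE input_P lamP2 (adn_reg input_P n rphi) sA; rewrite d0 iterS => ->.
rewrite sum_permutations//; last by apply/eqP => e; rewrite e in Dn.
rewrite (@sum_bij_seq _ nat label X A (fun x => (Wavy, x)) predT); first last.
- move=> y; rewrite hA; apply: (iffP andP).
    case=> /orP[/eqP ->//|/andP[_ h] /eqP y1]; exists y.2; split=> //.
    by rewrite -y1; case: (y).
  by case=> x [xX _ ->]; rewrite /= xX.
- by move=> x y _ _ _ _ [].
- exact: fset_uniq.
- exact: uX.
apply: eq_big_seq => x xX; rewrite (IH (rem x X)); last 4 first.
- by rewrite size_rem// Dn.
- exact: rem_uniq.
- by apply: contra X0; apply: mem_rem.
- move=> y; rewrite !inE hA mem_rem_uniq// inE.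
  case: (eqVneq y (Wavy, x)) => [->|h]; first by rewrite /= eqxx.
  case: (eqVneq y (Straight, 1%N)) => //= _; case: (eqVneq y.1 Wavy) => //= y1.
  suff -> : y.2 != x by [].
  by apply: contraNneq h => <-; rewrite -y1; case: (y).
rewrite ocomp_sumr; apply: eq_bigr => xs _; exact: esym (nested_bracket_cons x xs A).
Qed.

Variables (B : nat -> K) (BE : bernoulli B).
Variables (JB : morphism (HS K) P) (JBE : jacobi_bernoulli B JB).

Lemma HS_op_out A d : ~~ ((nin A Straight == 1)%N && (d == 0)) -> HS_op K A d = 0.
Proof. exact: (ival_out (gen_interp (@HS_rel K)) (g := HS_F : gen HS_sig)). Qed.

(** Both sides come from the same equivariance, so that it suffices to compare
them on standard inputs, where all terms but ad^n phi vanish for n wavy inputs. *)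
Lemma square_f A d :
  mmap (LP_projection K) (mmap (JBinf K) (HSinf_op K A d)) =
  mmap JB (mmap (HS_projection K) (HSinf_op K A d)).
Proof.
pose c := corolla (free_interp K) (HSinf_f : gen HSinf_sig).
have rc : regular 1 c by apply: corolla_reg => // -[].
have cc : coloured KY c by apply: corolla_coloured.
pose h1 := morphism_comp (LP_projection K) (JBinf K); pose h2 := morphism_comp JB (HS_projection K).
suff: fmap h1 c = fmap h2 c.
  move/(congr1 (fun a : fam Wavy => a (cdeco KY) A d)).
  by rewrite /fmap /c corolla_cdeco.
have cm (h : morphism (HSinf K) P) : coloured KY (fmap h c).
  by move=> q D d0 x xD hx; rewrite /fmap (cc _ _ _ _ xD)// mmap0.
apply: (@fam_std_ext _ _ KY 1) => //; try exact: fmap_reg.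
move=> m n D d0; have [nm nn] := nin_std m n; rewrite /d0 od_cdeco nm {d0 A d}.
set d := 1 - m%:Z.
rewrite /fmap /c corolla_cdeco -[mmap h1 _]/(mmap (LP_projection K) (mmap (JBinf K) (HSinf_op K D d))).
rewrite -[mmap h2 _]/(mmap JB (mmap (HS_projection K) (HSinf_op K D d))).
rewrite [mmap (HS_projection K) _](lift_gen (no_relators (HS_projection_interp K)) (HSinf_f : gen HSinf_sig)).
rewrite -[HS_projection_interp K _ _ _]/(HS_op K D d) JBinf_op /JBf.
rewrite -[mmap _ _]/(fmap (LP_projection K) (solution (phiF K) (lamF K KZ)) (cdeco KY) D d).
rewrite fmap_solution fmap_phiF fmap_lamF.
have sD : slot \notin D by rewrite in_std.
rewrite (solution_bernoulli input_P lamP2 BE (N := (wt (cdeco KY) D + n).+1)); last by rewrite ltnS leq_addr.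
have hn : (n < (wt (cdeco KY) D + n).+1)%N by rewrite ltnS leq_addl.
rewrite (bigD1 (Ordinal hn))//=  [X in _ + X]big1 ?addr0; last first.
  move=> k kn; rewrite adn_phi_out ?scaler0//; apply/orP; right.
  by rewrite nn; apply: contraNneq kn => e; apply/eqP/val_inj.
have [m1|m1] := eqVneq m 1%N; last first.
  by rewrite HS_op_out ?nm ?(negbTE m1)// mmap0 adn_phi_out ?scaler0// nm m1.
have dz : d = 0 by rewrite /d m1.
rewrite dz /D m1 -[std 1 n]/(labels Straight 1 1 `|` labels Wavy 2 n) (JBE.2 n); congr (_ *: _).
rewrite (sum_perm_permutations n (fun xs => nested_bracket K xs _)) -(adn_phi (X := iota 2 n)).
- by rewrite size_iota.
- exact: iota_uniq.
- by rewrite mem_iota.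
move=> x; rewrite !inE !in_labels mem_iota.
by case: x => -[] [|[|i]] //=.
Qed.

Lemma square_ell A d :
  mmap (LP_projection K) (mmap (JBinf K) (HSinf_ell K A d)) =
  mmap JB (mmap (HS_projection K) (HSinf_ell K A d)).
Proof.
pose c := corolla (free_interp K) (HSinf_l : gen HSinf_sig).
have rc : regular 2 c by apply: corolla_reg => // -[].
have cc : coloured KY c by apply: corolla_coloured.
pose h1 := morphism_comp (LP_projection K) (JBinf K); pose h2 := morphism_comp JB (HS_projection K).
suff: fmap h1 c = fmap h2 c.
  move/(congr1 (fun a : fam Straight => a (cdeco KY) A d)).
  by rewrite /fmap /c corolla_cdeco.
have cm (h : morphism (HSinf K) P) : coloured KY (fmap h c).
  by move=> q D d0 x xD hx; rewrite /fmap (cc _ _ _ _ xD)// mmap0.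
apply: (@fam_std_ext _ _ KY 2) => //; try exact: fmap_reg.
move=> m n D d0; have [nm nn] := nin_std m n; rewrite /d0 od_cdeco nm {d0 A d}.
set d := 2 - m%:Z.
rewrite /fmap /c corolla_cdeco -[mmap h1 _]/(mmap (LP_projection K) (mmap (JBinf K) (HSinf_ell K D d))).
rewrite -[mmap h2 _]/(mmap JB (mmap (HS_projection K) (HSinf_ell K D d))) JBinf_ell.
rewrite [mmap (HS_projection K) _](lift_gen (no_relators (HS_projection_interp K)) (HSinf_l : gen HSinf_sig)).
rewrite [LHS](lift_gen (no_relators (LP_projection_interp K)) (LPinf_l : gen LPinf_sig)).
rewrite -[HS_projection_interp K _ _ _]/(HS_bracket K D d) -[LHS]/(LP_bracketg K D d).
have [/andP[/eqP m2 /eqP n0]|hmn] := boolP ((m == 2) && (n == 0))%N.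
  have dz : d = 0 by rewrite /d m2.
  by rewrite dz /D m2 n0 std0r JBE.1.
have -> : HS_bracket K D d = 0.
  by apply: (ival_out (gen_interp (@HS_rel K)) (g := HS_br : gen HS_sig)); rewrite /valid /= nm nn (negbTE hmn).
rewrite mmap0; apply: (ival_out (gen_interp (@LP_rel K)) (g := LP_brg : gen LP_sig)).
by rewrite /valid /= nm nn (negbTE hmn).
Qed.

Lemma square A c d (x : HSinf K A c d) :
  mmap (LP_projection K) (mmap (JBinf K) x) = mmap JB (mmap (HS_projection K) x).
Proof.
apply: (@lift_unique _ _ _ _ (morphism_comp (LP_projection K) (JBinf K)) (morphism_comp JB (HS_projection K))).
by case=> D d0; [exact: square_ell|exact: square_f].
Qed.
End Target.

Theorem theorem4p2p1 (K : fieldType) (charK0 : [pchar K] =i pred0)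
    (dHS : differential (HSinf K)) (dHSE : HSinf_differential dHS)
    (dLP : differential (LPinf K)) (dLPE : LPinf_differential dLP)
    (B : nat -> K) (BE : bernoulli B)
    (JB : morphism (HS K) (LP K)) (JBE : jacobi_bernoulli B JB) :
  exists JBinf : morphism (HSinf K) (LPinf K),
    dg_morphism dHS dLP JBinf /\
    forall (A : {fset label}) (c : colour) (d : int) (x : HSinf K A c d),
      mmap (LP_projection K) (mmap JBinf x) = mmap JB (mmap (HS_projection K) x).
Proof.
exists (JBinf K); split; first exact (JBinf_dg charK0 dHSE dLPE).
by move=> A c d x; exact (square BE JBE x).
Qed.
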